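(* Let $X$ be a compact Hausdorff metrisable space and let $(A,\{\sigma_x\}_{x\in X})$ be a separable lower semi-continuous $C^*$-bundle over $X$ (separable meaning that the $C^*$-algebra $A$ is separable). Then there exist a Hilbert $C(X)$-module $\mathcal{E}$ and a $C(X)$-representation $\pi$ of $A$ in the continuous field $\mathcal{K}(\mathcal{E})$ such that for every $x\in X$ one has the isomorphism of $C^*$-algebras $$\pi_x(A)\simeq \sigma_x(A).$$
   Context: $C(X)$-algebra: for a compact Hausdorff space $X$, a $C(X)$-algebra is a $C^*$-algebra $A$ endowed with a unital $*$-morphism from $C(X)$ into the centre of the multiplier algebra $\mathcal{M}(A)$. For $x\in X$, $C_x(X)$ denotes the kernel of the evaluation map $ev_x:C(X)\to\mathbb{C}$ at $x$, and the fibre $A_x$ is the quotient of $A$ by the closed ideal $C_x(X)A$; the image of $a\in A$ in $A_x$ is denoted $a_x$. The $C(X)$-algebra $A$ is a continuous field of $C^*$-algebras over $X$ if $x\mapsto\|a_x\|$ is continuous for every $a\in A$. Faithful family of representations: a family $\{\sigma_\lambda\}_{\lambda\in\Lambda}$ of $*$-representations of a $C^*$-algebra $A$ such that for every nonzero $a\in A$ there is $\lambda\in\Lambda$ with $\sigma_\lambda(a)\neq 0$. Lower semi-continuous $C^*$-bundle over $X$: a pair $(A,\{\sigma_x\})$ where (a) $A$ is a $C(X)$-algebra; (b) $\{\sigma_x,\ x\in X\}$ is a faithful family of representations of the $C^*$-algebra $A$ such that for every $x\in X$ the representation $\sigma_x$ factorizes through the fibre $A_x$ (i.e. $\sigma_x$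 vanishes on $C_x(X)A$); (c) for each $a\in A$ the function $x\mapsto\|\sigma_x(a)\|$ is lower semi-continuous. For a Hilbert $C(X)$-module $\mathcal{E}$, $\mathcal{L}(\mathcal{E})$ is the $C^*$-algebra of adjointable $C(X)$-linear operators on $\mathcal{E}$ and $\mathcal{K}(\mathcal{E})$ is the ideal of compact operators, which is a continuous field of $C^*$-algebras over $X$ with $\mathcal{M}(\mathcal{K}(\mathcal{E}))=\mathcal{L}(\mathcal{E})$. For $x\in X$, $\mathcal{E}_x=\mathcal{E}\otimes_{ev_x}\mathbb{C}$ is the fibre Hilbert space and $\mathcal{M}(\mathcal{K}(\mathcal{E})_x)=\mathcal{L}(\mathcal{E}_x)$. $C(X)$-representation: a $C(X)$-representation of a $C(X)$-algebra $D$ in a continuous field of $C^*$-algebras $B$ over $X$ is a $C(X)$-linear $*$-morphism $\pi:D\to\mathcal{M}(B)$; for each $x\in X$ the induced representation $\pi_x$ of $D$ in $\mathcal{M}(B_x)$ factorizes through the fibre $D_x$. For $B=\mathcal{K}(\mathcal{E})$, $\pi:D\to\mathcal{L}(\mathcal{E})$ and $\pi_x:D\to\mathcal{L}(\mathcal{E}_x)$ is $d\mapsto \pi(d)\otimes_{ev_x}1$. *)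

(* Defs.v *)
From HB Require Import structures.
From mathcomp Require Import all_boot all_order all_algebra ring_quotient.
From mathcomp Require Import complex ring.
From mathcomp Require Import all_classical all_reals all_analysis.

Import Order.TTheory GRing.Theory Num.Theory numFieldNormedType.Exports.

Set Implicit Arguments.
Unset Strict Implicit.
Unset Printing Implicit Defensive.

Local Open Scope classical_set_scope.
Local Open Scope ring_scope.

(* Complex *-algebras, not assumed unital. The scalars are R[i], with R a
   model of the real numbers; ^* is complex conjugation. *)
HB.mixin Record isStarAlgebra (R : realType) A of GRing.Lmodule R[i] A := {
  smul : A -> A -> A ;
  star : A -> A ;
  smulA : forall a b c, smul a (smul b c) = smul (smul a b) c ;
  smulDl : forall a b c, smul (a + b) c = smul a c + smul b c ;
  smulDr : forall a b c, smul a (b + c) = smul a b + smul a c ;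
  smulZl : forall k a b, smul (k *: a) b = k *: smul a b ;
  smulZr : forall k a b, smul a (k *: b) = k *: smul a b ;
  starK : forall a, star (star a) = a ;
  starD : forall a b, star (a + b) = star a + star b ;
  starZ : forall k a, star (k *: a) = k^* *: star a ;
  starM : forall a b, star (smul a b) = smul (star b) (star a)
}.

#[short(type="starAlgType")]
HB.structure Definition StarAlgebra (R : realType) :=
  {A of GRing.Lmodule R[i] A & isStarAlgebra R A}.

HB.mixin Record isCStarAlgebra (R : realType) A
    of CompleteNormedModule R[i] A & StarAlgebra R A := {
  norm_smul : forall a b : A, `|smul a b| <= `|a| * `|b| ;
  norm_star_smul : forall a : A, `|smul (star a) a| = `|a| ^+ 2
}.

#[short(type="cstarAlgType")]
HB.structure Definition CStarAlgebra (R : realType) :=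
  {A of CompleteNormedModule R[i] A & StarAlgebra R A & isCStarAlgebra R A}.

Definition star_morphism (R : realType) (A B : starAlgType R) (f : A -> B) :=
  [/\ forall (k : R[i]) (a b : A), f (k *: a + b) = k *: f a + f b,
      forall a b : A, f (smul a b) = smul (f a) (f b)
    & forall a : A, f (star a) = star (f a)].

(* The *-subalgebras S of A and T of B are *-isomorphic. When they are
   C*-algebras this is isomorphism of C*-algebras: such a map is isometric. *)
Definition star_isomorphic (R : realType) (A B : starAlgType R)
    (S : set A) (T : set B) :=
  exists f : A -> B,
    [/\ set_bij S T f,
        forall (k : R[i]) (a b : A), S a -> S b ->
          f (k *: a + b) = k *: f a + f b,
        forall a b : A, S a -> S b -> f (smul a b) = smul (f a) (f b)
      & forall a : A, S a -> f (star a) = star (f a)].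

Section scalars.
Context (R : realType).
Local Notation C := (R[i]^o).

Fact scalar_smulZl (k a b : C) : (k *: a : C) * b = k *: (a * b : C) :> C.
Proof. by rewrite -[RHS]/(k * (a * b)) mulrA. Qed.

Fact scalar_smulZr (k a b : C) : a * (k *: b : C) = k *: (a * b : C) :> C.
Proof. by rewrite -[RHS]/(k * (a * b)) mulrCA. Qed.

Fact scalar_starM (a b : R[i]) : (a * b)^* = b^* * a^*.
Proof. by rewrite rmorphM mulrC. Qed.

HB.instance Definition _ := @isStarAlgebra.Build R R[i]^o
  (fun a b : R[i] => a * b) (fun a : R[i] => a^*) (@mulrA R[i]) (@mulrDl R[i])
  (@mulrDr R[i]) scalar_smulZl scalar_smulZr (@conjCK R[i])
  (@rmorphD _ _ (@Num.conj R[i])) (@rmorphM _ _ (@Num.conj R[i])) scalar_starM.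

End scalars.

Section continuous_functions.
Context (R : realType) (X : topologicalType).

Definition contC := continuousType X R[i]^o.

HB.instance Definition _ := Choice.on contC.

Implicit Types f g : contC.

Definition contC_of (f : X -> R[i]^o) (cf : continuous f) : contC := mkcts cf.

Lemma contCP f g : f =1 g -> f = g.
Proof. by move/continuousEP. Qed.

Lemma contC_cst (k : R[i]) : continuous (fun _ : X => k : R[i]^o).
Proof. by move=> x; exact: cvg_cst. Qed.

Lemma contCD f g : continuous (fun x => f x + g x : R[i]^o).
Proof. by move=> x; apply: cvgD; exact: cts_fun. Qed.

Lemma contCN f : continuous (fun x => - f x : R[i]^o).
Proof. by move=> x; apply: cvgN; exact: cts_fun. Qed.

Lemma contCM f g : continuous (fun x => (f x : R[i]) * g x : R[i]^o).
Proof. by move=> x; apply: cvgM; exact: cts_fun. Qed.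

Lemma contCJ f : continuous (fun x => (f x : R[i])^* : R[i]^o).
Proof.
move=> x; apply/cvgrPdist_lt => e e0.
have /cvgrPdist_lt/(_ e e0) := @cts_fun _ _ f x.
apply: filterS => y; rewrite -[X in X < _](@norm_conjC R[i]) rmorphB.
exact.
Qed.

Definition contC_0 : contC := contC_of (contC_cst (k := 0)).
Definition contC_1 : contC := contC_of (contC_cst (k := 1)).
Definition contC_add f g : contC := contC_of (contCD (f := f) (g := g)).
Definition contC_opp f : contC := contC_of (contCN (f := f)).
Definition contC_mul f g : contC := contC_of (contCM (f := f) (g := g)).
Definition contC_scale (k : R[i]) f : contC :=
  contC_mul (contC_of (contC_cst (k := k))) f.
Definition contC_conj f : contC := contC_of (contCJ (f := f)).

Fact contC_addA : associative contC_add.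
Proof. by move=> f g h; apply: contCP => x; exact: addrA. Qed.
Fact contC_addC : commutative contC_add.
Proof. by move=> f g; apply: contCP => x; exact: addrC. Qed.
Fact contC_add0 : left_id contC_0 contC_add.
Proof. by move=> f; apply: contCP => x; exact: add0r. Qed.
Fact contC_addN : left_inverse contC_0 contC_opp contC_add.
Proof. by move=> f; apply: contCP => x; exact: addNr. Qed.

HB.instance Definition _ :=
  GRing.isZmodule.Build contC contC_addA contC_addC contC_add0 contC_addN.

Fact contC_scaleA k l f :
  contC_scale k (contC_scale l f) = contC_scale (k * l) f.
Proof. by apply: contCP => x; exact: mulrA. Qed.
Fact contC_scale1 : left_id 1 contC_scale.
Proof. by move=> f; apply: contCP => x; exact: mul1r. Qed.
Fact contC_scaleDr : right_distributive contC_scale +%R.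
Proof. by move=> k f g; apply: contCP => x; exact: mulrDr. Qed.
Fact contC_scaleDl f : {morph contC_scale^~ f : a b / a + b}.
Proof. by move=> k l; apply: contCP => x; exact: mulrDl. Qed.

HB.instance Definition _ := GRing.Zmodule_isLmodule.Build R[i] contC
  contC_scaleA contC_scale1 contC_scaleDr contC_scaleDl.

Fact contC_mulA f g h :
  contC_mul f (contC_mul g h) = contC_mul (contC_mul f g) h.
Proof. by apply: contCP => x; exact: mulrA. Qed.
Fact contC_mulDl f g h : contC_mul (f + g) h = contC_mul f h + contC_mul g h.
Proof. by apply: contCP => x; exact: mulrDl. Qed.
Fact contC_mulDr f g h : contC_mul f (g + h) = contC_mul f g + contC_mul f h.
Proof. by apply: contCP => x; exact: mulrDr. Qed.
Fact contC_mulZl (k : R[i]) f g : contC_mul (k *: f) g = k *: contC_mul f g.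
Proof. by apply: contCP => x; apply/esym; exact: mulrA. Qed.
Fact contC_mulZr (k : R[i]) f g : contC_mul f (k *: g) = k *: contC_mul f g.
Proof. by apply: contCP => x; exact: mulrCA. Qed.
Fact contC_conjK f : contC_conj (contC_conj f) = f.
Proof. by apply: contCP => x; exact: conjCK. Qed.
Fact contC_conjD f g : contC_conj (f + g) = contC_conj f + contC_conj g.
Proof. by apply: contCP => x; exact: rmorphD. Qed.
Fact contC_conjZ (k : R[i]) f : contC_conj (k *: f) = k^* *: contC_conj f.
Proof. by apply: contCP => x; exact: rmorphM. Qed.
Fact contC_conjM f g :
  contC_conj (contC_mul f g) = contC_mul (contC_conj g) (contC_conj f).
Proof. by apply: contCP => x; exact: scalar_starM. Qed.

HB.instance Definition _ := @isStarAlgebra.Build R contC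
  contC_mul contC_conj contC_mulA contC_mulDl contC_mulDr contC_mulZl
  contC_mulZr
  contC_conjK contC_conjD contC_conjZ contC_conjM.

End continuous_functions.

Section multiplier_algebra.
Context (R : realType) (A : cstarAlgType R).

(* Double centralizers (L, R). Linearity and boundedness of the two maps
   follow from the defining identity. *)
Record multiplier := Multiplier {
  mult_l : A -> A ;
  mult_r : A -> A ;
  mult_lr : forall a b, smul a (mult_l b) = smul (mult_r a) b
}.

HB.instance Definition _ := gen_eqMixin multiplier.
HB.instance Definition _ := gen_choiceMixin multiplier.

Implicit Types m n p : multiplier.

Lemma multP m n : mult_l m =1 mult_l n -> mult_r m =1 mult_r n -> m = n.
Proof.
case: m n => [l r lr] [l' r' lr'] /= /funext el /funext er.
by rewrite el er in lr lr' *; congr Multiplier; exact: Prop_irrelevance.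
Qed.

Lemma smul0l (a : A) : smul 0 a = 0.
Proof. by rewrite -(scale0r (0 : A)) smulZl !scale0r. Qed.
Lemma smul0r (a : A) : smul a 0 = 0.
Proof. by rewrite -(scale0r (0 : A)) smulZr !scale0r. Qed.
Lemma smulNl (a b : A) : smul (- a) b = - smul a b.
Proof. by rewrite -scaleN1r smulZl scaleN1r. Qed.
Lemma smulNr (a b : A) : smul a (- b) = - smul a b.
Proof. by rewrite -scaleN1r smulZr scaleN1r. Qed.
Lemma star0 : star (0 : A) = 0.
Proof. by rewrite -(scale0r (0 : A)) starZ rmorph0 !scale0r. Qed.

Lemma smul_eq0 (a : A) : smul (star a) a = 0 -> a = 0.
Proof.
move=> e; apply/normr0_eq0/eqP; rewrite -sqrf_eq0 -norm_star_smul e.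
by rewrite normr0.
Qed.

Lemma smul_injr (b c : A) : (forall a, smul a b = smul a c) -> b = c.
Proof.
move=> e; apply/eqP; rewrite -subr_eq0; apply/eqP/smul_eq0.
by rewrite smulDr smulNr e subrr.
Qed.

Lemma smul_injl (b c : A) : (forall a, smul b a = smul c a) -> b = c.
Proof.
move=> e; rewrite -[b]starK -[c]starK; congr star; apply: smul_injr => a.
by rewrite -[a]starK -!starM e.
Qed.

Lemma mult_lD m a b : mult_l m (a + b) = mult_l m a + mult_l m b.
Proof. by apply: smul_injr => c; rewrite smulDr !mult_lr smulDr. Qed.
Lemma mult_rD m a b : mult_r m (a + b) = mult_r m a + mult_r m b.
Proof. by apply: smul_injl => c; rewrite smulDl -!mult_lr smulDl. Qed.
Lemma mult_lZ m (k : R[i]) a : mult_l m (k *: a) = k *: mult_l m a.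
Proof. by apply: smul_injr => c; rewrite smulZr !mult_lr smulZr. Qed.
Lemma mult_rZ m (k : R[i]) a : mult_r m (k *: a) = k *: mult_r m a.
Proof. by apply: smul_injl => c; rewrite smulZl -!mult_lr smulZl. Qed.

Fact mult_0_lr (a b : A) : smul a 0 = smul 0 b.
Proof. by rewrite smul0l smul0r. Qed.
Fact mult_opp_lr m a b : smul a (- mult_l m b) = smul (- mult_r m a) b.
Proof. by rewrite smulNl smulNr mult_lr. Qed.
Fact mult_add_lr m n a b :
  smul a (mult_l m b + mult_l n b) = smul (mult_r m a + mult_r n a) b.
Proof. by rewrite smulDl smulDr !mult_lr. Qed.
Fact mult_scale_lr (k : R[i]) m a b :
  smul a (k *: mult_l m b) = smul (k *: mult_r m a) b.
Proof. by rewrite smulZl smulZr mult_lr. Qed.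
Fact mult_mul_lr m n a b :
  smul a (mult_l m (mult_l n b)) = smul (mult_r n (mult_r m a)) b.
Proof. by rewrite !mult_lr. Qed.
Fact mult_star_lr m a b :
  smul a (star (mult_r m (star b))) = smul (star (mult_l m (star a))) b.
Proof. by rewrite -[a in LHS]starK -[b in RHS]starK -!starM mult_lr. Qed.

Definition mult_0 := @Multiplier (fun=> 0) (fun=> 0) mult_0_lr.
Definition mult_1 := @Multiplier id id (fun _ _ => erefl).
Definition mult_opp m := @Multiplier
  (fun a => - mult_l m a) (fun a => - mult_r m a) (mult_opp_lr m).
Definition mult_add m n := @Multiplier
  (fun a => mult_l m a + mult_l n a) (fun a => mult_r m a + mult_r n a)
  (mult_add_lr m n).
Definition mult_scale (k : R[i]) m := @Multiplier
  (fun a => k *: mult_l m a) (fun a => k *: mult_r m a) (mult_scale_lr k m).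
Definition mult_mul m n := @Multiplier
  (fun a => mult_l m (mult_l n a)) (fun a => mult_r n (mult_r m a))
  (mult_mul_lr m n).
Definition mult_star m := @Multiplier
  (fun a => star (mult_r m (star a))) (fun a => star (mult_l m (star a)))
  (mult_star_lr m).

Fact mult_addA : associative mult_add.
Proof. by move=> m n p; apply: multP => a; exact: addrA. Qed.
Fact mult_addC : commutative mult_add.
Proof. by move=> m n; apply: multP => a; exact: addrC. Qed.
Fact mult_add0 : left_id mult_0 mult_add.
Proof. by move=> m; apply: multP => a; exact: add0r. Qed.
Fact mult_addN : left_inverse mult_0 mult_opp mult_add.
Proof. by move=> m; apply: multP => a; exact: addNr. Qed.

HB.instance Definition _ :=
  GRing.isZmodule.Build multiplier mult_addA mult_addC mult_add0 mult_addN.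

Fact mult_scaleA k l m : mult_scale k (mult_scale l m) = mult_scale (k * l) m.
Proof. by apply: multP => a; exact: scalerA. Qed.
Fact mult_scale1 : left_id 1 mult_scale.
Proof. by move=> m; apply: multP => a; exact: scale1r. Qed.
Fact mult_scaleDr : right_distributive mult_scale +%R.
Proof. by move=> k m n; apply: multP => a; exact: scalerDr. Qed.
Fact mult_scaleDl m : {morph mult_scale^~ m : a b / a + b}.
Proof. by move=> k l; apply: multP => a; exact: scalerDl. Qed.

HB.instance Definition _ := GRing.Zmodule_isLmodule.Build R[i] multiplier
  mult_scaleA mult_scale1 mult_scaleDr mult_scaleDl.

Fact mult_mulA m n p : mult_mul m (mult_mul n p) = mult_mul (mult_mul m n) p.
Proof. exact: multP. Qed.
Fact mult_mulDl m n p : mult_mul (m + n) p = mult_mul m p + mult_mul n p.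
Proof. by apply: multP => // a; exact: mult_rD. Qed.
Fact mult_mulDr m n p : mult_mul m (n + p) = mult_mul m n + mult_mul m p.
Proof. by apply: multP => // a; exact: mult_lD. Qed.
Fact mult_mulZl (k : R[i]) m n : mult_mul (k *: m) n = k *: mult_mul m n.
Proof. by apply: multP => // a; exact: mult_rZ. Qed.
Fact mult_mulZr (k : R[i]) m n : mult_mul m (k *: n) = k *: mult_mul m n.
Proof. by apply: multP => // a; exact: mult_lZ. Qed.
Fact mult_starK m : mult_star (mult_star m) = m.
Proof. by apply: multP => a /=; rewrite !starK. Qed.
Fact mult_starD m n : mult_star (m + n) = mult_star m + mult_star n.
Proof. by apply: multP => a; exact: starD. Qed.
Fact mult_starZ (k : R[i]) m : mult_star (k *: m) = k^* *: mult_star m.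
Proof. by apply: multP => a; exact: starZ. Qed.
Fact mult_starM m n :
  mult_star (mult_mul m n) = mult_mul (mult_star n) (mult_star m).
Proof. by apply: multP => a /=; rewrite starK. Qed.

HB.instance Definition _ := @isStarAlgebra.Build R multiplier
  mult_mul mult_star mult_mulA mult_mulDl mult_mulDr mult_mulZl mult_mulZr
  mult_starK mult_starD mult_starZ mult_starM.

End multiplier_algebra.

Arguments mult_1 {R A}.
Arguments contC_1 {R X}.

Record CXAlgebra (R : realType) (X : topologicalType) := {
  cx_alg :> cstarAlgType R ;
  cx_mult : contC R X -> multiplier cx_alg ;
  cx_morph : star_morphism cx_mult ;
  cx_unital : cx_mult contC_1 = mult_1 ;
  cx_central : forall f m, smul (cx_mult f) m = smul m (cx_mult f)
}.

(* The product f a, for f in C(X) and a in A. *)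
Definition cx_act (R : realType) (X : topologicalType) (A : CXAlgebra R X)
  (f : contC R X) (a : A) : A := mult_l (cx_mult A f) a.

(* Definite sesquilinear pairings on V with values in the *-algebra B, linear
   in the second variable. Both Hilbert spaces (B = R[i]) and Hilbert
   C(X)-modules (B = C(X)) are of this form. *)
Record innerProduct (R : realType) (B : starAlgType R) (V : lmodType R[i]) := {
  ip :> V -> V -> B ;
  ip_linear : forall u (k : R[i]) v w,
    ip u (k *: v + w) = k *: ip u v + ip u w ;
  ip_star : forall u v, star (ip u v) = ip v u ;
  ip_definite : forall v, ip v v = 0 -> v = 0
}.

Section adjointable.
Context (R : realType) (B : starAlgType R) (V : lmodType R[i]).
Context (p : innerProduct B V).

(* Operators packed with their adjoint, which is unique. Being adjointable
   entails linearity over the scalars (over C(X) for a Hilbert C(X)-module) and,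
   when V is complete, boundedness. *)
Record adjointable := Adjointable {
  op :> V -> V ;
  adj : V -> V ;
  adjP : forall u v, p (op u) v = p u (adj v)
}.

HB.instance Definition _ := gen_eqMixin adjointable.
HB.instance Definition _ := gen_choiceMixin adjointable.

Implicit Types S T U : adjointable.

Lemma ipDr u v w : p u (v + w) = p u v + p u w.
Proof. by rewrite -[v]scale1r ip_linear !scale1r. Qed.
Lemma ip0r u : p u 0 = 0.
Proof. by apply: (addIr (p u 0)); rewrite -ipDr !add0r. Qed.
Lemma ipZr u (k : R[i]) v : p u (k *: v) = k *: p u v.
Proof. by rewrite -[k *: v]addr0 ip_linear ip0r addr0. Qed.
Lemma ipNr u v : p u (- v) = - p u v.
Proof. by rewrite -scaleN1r ipZr scaleN1r. Qed.
Lemma ipDl u v w : p (u + v) w = p u w + p v w.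
Proof. by rewrite -ip_star ipDr starD !ip_star. Qed.
Lemma ipZl (k : R[i]) u v : p (k *: u) v = k^* *: p u v.
Proof. by rewrite -ip_star ipZr starZ ip_star. Qed.
Lemma ipNl u v : p (- u) v = - p u v.
Proof. by rewrite -scaleN1r ipZl rmorphN1 scaleN1r. Qed.
Lemma ip0l u : p 0 u = 0.
Proof. by apply: (addIr (p 0 u)); rewrite -ipDl !add0r. Qed.

Lemma ip_injr v w : (forall u, p u v = p u w) -> v = w.
Proof.
move=> e; apply/eqP; rewrite -subr_eq0; apply/eqP/(@ip_definite _ _ _ p).
by rewrite ipDr ipNr e subrr.
Qed.

Lemma ip_injl v w : (forall u, p v u = p w u) -> v = w.
Proof. by move=> e; apply: ip_injr => u; rewrite -ip_star e ip_star. Qed.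

Lemma adjPl T u v : p (adj T u) v = p u (T v).
Proof. by rewrite -ip_star -adjP ip_star. Qed.

Lemma adjointableP S T : S =1 T -> S = T.
Proof.
move=> eo; have ea : adj S =1 adj T.
  by move=> v; apply: ip_injr => u; rewrite -!adjP eo.
case: S T eo ea => [t s ts] [t' s' ts'] /= /funext eo /funext ea.
by rewrite eo ea in ts ts' *; congr Adjointable; exact: Prop_irrelevance.
Qed.

Lemma adj_opD T u v : T (u + v) = T u + T v.
Proof. by apply: ip_injl => z; rewrite ipDl !adjP ipDl. Qed.
Lemma adj_opZ T (k : R[i]) u : T (k *: u) = k *: T u.
Proof. by apply: ip_injl => z; rewrite ipZl !adjP ipZl. Qed.

Fact adj_0P u v : p 0 v = p u 0.
Proof. by rewrite ip0l ip0r. Qed.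
Fact adj_oppP T u v : p (- T u) v = p u (- adj T v).
Proof. by rewrite ipNl ipNr adjP. Qed.
Fact adj_addP S T u v : p (S u + T u) v = p u (adj S v + adj T v).
Proof. by rewrite ipDl ipDr !adjP. Qed.
Fact adj_scaleP (k : R[i]) T u v : p (k *: T u) v = p u (k^* *: adj T v).
Proof. by rewrite ipZl ipZr adjP. Qed.
Fact adj_mulP S T u v : p (S (T u)) v = p u (adj T (adj S v)).
Proof. by rewrite !adjP. Qed.

Definition adj_0 := @Adjointable (fun=> 0) (fun=> 0) adj_0P.
Definition adj_opp T := @Adjointable
  (fun u => - T u) (fun u => - adj T u) (adj_oppP T).
Definition adj_add S T := @Adjointable
  (fun u => S u + T u) (fun u => adj S u + adj T u) (adj_addP S T).
Definition adj_scale (k : R[i]) T := @Adjointable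
  (fun u => k *: T u) (fun u => k^* *: adj T u) (adj_scaleP k T).
Definition adj_mul S T := @Adjointable
  (fun u => S (T u)) (fun u => adj T (adj S u)) (adj_mulP S T).
Definition adj_star T := @Adjointable (adj T) (op T) (adjPl T).

Fact adj_addA : associative adj_add.
Proof. by move=> S T U; apply: adjointableP => u; exact: addrA. Qed.
Fact adj_addC : commutative adj_add.
Proof. by move=> S T; apply: adjointableP => u; exact: addrC. Qed.
Fact adj_add0 : left_id adj_0 adj_add.
Proof. by move=> S; apply: adjointableP => u; exact: add0r. Qed.
Fact adj_addN : left_inverse adj_0 adj_opp adj_add.
Proof. by move=> S; apply: adjointableP => u; exact: addNr. Qed.

HB.instance Definition _ :=
  GRing.isZmodule.Build adjointable adj_addA adj_addC adj_add0 adj_addN.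

Fact adj_scaleA k l T : adj_scale k (adj_scale l T) = adj_scale (k * l) T.
Proof. by apply: adjointableP => u; exact: scalerA. Qed.
Fact adj_scale1 : left_id 1 adj_scale.
Proof. by move=> T; apply: adjointableP => u; exact: scale1r. Qed.
Fact adj_scaleDr : right_distributive adj_scale +%R.
Proof. by move=> k S T; apply: adjointableP => u; exact: scalerDr. Qed.
Fact adj_scaleDl T : {morph adj_scale^~ T : a b / a + b}.
Proof. by move=> k l; apply: adjointableP => u; exact: scalerDl. Qed.

HB.instance Definition _ := GRing.Zmodule_isLmodule.Build R[i] adjointable
  adj_scaleA adj_scale1 adj_scaleDr adj_scaleDl.

Fact adj_mulA S T U : adj_mul S (adj_mul T U) = adj_mul (adj_mul S T) U.
Proof. exact: adjointableP. Qed.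
Fact adj_mulDl S T U : adj_mul (S + T) U = adj_mul S U + adj_mul T U.
Proof. exact: adjointableP. Qed.
Fact adj_mulDr S T U : adj_mul S (T + U) = adj_mul S T + adj_mul S U.
Proof. by apply: adjointableP => u; exact: adj_opD. Qed.
Fact adj_mulZl (k : R[i]) S T : adj_mul (k *: S) T = k *: adj_mul S T.
Proof. exact: adjointableP. Qed.
Fact adj_mulZr (k : R[i]) S T : adj_mul S (k *: T) = k *: adj_mul S T.
Proof. by apply: adjointableP => u; exact: adj_opZ. Qed.
Fact adj_starK T : adj_star (adj_star T) = T.
Proof. exact: adjointableP. Qed.
Fact adj_starD S T : adj_star (S + T) = adj_star S + adj_star T.
Proof. exact: adjointableP. Qed.
Fact adj_starZ (k : R[i]) T : adj_star (k *: T) = k^* *: adj_star T.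
Proof. exact: adjointableP. Qed.
Fact adj_starM S T : adj_star (adj_mul S T) = adj_mul (adj_star T) (adj_star S).
Proof. exact: adjointableP. Qed.

HB.instance Definition _ := @isStarAlgebra.Build R adjointable
  adj_mul adj_star adj_mulA adj_mulDl adj_mulDr adj_mulZl adj_mulZr
  adj_starK adj_starD adj_starZ adj_starM.

End adjointable.

Record hilbertSpace (R : realType) := {
  hs_space :> completeNormedModType R[i] ;
  hs_ip : innerProduct (R[i]^o : starAlgType R) hs_space ;
  hs_norm : forall v, `|v| ^+ 2 = hs_ip v v
}.

(* c is the supremum norm of f, taken to be 0 when X is empty. *)
Definition is_sup_norm (R : realType) (X : topologicalType) (f : contC R X)
    (c : R[i]) :=
  [/\ 0 <= c, forall x, `|f x| <= c
    & forall d : R[i], 0 <= d -> (forall x, `|f x| <= d) -> c <= d].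

Record hilbertModule (R : realType) (X : topologicalType) := {
  hm_space :> completeNormedModType R[i] ;
  hm_ip : innerProduct (contC R X : starAlgType R) hm_space ;
  hm_ge0 : forall e x, (0 : R[i]) <= hm_ip e e x ;
  hm_norm : forall e, is_sup_norm (hm_ip e e) (`|e| ^+ 2) ;
  hm_act : hm_space -> contC R X -> hm_space ;
  hm_actDl : forall e e' f, hm_act (e + e') f = hm_act e f + hm_act e' f ;
  hm_actDr : forall e f g, hm_act e (f + g) = hm_act e f + hm_act e g ;
  hm_actZl : forall (k : R[i]) e f, hm_act (k *: e) f = k *: hm_act e f ;
  hm_actZr : forall (k : R[i]) e f, hm_act e (k *: f) = k *: hm_act e f ;
  hm_actA : forall e f g, hm_act e (smul f g) = hm_act (hm_act e f) g ;
  hm_act1 : forall e, hm_act e contC_1 = e ;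
  hm_ip_act : forall e e' f, hm_ip e (hm_act e' f) = smul (hm_ip e e') f
}.

Lemma complex_archi (R : realType) (e : R[i]) :
  0 < e -> exists n, 2^-1 ^+ n < e.
Proof.
move=> e0; have er : e = real_complex R (complex.Re e).
  by rewrite RRe_real// gtr0_real.
rewrite er in e0 *; move: e0; rewrite ltcR => e0.
have [n ne] : exists n : nat, (complex.Re e)^-1 < n%:R.
  by exists (Num.bound (complex.Re e)^-1); rewrite archi_boundP// invr_ge0 ltW.
exists n; have -> : (2^-1 : R[i]) = real_complex R 2^-1.
  by rewrite fmorphV rmorph_nat.
rewrite -rmorphXn ltcR exprVn invf_plt ?posrE ?exprn_gt0//.
by rewrite (lt_trans ne)// -natrX ltr_nat ltn_expl.
Qed.

(* The fibre of E at x, i.e. the interior tensor product of E with the scalars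
   along evaluation at x: the class of k *: e is the elementary tensor of e and
   k, and the inner product of the classes of e and f is <e, f>(x). The quotient
   by the null vectors is already complete. *)
Section fibre.
Context (R : realType) (X : topologicalType) (E : hilbertModule R X) (x : X).

Definition fibre_form (e f : E) : R[i] := hm_ip E e f x.

Local Notation sp := fibre_form.

Lemma fibre_formDr e f g : sp e (f + g) = sp e f + sp e g.
Proof. by rewrite /fibre_form ipDr. Qed.
Lemma fibre_formDl e f g : sp (e + f) g = sp e g + sp f g.
Proof. by rewrite /fibre_form ipDl. Qed.
Lemma fibre_formZr e (k : R[i]) f : sp e (k *: f) = k * sp e f.
Proof. by rewrite /fibre_form ipZr. Qed.
Lemma fibre_formZl e (k : R[i]) f : sp (k *: e) f = k^* * sp e f.
Proof. by rewrite /fibre_form ipZl. Qed.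
Lemma fibre_formNr e f : sp e (- f) = - sp e f.
Proof. by rewrite /fibre_form ipNr. Qed.
Lemma fibre_formNl e f : sp (- e) f = - sp e f.
Proof. by rewrite /fibre_form ipNl. Qed.
Lemma fibre_form0l e : sp 0 e = 0.
Proof. by rewrite /fibre_form ip0l. Qed.
Lemma fibre_form_conj e f : (sp e f)^* = sp f e.
Proof. by rewrite /fibre_form -(ip_star (hm_ip E) e f). Qed.
Lemma fibre_form_ge0 e : 0 <= sp e e.
Proof. exact: hm_ge0. Qed.

Lemma fibre_form_CS e f : `|sp e f| ^+ 2 <= sp e e * sp f f.
Proof.
set a := sp e e; set c := sp f f; set b := sp e f.
have a0 : 0 <= a := fibre_form_ge0 e; have c0 : 0 <= c := fibre_form_ge0 f.
have bb0 : 0 <= `|b| ^+ 2 by rewrite exprn_ge0.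
have quad (t : R[i]) : 0 <= t ->
    0 <= a - 2 * t * `|b| ^+ 2 + t ^+ 2 * `|b| ^+ 2 * c.
  move=> t0; have := fibre_form_ge0 (e + (- (t * b^*)) *: f).
  rewrite fibre_formDl !fibre_formDr !fibre_formZr !fibre_formZl.
  rewrite -(fibre_form_conj e f) -/a -/b -/c normCK.
  rewrite rmorphN rmorphM /= conjCK (CrealP (ger0_real t0)).
  suff -> : a + - (t * b^*) * b +
      (- (t * b) * b^* + - (t * b^*) * (- (t * b) * c)) =
    a - 2 * t * (b * b^*) + t ^+ 2 * (b * b^*) * c by [].
  by ring.
have [c00|cn0] := eqVneq c 0.
  have [->|bn0] := eqVneq b 0; first by rewrite normr0 expr0n mulr_ge0.
  have bb1 : `|b| ^+ 2 != 0 by rewrite sqrf_eq0 normr_eq0.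
  have /quad : 0 <= (a + 1) / `|b| ^+ 2 by rewrite divr_ge0 ?addr_ge0.
  rewrite c00 !mulr0 addr0 -mulrA divfK// => H.
  have : a - 2 * (a + 1) = - (a + 2) by ring.
  move=> E1; move: H; rewrite E1 oppr_ge0 => H.
  have : (0 : R[i]) < a + 2 by rewrite ltr_wpDl.
  by move/(le_lt_trans H); rewrite ltxx.
have cp : 0 < c by rewrite lt_def cn0.
have /quad : 0 <= c^-1 by rewrite invr_ge0.
have -> : a - 2 / c * `|b| ^+ 2 + c^-1 ^+ 2 * `|b| ^+ 2 * c = a - `|b| ^+ 2 / c.
  by field.
by rewrite subr_ge0 ler_pdivrMr.
Qed.

Lemma fibre_form_null e f : sp e e = 0 -> sp e f = 0.
Proof.
move=> e0; have := fibre_form_CS e f; rewrite e0 mul0r => H.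
by apply/eqP; rewrite -normr_eq0 -sqrf_eq0 eq_le H exprn_ge0.
Qed.

Definition fibre_null : {pred E} := [pred e | sp e e == 0].

Fact fibre_null_zmod : zmod_closed fibre_null.
Proof.
split=> [|e f]; rewrite !inE; first by rewrite fibre_form0l.
move=> /eqP e0 /eqP f0; rewrite fibre_formDl fibre_formNl.
by rewrite (fibre_form_null _ e0) (fibre_form_null _ f0) subrr.
Qed.

HB.instance Definition _ :=
  GRing.isZmodClosed.Build E fibre_null fibre_null_zmod.

Definition fibre_space := Quotient.quot fibre_null.

HB.instance Definition _ := GRing.Zmodule.on fibre_space.

Definition fibre_pi (e : E) : fibre_space :=
  \pi_(Quotient.quot fibre_null)%qT e.

Definition fibre_repr (q : fibre_space) : E := repr q.

Lemma fibre_reprK q : fibre_pi (fibre_repr q) = q.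
Proof. exact: reprK. Qed.

Lemma fibre_piP e f : fibre_pi e = fibre_pi f <-> sp (e - f) (e - f) = 0.
Proof.
split=> [/eqP|] H; first by apply/eqP; move: H; rewrite -Quotient.idealrBE.
by apply/eqP; rewrite /fibre_pi -Quotient.idealrBE inE H.
Qed.

Lemma fibre_piD e f : fibre_pi (e + f) = fibre_pi e + fibre_pi f.
Proof. by rewrite /fibre_pi !piE. Qed.

Lemma fibre_piN e : fibre_pi (- e) = - fibre_pi e.
Proof. by rewrite /fibre_pi !piE. Qed.

Definition fibre_scale (k : R[i]) (q : fibre_space) :=
  fibre_pi (k *: fibre_repr q).

Lemma fibre_piZ (k : R[i]) e : fibre_pi (k *: e) = fibre_scale k (fibre_pi e).
Proof.
apply/fibre_piP; rewrite -scalerBr fibre_formZl fibre_formZr.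
suff -> : sp (e - fibre_repr (fibre_pi e)) (e - fibre_repr (fibre_pi e)) = 0.
  by rewrite !mulr0.
by apply/fibre_piP; rewrite fibre_reprK.
Qed.

Fact fibre_scaleA k l q :
  fibre_scale k (fibre_scale l q) = fibre_scale (k * l) q.
Proof. by rewrite -(fibre_reprK q) -!fibre_piZ scalerA. Qed.
Fact fibre_scale1 : left_id 1 fibre_scale.
Proof. by move=> q; rewrite -(fibre_reprK q) -!fibre_piZ scale1r. Qed.
Fact fibre_scaleDr : right_distributive fibre_scale +%R.
Proof.
move=> k p q; rewrite -(fibre_reprK q) -(fibre_reprK p).
by rewrite -fibre_piD -!fibre_piZ -fibre_piD scalerDr.
Qed.
Fact fibre_scaleDl q : {morph fibre_scale^~ q : a b / a + b}.
Proof.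
by move=> k l; rewrite -(fibre_reprK q) -!fibre_piZ -fibre_piD scalerDl.
Qed.

HB.instance Definition _ := GRing.Zmodule_isLmodule.Build R[i] fibre_space
  fibre_scaleA fibre_scale1 fibre_scaleDr fibre_scaleDl.

Lemma fibre_piZE (k : R[i]) e : fibre_pi (k *: e) = k *: fibre_pi e.
Proof. exact: fibre_piZ. Qed.

Definition fibre_ip_fun (p q : fibre_space) : R[i]^o :=
  sp (fibre_repr p) (fibre_repr q).

Lemma fibre_ip_pi e f : fibre_ip_fun (fibre_pi e) (fibre_pi f) = sp e f.
Proof.
rewrite /fibre_ip_fun; set e' := fibre_repr _; set f' := fibre_repr _.
have /fibre_piP/fibre_form_null e0 : fibre_pi e' = fibre_pi e.
  by rewrite fibre_reprK.
have /fibre_piP/fibre_form_null f0 : fibre_pi f' = fibre_pi f.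
  by rewrite fibre_reprK.
rewrite -[e'](subrK e) fibre_formDl e0 add0r.
by rewrite -[f'](subrK f) fibre_formDr -fibre_form_conj f0 conjC0 add0r.
Qed.

Fact fibre_ip_linear u (k : R[i]) v w :
  fibre_ip_fun u (k *: v + w) = k *: fibre_ip_fun u v + fibre_ip_fun u w.
Proof.
rewrite -(fibre_reprK u) -(fibre_reprK v) -(fibre_reprK w).
rewrite -fibre_piZE -fibre_piD !fibre_ip_pi.
by rewrite fibre_formDr fibre_formZr.
Qed.

Fact fibre_ip_star u v : star (fibre_ip_fun u v) = fibre_ip_fun v u.
Proof. exact: fibre_form_conj. Qed.

Fact fibre_ip_definite v : fibre_ip_fun v v = 0 -> v = 0.
Proof.
rewrite -(fibre_reprK v) fibre_ip_pi => v0.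
have <- : fibre_pi 0 = 0.
  by apply: (addIr (fibre_pi 0)); rewrite -fibre_piD !add0r.
by apply/fibre_piP; rewrite subr0.
Qed.

Definition fibre_norm (q : fibre_space) : R[i] := sqrtC (fibre_ip_fun q q).

Lemma fibre_norm_ge0 q : 0 <= fibre_norm q.
Proof. by rewrite sqrtC_ge0 fibre_form_ge0. Qed.

Lemma fibre_normK q : fibre_norm q ^+ 2 = fibre_ip_fun q q.
Proof. exact: sqrtCK. Qed.

Fact fibre_normD p q : fibre_norm (p + q) <= fibre_norm p + fibre_norm q.
Proof.
have nn := fibre_norm_ge0.
rewrite -(@ler_pXn2r _ 2%N)// ?nnegrE ?addr_ge0// sqrrD !fibre_normK.
rewrite -(fibre_reprK p) -(fibre_reprK q) -fibre_piD !fibre_ip_pi.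
set e := fibre_repr p; set f := fibre_repr q.
rewrite fibre_formDl !fibre_formDr addrA lerD2r -!addrA lerD2l.
have b_le : `|sp e f| <= fibre_norm (fibre_pi e) * fibre_norm (fibre_pi f).
  rewrite -(@ler_pXn2r _ 2%N)// ?nnegrE ?mulr_ge0//.
  by rewrite exprMn !fibre_normK !fibre_ip_pi fibre_form_CS.
have b_real : sp e f + sp f e \is Num.real.
  by rewrite CrealE rmorphD /= !fibre_form_conj addrC.
apply: le_trans (real_ler_norm b_real) _; apply: le_trans (ler_normD _ _) _.
rewrite mulr2n lerD// -fibre_form_conj norm_conjC//.
Qed.

Fact fibre_normZ (k : R[i]) q : fibre_norm (k *: q) = `|k| * fibre_norm q.
Proof.
apply/eqP; rewrite -(@eqrXn2 _ 2%N)// ?mulr_ge0 ?fibre_norm_ge0//.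
rewrite exprMn !fibre_normK -(fibre_reprK q) -fibre_piZE !fibre_ip_pi.
by rewrite fibre_formZl fibre_formZr mulrA normCKC.
Qed.

Fact fibre_norm0_eq0 q : fibre_norm q = 0 -> q = 0.
Proof.
by move=> q0; apply: fibre_ip_definite; rewrite -fibre_normK q0 expr0n.
Qed.

HB.instance Definition _ := Lmodule_isNormed.Build R[i] fibre_space
  fibre_normD fibre_normZ fibre_norm0_eq0.

Lemma fibre_norm_pi e : `|fibre_pi e| ^+ 2 = sp e e.
Proof. by rewrite -[`|_|]/(fibre_norm _) fibre_normK fibre_ip_pi. Qed.

Lemma fibre_norm_le e : `|fibre_pi e| <= `|e|.
Proof.
rewrite -(@ler_pXn2r _ 2%N)// ?nnegrE// fibre_norm_pi.
have [_ /(_ x) + _] := hm_norm e; apply: le_trans.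
by rewrite ger0_norm// fibre_form_ge0.
Qed.

Lemma fibre_lift (q : fibre_space) : exists2 e, fibre_pi e = q & `|e| <= `|q|.
Proof.
rewrite -(fibre_reprK q); set e := fibre_repr q; set t := sp e e.
have : 0 <= t := fibre_form_ge0 e.
rewrite le_eqVlt => /predU1P[/esym t0|t0].
  exists 0; last by rewrite normr0.
  by apply/fibre_piP; rewrite sub0r fibre_formNl fibre_formNr -/t t0 !oppr0.
have den_gt0 y : 0 < t + hm_ip E e e y by rewrite ltr_wpDr// hm_ge0.
have cf : continuous (fun y => (2 * t) * (t + hm_ip E e e y)^-1 : R[i]^o).
  move=> y; apply: cvgM; first exact: cvg_cst.
  apply: cvgV; first exact: lt0r_neq0.
  by apply: cvgD; [exact: cvg_cst|exact: cts_fun].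
pose f : contC R X := contC_of cf.
have f_real y : (f y : R[i])^* = f y.
  apply: CrealP; apply: ger0_real.
  by rewrite mulr_ge0 ?mulr_ge0 ?invr_ge0 ?ltW.
have ipl h : hm_ip E (hm_act e f) h = smul f (hm_ip E e h).
  rewrite -ip_star hm_ip_act starM ip_star; congr smul.
  by apply: contCP => y; exact: f_real.
have fx : f x = 1 :> R[i].
  have -> : f x = (2 * t) / (t + t) :> R[i] by [].
  by rewrite mulr_natl mulr2n divff// gt_eqF// addr_gt0.
exists (hm_act e f).
  apply/fibre_piP; rewrite fibre_formDl fibre_formNl {1}/fibre_form ipl.
  by rewrite -[X in X - _]/(f x * sp e _) fx mul1r subrr.
rewrite -(@ler_pXn2r _ 2%N)// ?nnegrE// fibre_norm_pi -/t.
have [_ _] := hm_norm (hm_act e f); apply; first exact: ltW.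
move=> y; rewrite ipl hm_ip_act.
rewrite -[X in `|X| <= _]/
  ((f y : R[i]) * ((hm_ip E e e y : R[i]) * (f y : R[i]))).
have g0 : (0 : R[i]) <= hm_ip E e e y := hm_ge0 e y.
have -> : f y = (2 * t) / (t + hm_ip E e e y) :> R[i] by [].
move: g0 (den_gt0 y); set g : R[i] := hm_ip E e e y => g0 d0.
rewrite ger0_norm; last first.
  by rewrite !mulr_ge0 ?invr_ge0 ?(ltW t0) ?(ltW d0).
have -> : 2 * t / (t + g) * (g * (2 * t / (t + g))) =
    t * (4 * t * g) / (t + g) ^+ 2.
  by field; rewrite gt_eqF.
rewrite ler_pdivrMr ?exprn_gt0// ler_wpM2l ?(ltW t0)// -subr_ge0.
have -> : (t + g) ^+ 2 - 4 * t * g = (t - g) ^+ 2 by ring.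
by rewrite real_exprn_even_ge0// realB// ger0_real// ltW.
Qed.

Fact fibre_complete (F : set_system fibre_space) :
  ProperFilter F -> cauchy F -> cvg F.
Proof.
move=> FF /cauchyP F_cauchy.
pose eps n : R[i] := 2^-1 ^+ n.
have eps0 n : 0 < eps n by rewrite exprn_gt0// invr_gt0.
have epsS n : eps n.+1 + eps n.+1 = eps n.
  rewrite /eps exprS -mulrDl; have -> : 2^-1 + 2^-1 = 1 :> R[i] by field.
  by rewrite mul1r.
have eps_le n m : (n <= m)%N -> eps m <= eps n.
  by move=> nm; rewrite ler_wiXn2l// ?invr_ge0// invf_le1// ler1n.
have [p Fp] : {p : nat -> fibre_space & forall n, F (ball (p n) (eps n))}.
  by apply: (@choice _ _ (fun n q => F (ball q (eps n)))) => n; exact: F_cauchy.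
have p_dist n : `|p n.+1 - p n| <= eps n + eps n.
  have [q [qn qm]] := filter_ex (filterI (Fp n.+1) (Fp n)).
  move: qn qm; rewrite -!ball_normE /= => qn qm.
  rewrite -[_ - _](subrKA q) (le_trans (ler_normD _ _))// lerD//.
    by rewrite (le_trans (ltW qn))// eps_le.
  by rewrite distrC ltW.
have [d d_pi d_norm] : exists2 d : nat -> E,
    forall n, fibre_pi (d n) = p n.+1 - p n &
    forall n, `|d n| <= eps n + eps n.
  have /choice [d dP] : forall n, exists e : E,
      fibre_pi e = p n.+1 - p n /\ `|e| <= eps n + eps n.
    move=> n; have [e e_pi e_norm] := fibre_lift (p n.+1 - p n).
    by exists e; split=> //; exact: le_trans (p_dist n).
  by exists d => n; case: (dP n).
pose z := fix z n := if n is m.+1 then z m + d m else fibre_repr (p 0).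
have z_pi n : fibre_pi (z n) = p n.
  elim: n => [|n IH] /=; first exact: fibre_reprK.
  by rewrite fibre_piD IH d_pi addrC subrK.
have z_dist n k : `|z (n + k)%N - z n| <= (eps n - eps (n + k)%N) *+ 4.
  elim: k => [|k IH]; first by rewrite addn0 !subrr normr0 mul0rn.
  rewrite addnS /= addrAC (le_trans (ler_normD _ _))//.
  apply: le_trans (lerD IH (d_norm _)) _.
  rewrite -(epsS (n + k)%N) le_eqVlt; apply/orP; left; apply/eqP.
  by ring.
have eps_small (e : R[i]) : 0 < e -> exists n, eps n < e.
  move=> e0; exact: complex_archi.
have z_cauchy : cauchy (z @ \oo).
  apply/cauchy_exP => e e0.
  have [n en] : exists n, eps n < e / 4 by apply: eps_small; rewrite divr_gt0.
  exists (z n); exists n => //= m nm; rewrite -ball_normE /= distrC.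
  rewrite -(subnKC nm); apply: le_lt_trans (z_dist n _) _.
  rewrite -mulr_natr -ltr_pdivlMr//; apply: le_lt_trans en.
  by rewrite gerBl ltW.
have zl : z @ \oo --> lim (z @ \oo) by exact: (cauchy_cvg _ z_cauchy).
set l := lim (z @ \oo) in zl.
apply: (cvgP (fibre_pi l)); apply/cvgrPdist_lt => e e0.
have e2 : 0 < e / 2 by rewrite divr_gt0.
have [n en] := eps_small _ e2.
have [m nm lm] : exists2 m, (n <= m)%N & `|l - z m| < e / 2.
  have /cvgrPdist_lt/(_ _ e2)[N _ H] := zl.
  by exists (maxn n N); [exact: leq_maxl|apply: H; rewrite /= leq_maxr].
apply: filterS (Fp m) => q; rewrite -ball_normE /= => pq.
rewrite -[_ - _](subrKA (p m)) [e]splitr (le_lt_trans (ler_normD _ _))// ltrD//.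
  rewrite -z_pi -fibre_piN -fibre_piD.
  exact: le_lt_trans (fibre_norm_le _) lm.
by apply: lt_trans pq _; apply: le_lt_trans en; exact: eps_le.
Qed.

HB.instance Definition _ := Uniform_isComplete.Build fibre_space fibre_complete.

Definition fibre_ip : innerProduct (R[i]^o : starAlgType R) fibre_space :=
  Build_innerProduct fibre_ip_linear fibre_ip_star fibre_ip_definite.

Definition fibre : hilbertSpace R :=
  Build_hilbertSpace (hs_ip := fibre_ip) fibre_normK.

End fibre.

(* The operator induced by T on the fibre at x. *)
Section fibre_op.
Context (R : realType) (X : topologicalType) (E : hilbertModule R X).
Context (T : adjointable (hm_ip E)) (x : X).

Fact fibre_opP (p q : fibre E x) :
  hs_ip (fibre E x) (fibre_pi x (T (fibre_repr p))) q =
  hs_ip (fibre E x) p (fibre_pi x (adj T (fibre_repr q))).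
Proof.
rewrite -[hs_ip _]/(fibre_ip E x) /=.
rewrite -{1}(fibre_reprK q) -{2}(fibre_reprK p) !fibre_ip_pi.
by rewrite /fibre_form adjP.
Qed.

Definition fibre_op : adjointable (hs_ip (fibre E x)) :=
  @Adjointable _ _ _ (hs_ip (fibre E x))
    (fun q => fibre_pi x (T (fibre_repr q)))
    (fun q => fibre_pi x (adj T (fibre_repr q))) fibre_opP.

Lemma fibre_op_pi (e : E) : fibre_op (fibre_pi x e) = fibre_pi x (T e).
Proof.
apply: (@ip_injl _ _ _ (hs_ip (fibre E x))) => q; rewrite adjP.
rewrite -[hs_ip _]/(fibre_ip E x) /= -(fibre_reprK q) !fibre_ip_pi fibre_reprK.
by rewrite /fibre_form adjP.
Qed.

End fibre_op.

(* Operator norm, as an extended real. *)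
Definition opnorm (R : realType) (H : hilbertSpace R)
    (T : adjointable (hs_ip H)) : \bar R :=
  ereal_sup [set (complex.Re `|T h|)%:E | h in [set h : H | `|h| <= 1]].

Record lsc_bundle (R : realType) (X : topologicalType) (A : CXAlgebra R X)
    (H : X -> hilbertSpace R) (sigma : forall x, A -> adjointable (hs_ip (H x)))
    : Prop := {
  lscb_morph : forall x, star_morphism (sigma x) ;
  lscb_faithful : forall a : A, a <> 0 -> exists x, sigma x a <> 0 ;
  lscb_fibre : forall x (f : contC R X) (a : A),
    f x = 0 -> sigma x (cx_act f a) = 0 ;
  lscb_lsc : forall a : A, lower_semicontinuous (fun x => opnorm (sigma x a))
}.

(* C(X)-representations of A in the field K(E) of compact operators, whose
   multiplier algebra is L(E). *)
Definition CX_representation (R : realType) (X : topologicalType)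
    (A : CXAlgebra R X) (E : hilbertModule R X)
    (pi : A -> adjointable (hm_ip E)) :=
  star_morphism pi /\
  forall (f : contC R X) (a : A) (e : E), pi (cx_act f a) e = hm_act (pi a e) f.

Definition induced_rep (R : realType) (X : topologicalType)
    (A : CXAlgebra R X) (E : hilbertModule R X)
    (pi : A -> adjointable (hm_ip E)) (x : X) :
  A -> adjointable (hs_ip (fibre E x)) := fun a => fibre_op (pi a) x.

Definition metrizable (R : realType) (X : topologicalType) :=
  exists d : X -> X -> R,
    [/\ forall x y, d x y = 0 <-> x = y,
        forall x y, d x y = d y x,
        forall x y z, d x z <= d x y + d y z
      & forall x (U : set X), nbhs x U <->
          exists2 r, 0 < r & [set y | d x y < r] `<=` U].

Definition separable_space (T : topologicalType) :=
  exists D : set T, countable D /\ dense D.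

(* Main.v *)
(* Let Q_x be the closed convex set of functionals generated by the vector
   functionals <h, sigma_x(.) h> with |h| <= 1. Lower semicontinuity of the norms
   |sigma_x(a)| makes the largest values of self-adjoint elements on Q_x lower
   semicontinuous as well, hence, by Hahn-Banach in finite dimension, x |-> Q_x is
   a weak-* lower semicontinuous multifunction. As A is separable, Michael's
   selection argument applies: through every point of Q_x0 passes a field phi of
   functionals phi_x in Q_x with x |-> phi_x(a) continuous for all a. Such a field
   defines a C(X)-valued form phi(a^* b) on A; let E be the completion of the
   algebraic direct sum of these pre-Hilbert modules over all phi, and pi the
   action of A by left multiplication. Then pi_x is a sum of GNS representations
   of elements of Q_x, in which all vector functionals occur, so pi_x and sigma_x
   have the same kernel and hence isomorphic images. *)

Require Import Defs.
From HB Require Import structures.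
From mathcomp Require Import all_boot all_order all_algebra.
From mathcomp Require Import complex finmap ring lra.
From mathcomp Require Import all_classical all_reals all_analysis.

Import Order.TTheory GRing.Theory Num.Theory numFieldNormedType.Exports.

Set Implicit Arguments.
Unset Strict Implicit.
Unset Printing Implicit Defensive.

Local Open Scope classical_set_scope.
Local Open Scope ring_scope.

(** * Limits *)

(** Lower semicontinuity is given for norms of elements of [A], whereas the top of the numerical
    range of a self-adjoint [b] is read off from the norm of [b + M], which need not lie in [A]. The
    elements [b (b + M)^n] do lie in [A], and their norms grow like the n-th power of the top of
    [b + M], up to factors independent of [n]. Only nonnegative tops are caught in this way; that is
    enough because every Q_x contains 0. The sets Q_x are never formed. The functionals [psi s] with
    [mass s <= 1] make up a convex set with closure Q_x; the selection needs no more than this set,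
    and linearity, positivity and vanishing on the kernel of [sigma_x] pass to limits. What is
    selected is the sequence of values on a dense sequence of [A]; a bound common to all functionals
    then extends them to [A]. That bound is twice the norm of [a] instead of the norm itself,
    because the square root of [1 - b] is built by an iteration run for [b] of norm at most 1/2.
    Only boundedness matters later. *)

Lemma small_norm_eq0 (R : realType) (z C : R[i]) :
  (forall e : R[i], 0 < e -> `|z| <= C * e) -> z = 0.
Proof.
move=> zC; apply/eqP; rewrite -normr_eq0 eq_le normr_ge0 andbT.
have C0 : 0 <= C by have := zC 1 ltr01; rewrite mulr1; exact: le_trans.
have C1 : 0 < C + 1 by rewrite ltr_wpDl.
rewrite real_leNgt ?normr_real// ; apply/negP => z0.
have z2 : 0 < `|z| / (C + 1) / 2 by rewrite !divr_gt0.
have : `|z| <= `|z| / 2.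
  apply: le_trans (zC _ z2) _; rewrite [X in X <= _]mulrA ler_pM2r ?invr_gt0//.
  by rewrite mulrCA ger_pMr// ler_pdivrMr// mul1r lerDl.
by rewrite ler_pMr// lt_geF// invf_lt1// ltr1n.
Qed.

Lemma small_norm_eq0_le1 (R : realType) (z C : R[i]) :
  (forall e : R[i], 0 < e -> e <= 1 -> `|z| <= C * e) -> z = 0.
Proof.
move=> zC; apply: (@small_norm_eq0 _ _ C) => e e0.
have [e1|e1] := real_leP (gtr0_real e0) (real1 _); first exact: zC.
have z1 := zC 1 ltr01 (lexx _).
have C0 : 0 <= C by have := le_trans (normr_ge0 _) z1; rewrite mulr1.
by apply: le_trans z1 _; rewrite mulr1 ler_peMr// ltW.
Qed.

(** The order of [R[i]] is partial and [0 <= z] also asserts that [z] is real, so refuting [z < 0]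
    would not do. Instead [z] is compared with its modulus: [w] equals its own modulus, so both are
    within [e] of [w]. *)
Lemma near_ge0 (R : realType) (z : R[i]) :
  (forall e : R[i], 0 < e -> exists2 w, 0 <= w & `|w - z| <= e) -> 0 <= z.
Proof.
move=> zw; suff -> : z = `|z| by [].
apply/eqP; rewrite -subr_eq0; apply/eqP; apply: (@small_norm_eq0 _ _ 2) => e e0.
have [w w0 wz] := zw e e0.
rewrite -(subrKA w) (le_trans (ler_normD _ _))// mulr_natl mulr2n lerD//.
  by rewrite distrC.
by rewrite -{1}(ger0_norm w0) (le_trans (ler_dist_dist _ _)).
Qed.

(** The restriction to [e <= 1] allows errors quadratic in [e], as they arise for inner products of
    approximants, to be bounded linearly. *)
Lemma le_of_near (R : realType) (a b C : R[i]) : 0 <= C ->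
  (forall e : R[i], 0 < e -> e <= 1 -> a <= b + C * e) -> a <= b.
Proof.
move=> C0 abC; rewrite -subr_ge0; apply: near_ge0 => e e0.
have D0 : 0 < C + 1 + e by rewrite addr_gt0// ltr_wpDl.
have d0 : 0 < e / (C + 1 + e) by rewrite divr_gt0.
exists (b + C * (e / (C + 1 + e)) - a).
  by rewrite subr_ge0 abC// ler_pdivrMr// mul1r lerDr addr_ge0.
have -> : b + C * (e / (C + 1 + e)) - a - (b - a) = C * (e / (C + 1 + e)) by ring.
rewrite ger0_norm; last exact: mulr_ge0 C0 (ltW d0).
rewrite mulrCA ger_pMr// ler_pdivrMr// mul1r -addrA lerDl.
by rewrite addr_ge0// ltW.
Qed.

Lemma quadratic_CS (R : realType) (a b c : R[i]) :
  0 <= a -> 0 <= c ->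
  (forall k : R[i], 0 <= a + k * b + k^* * b^* + `|k| ^+ 2 * c) ->
  `|b| ^+ 2 <= a * c.
Proof.
move=> a0 c0 quad.
have quadt (t : R[i]) : 0 <= t ->
    0 <= a - 2 * t * `|b| ^+ 2 + t ^+ 2 * `|b| ^+ 2 * c.
  move=> t0; have := quad (- (t * b^*)).
  rewrite rmorphN rmorphM /= conjCK normrN normrM norm_conjC exprMn.
  rewrite (CrealP (ger0_real t0)) (ger0_norm t0).
  suff -> : a + - (t * b^*) * b + - (t * b) * b^* + t ^+ 2 * `|b| ^+ 2 * c =
     a - 2 * t * `|b| ^+ 2 + t ^+ 2 * `|b| ^+ 2 * c by [].
  by rewrite normCK; ring.
have [c00|cn0] := eqVneq c 0.
  rewrite c00 mulr0 real_leNgt ?real0 ?realX ?normr_real//; apply/negP => b0.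
  have /quadt : 0 <= (a + 1) / `|b| ^+ 2 by rewrite divr_ge0 ?addr_ge0// ltW.
  rewrite c00 !mulr0 addr0 -mulrA divfK ?gt_eqF// => H.
  have : a - 2 * (a + 1) < 0.
    have -> : a - 2 * (a + 1) = - (a + 2) by ring.
    by rewrite oppr_lt0 ltr_wpDl.
  by move/(le_lt_trans H); rewrite ltxx.
have cp : 0 < c by rewrite lt_def cn0.
have /quadt : 0 <= c^-1 by rewrite invr_ge0.
have -> : a - 2 / c * `|b| ^+ 2 + c^-1 ^+ 2 * `|b| ^+ 2 * c = a - `|b| ^+ 2 / c.
  by field.
by rewrite subr_ge0 ler_pdivrMr.
Qed.

Lemma complex_cauchy (R : realType) (u : nat -> R[i]) :
  (forall e : R[i], 0 < e -> exists N, forall n m, (N <= n)%N -> (N <= m)%N ->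
    `|u n - u m| <= e) ->
  exists l : R[i], forall e : R[i], 0 < e -> exists N, forall n, (N <= n)%N ->
    `|u n - l| <= e.
Proof.
move=> cu.
have part (p : R[i] -> R) : (forall z z', p (z - z') = p z - p z') ->
    (forall z : R[i], `|p z|%:C%C <= `|z|) ->
    exists l : R, forall e : R, 0 < e -> exists N, forall n, (N <= n)%N ->
      `|p (u n) - l| <= e.
  move=> pB p_le.
  have pc : cauchy ((p \o u) @ \oo).
    apply/cauchy_exP => e e0.
    have [|N HN] := cu (e / 2)%:C%C; first by rewrite ltcR divr_gt0.
    exists (p (u N)); exists N => //= m Nm; rewrite -ball_normE /=.
    rewrite -pB; have := le_trans (p_le _) (HN _ _ (leqnn N) Nm).
    by rewrite lecR => /le_lt_trans; apply; rewrite ltr_pdivrMr// ltr_pMr// ltr1n.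
  have pl : (p \o u) @ \oo --> lim ((p \o u) @ \oo) by exact: (cauchy_cvg _ pc).
  exists (lim ((p \o u) @ \oo)) => e e0.
  have /cvgrPdist_le/(_ e e0)[N _ HN] := pl.
  by exists N => n Nn; rewrite distrC; exact: HN.
have [a Ha] := part (@complex.Re R) (fun z z' => raddfB _ z z')
  (@normc_ge_Re R).
have imle (z : R[i]) : `|complex.Im z|%:C%C <= `|z|.
  by rewrite normc_def lecR -sqrtr_sqr ler_wsqrtr// lerDr sqr_ge0.
have [b Hb] := part (@complex.Im R) (fun z z' => raddfB _ z z') imle.
exists (a +i* b)%C => e e0.
have er : e = (complex.Re e)%:C%C by rewrite RRe_real// gtr0_real.
have e1 : 0 < complex.Re e / 2 by rewrite divr_gt0//; move: e0; rewrite er ltcR.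
have [N1 H1] := Ha _ e1; have [N2 H2] := Hb _ e1.
exists (maxn N1 N2) => n; rewrite geq_max => /andP[/H1 h1 /H2 h2].
have -> : u n - (a +i* b)%C =
    (complex.Re (u n) - a)%:C%C + 'i%C * (complex.Im (u n) - b)%:C%C.
  by case: (u n) => x y /=; simpc.
apply: le_trans (ler_normD _ _) _; rewrite normrM.
have -> : `|'i%C : R[i]| = 1.
  by rewrite normc_def /= expr0n expr1n add0r sqrtr1.
rewrite mul1r er [in leRHS](splitr (complex.Re e)) [in leRHS]rmorphD lerD//.
  by rewrite normc_def /= expr0n addr0 sqrtr_sqr lecR.
by rewrite normc_def /= expr0n addr0 sqrtr_sqr lecR.
Qed.

Lemma complete_cauchy (R : realType) (M : completeNormedModType R[i])
    (u : nat -> M) :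
  (forall e : R[i], 0 < e -> exists N, forall n m, (N <= n)%N -> (N <= m)%N ->
    `|u n - u m| <= e) ->
  exists l : M, forall e : R[i], 0 < e -> exists N, forall n, (N <= n)%N ->
    `|u n - l| <= e.
Proof.
move=> cu.
have pc : cauchy (u @ \oo).
  apply/cauchy_exP => e e0.
  have [|N HN] := cu (e / 2); first by rewrite divr_gt0.
  exists (u N); exists N => //= m Nm; rewrite -ball_normE /=.
  apply: le_lt_trans (HN _ _ (leqnn N) Nm) _.
  by rewrite ltr_pdivrMr// ltr_pMr// ltr1n.
exists (lim (u @ \oo)) => e e0.
have /cvgrPdist_le/(_ e e0)[N _ HN] : u @ \oo --> lim (u @ \oo).
  exact: (cauchy_cvg _ pc).
by exists N => n Nn; rewrite distrC; exact: HN.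
Qed.

Lemma contC_cauchy (R : realType) (X : topologicalType) (f : nat -> contC R X) :
  (forall e : R[i], 0 < e -> exists N, forall n m, (N <= n)%N -> (N <= m)%N ->
    forall x, `|f n x - f m x| <= e) ->
  exists g : contC R X, forall e : R[i], 0 < e -> exists N, forall n,
    (N <= n)%N -> forall x, `|f n x - g x| <= e.
Proof.
move=> cf.
have /choice[g Hg] (x : X) : exists l : R[i], forall e : R[i], 0 < e ->
    exists N, forall n, (N <= n)%N -> `|f n x - l| <= e.
  apply: complex_cauchy => e /cf[N HN]; exists N => n m Nn Nm.
  exact: HN.
have fg (e : R[i]) : 0 < e ->
    exists N, forall n, (N <= n)%N -> forall x, `|f n x - g x| <= e.
  move=> e0; have e2 : 0 < e / 2 by rewrite divr_gt0.
  have [N HN] := cf _ e2; exists N => n Nn x.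
  have [N' HN'] := Hg x _ e2.
  rewrite -(subrKA (f (maxn N N') x)) (le_trans (ler_normD _ _))//.
  by rewrite [e]splitr lerD// ?HN ?HN'// ?leq_maxl ?leq_maxr.
have cg : continuous (g : X -> R[i]^o).
  move=> x; apply/cvgrPdist_le => e e0.
  have e3 : 0 < e / 3 by rewrite divr_gt0.
  have [N HN] := fg _ e3.
  have /cvgrPdist_le/(_ _ e3) := @cts_fun _ _ (f N) x.
  apply: filterS => y fNy.
  have -> : g x - g y = - (f N x - g x) + (f N x - f N y) + (f N y - g y).
    by ring.
  have -> : e = e / 3 + e / 3 + e / 3 by field.
  rewrite (le_trans (ler_normD _ _))// lerD ?HN//.
  by rewrite (le_trans (ler_normD _ _))// normrN lerD ?HN.
by exists (contC_of cg).
Qed.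

(** Near each point the bound [n%:R] holds for all large [n]; the covering form of compactness,
    applied with the filter of large integers, makes one [n] work everywhere. *)
Lemma contC_bounded (R : realType) (X : topologicalType) (f : contC R X) :
  compact [set: X] -> exists2 M : R[i], 0 <= M & forall x, `|f x| <= M.
Proof.
move=> /compact_near_coveringP.
move=> /(_ nat \oo (fun n x => `|f x : R[i]| <= n%:R)) [x _|N _ /(_ N)].
  have [n xn] : exists n : nat, `|f x : R[i]| < n%:R.
    have [a ar a0] : exists2 a : R, `|f x : R[i]| = a%:C%C & 0 <= a.
      by eexists; [exact: normc_def|rewrite sqrtr_ge0].
    exists (Num.bound a); rewrite ar -(rmorph_nat (real_complex R)) ltcR.
    exact: archi_boundP.
  have /cvgrPdist_lt/(_ 1 ltr01) Ux := @cts_fun _ _ f x.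
  exists ([set y | `|f x - f y : R[i]| < 1], [set m | (n.+1 <= m)%N]).
    by split => //; exists n.+1.
  move=> [y m] /= [yU nm].
  rewrite -[f y : R[i]](subrK (f x)) (le_trans (ler_normD _ _))//.
  apply: le_trans (lerD (ltW _) (ltW xn)) _; first by rewrite distrC; exact: yU.
  by rewrite addrC natr1 ler_nat.
by move=> /(_ (leqnn N)) H; exists N%:R => // x; exact: H.
Qed.

(** * Representations of C*-algebras *)

Section cstar_norm.
Context (R : realType) (A : cstarAlgType R).

Lemma norm_star (a : A) : `|star a| = `|a|.
Proof.
have le (b : A) : `|b| <= `|star b|.
  have [->|b0] := eqVneq b 0; first by rewrite normr0.
  have : `|b| ^+ 2 <= `|star b| * `|b| by rewrite -norm_star_smul norm_smul.
  by rewrite expr2 ler_pM2r// normr_gt0.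
by apply/eqP; rewrite eq_le le andbT -{2}[a]starK le.
Qed.

(* [1 - b = (1 - c)^2] in the unitization of A. *)
Lemma sqrt_one_minus (b : A) : star b = b -> `|b| <= 2^-1 ->
  exists2 c : A, star c = c & b = c + c - smul c c.
Proof.
move=> bs b1.
(* The equation [b = c + c - smul c c] as a fixed-point problem. [T] preserves the ball of radius
   1/2 and halves distances on it, so the iterates of 0 converge; they are self-adjoint because [b]
   is. *)
pose T c := 2^-1 *: (b + smul c c).
pose c n := iter n T 0.
have cs n : star (c n) = c n.
  elim: n => [|n IH]; first exact: star0.
  by rewrite /c iterS -/(c n) /T starZ starD starM IH bs fmorphV rmorph_nat.
have h0 : (0 : R[i]) <= 2^-1 by rewrite invr_ge0.
have cn n : `|c n| <= 2^-1.
  elim: n => [|n IH]; first by rewrite normr0.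
  rewrite /c iterS -/(c n) /T normrZ ger0_norm//.
  rewrite -[leRHS]mulr1 ler_wpM2l// (le_trans (ler_normD _ _))//.
  have -> : 1 = 2^-1 + 2^-1 :> R[i] by field.
  apply: lerD => //; apply: le_trans (norm_smul _ _) _.
  rewrite -[leRHS]mulr1 ler_pM//; apply: le_trans IH _.
  by rewrite invf_le1// ler1n.
have T_lip (x y : A) : `|T x - T y| <= 2^-1 * ((`|x| + `|y|) * `|x - y|).
  rewrite /T -scalerBr normrZ ger0_norm// ler_wpM2l//.
  have -> : b + smul x x - (b + smul y y) = smul x (x - y) + smul (x - y) y.
    rewrite smulDr smulDl smulNl smulNr subrKA.
    by rewrite opprD addrACA subrr add0r.
  rewrite (le_trans (ler_normD _ _))// mulrDl [leRHS]addrC.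
  by rewrite addrC lerD// (le_trans (norm_smul _ _))// mulrC.
have c_step n k : `|c (n + k)%N - c n| <= 2^-1 ^+ n.
  elim: n => [|n IH].
    by rewrite subr0 expr0 (le_trans (cn _))// invf_le1// ler1n.
  rewrite addSn /c !iterS -/(c _) -/(c n) exprS.
  apply: le_trans (T_lip _ _) _; rewrite ler_wpM2l// -[leRHS]mul1r ler_pM//.
  have -> : 1 = 2^-1 + 2^-1 :> R[i] by field.
  exact: lerD.
have [|l Hl] := @complete_cauchy R A c.
  move=> e e0; have [|N HN] := @complex_archi R (e / 2); first by rewrite divr_gt0.
  exists N => n m Nn Nm; rewrite -(subrKA (c N)) (le_trans (ler_normD _ _))//.
  rewrite [e]splitr lerD//; [rewrite -(subnKC Nn)|rewrite distrC -(subnKC Nm)];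
  by apply: le_trans (c_step _ _) (ltW _).
exists l.
  apply/eqP; rewrite -subr_eq0; apply/eqP/normr0_eq0.
  apply: (@small_norm_eq0 _ _ 2) => e /Hl[N /(_ _ (leqnn N)) h].
  rewrite normr_id -(subrKA (c N)) -{1}(cs N).
  have -> : star l - star (c N) = star (l - c N).
    by rewrite starD -[- c N]scaleN1r starZ rmorphN1 scaleN1r.
  rewrite (le_trans (ler_normD _ _))// norm_star distrC.
  by rewrite mulr_natl mulr2n lerD.
suff Tl : l = T l.
  have -> : b = l + l - smul l l; last by [].
  rewrite {1 2}Tl /T -scalerDl.
  have -> : 2^-1 + 2^-1 = 1 :> R[i] by field.
  by rewrite scale1r addrK.
apply/eqP; rewrite -subr_eq0; apply/eqP/normr0_eq0.
apply: (@small_norm_eq0 _ _ (1 + 2^-1 * (2^-1 + `|l|))) => e /Hl[N HN].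
rewrite normr_id -(subrKA (c N.+1)) (le_trans (ler_normD _ _))//.
rewrite mulrDl mul1r lerD//; first by rewrite distrC HN.
rewrite /c iterS -/(c N) (le_trans (T_lip _ _))// -mulrA ler_wpM2l//.
by rewrite ler_pM ?HN ?addr_ge0// lerD2r.
Qed.
End cstar_norm.

Section hilbert.
Context (R : realType) (H : hilbertSpace R).
Implicit Types (h k : H) (T : adjointable (hs_ip H)).

Lemma hs_CS h k : `|hs_ip H h k : R[i]| <= `|h| * `|k|.
Proof.
rewrite -(@ler_pXn2r _ 2%N)// ?nnegrE ?mulr_ge0// exprMn !hs_norm.
apply: quadratic_CS => [| |z]; rewrite -?hs_norm ?exprn_ge0//.
have := exprn_ge0 2 (normr_ge0 (h + z *: k)); rewrite !hs_norm.
rewrite ipDl !ipDr !ipZl !ipZr normCK.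
rewrite -(ip_star (hs_ip H) h k).
set a := hs_ip H h h; set b := hs_ip H h k; set c := hs_ip H k k.
suff -> : a + z *: b + (z^* *: star b + z^* *: (z *: c)) =
  a + (z : R[i]) * b + z^* * b^* + z * z^* * c by [].
rewrite /GRing.scale /= /star /=; ring.
Qed.

End hilbert.

Section representation.
Context (R : realType) (A : cstarAlgType R) (H : hilbertSpace R).
Context (s : A -> adjointable (hs_ip H)) (sM : star_morphism s).

Lemma rep_linear (k : R[i]) a b h : s (k *: a + b) h = k *: s a h + s b h.
Proof. by case: sM => -> _ _. Qed.

Lemma rep_smul a b h : s (smul a b) h = s a (s b h).
Proof. by case: sM => _ -> _. Qed.

Lemma rep_star a h k : hs_ip H (s a h) k = hs_ip H h (s (star a) k).
Proof. by case: sM => _ _ ->; rewrite adjP. Qed.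

Lemma rep0 h : s 0 h = 0.
Proof. by rewrite -(addrN 0) -scaleN1r addrC rep_linear scaleN1r addNr. Qed.

Lemma repZ (k : R[i]) a h : s (k *: a) h = k *: s a h.
Proof. by rewrite -[k *: a]addr0 rep_linear rep0 addr0. Qed.

Lemma repD a b h : s (a + b) h = s a h + s b h.
Proof. by rewrite -[a]scale1r rep_linear !scale1r. Qed.

Lemma repB a b h : s (a - b) h = s a h - s b h.
Proof. by rewrite repD -[- b]scaleN1r repZ scaleN1r. Qed.

(** With [t] chosen so that [t *: smul (star a) a] has norm 1/2, this element is [c + c - smul c c],
    and the squared norm of [h - s c h] is that of [h] minus [t] times that of [s a h]. Its
    positivity gives the constant sqrt 2, rounded up to 2. *)
Lemma rep_bounded a h : `|s a h| <= 2 * `|a| * `|h|.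
Proof.
have [->|a0] := eqVneq a 0; first by rewrite rep0 !normr0 mulr0 mul0r.
have na : 0 < `|a| by rewrite normr_gt0.
pose t : R[i] := (2 * `|a| ^+ 2)^-1.
have t0 : 0 < t by rewrite invr_gt0 mulr_gt0 ?exprn_gt0.
have [|| c cs Hc] := @sqrt_one_minus R A (t *: smul (star a) a).
- rewrite starZ starM starK; congr (_ *: _).
  by apply: CrealP; rewrite ger0_real// ltW.
- by rewrite normrZ norm_star_smul gtr0_norm// /t invfM divfK// ?expf_neq0// gt_eqF.
have key : t * `|s a h| ^+ 2 <= `|h| ^+ 2.
  rewrite -subr_ge0; have := exprn_ge0 2 (normr_ge0 (h - s c h)).
  rewrite !hs_norm rep_star -rep_smul -[t * _]/(t *: (_ : R[i]^o)) -ipZr -repZ Hc.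
  have cc : hs_ip H (s c h) (s c h) = hs_ip H h (s (smul c c) h).
    by rewrite rep_star cs rep_smul.
  have ch : hs_ip H (s c h) h = hs_ip H h (s c h) by rewrite rep_star cs.
  rewrite repB repD !ipDl !ipDr !ipNl !ipNr ch cc.
  set x := hs_ip H h h; set y := hs_ip H h (s c h).
  by rewrite !opprD !opprK !addrA.
rewrite -(@ler_pXn2r _ 2%N)// ?nnegrE ?mulr_ge0//.
move: key; rewrite mulrC /t ler_pdivrMr ?mulr_gt0 ?exprn_gt0// => /le_trans; apply.
rewrite !exprMn mulrC ler_wpM2r ?exprn_ge0// ler_wpM2r ?exprn_ge0//.
by rewrite -natrX ler_nat.
Qed.

End representation.

(** * Lower semicontinuity of numerical ranges *)

Section real_form.
Context (R : realType) (H : hilbertSpace R).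
Implicit Types (h k : H).

(** The forms of self-adjoint operators are real, so taking the real part loses nothing and moves
    the estimates from the partially ordered [R[i]] to the ordered field [R]. *)
Definition rip h k : R := complex.Re (hs_ip H h k).

Lemma ripC h k : rip h k = rip k h.
Proof.
by rewrite /rip -(ip_star (hs_ip H) k h) /star /=; case: (hs_ip H k h : R[i]).
Qed.

Lemma ripDr h k l : rip h (k + l) = rip h k + rip h l.
Proof. by rewrite /rip ipDr raddfD. Qed.

Lemma ripDl h k l : rip (h + k) l = rip h l + rip k l.
Proof. by rewrite ripC ripDr !(ripC l). Qed.

Lemma ripNr h k : rip h (- k) = - rip h k.
Proof. by rewrite /rip ipNr raddfN. Qed.

Lemma ripNl h k : rip (- h) k = - rip h k.
Proof. by rewrite ripC ripNr ripC. Qed.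

Lemma ripZr h (t : R) k : rip h (t%:C%C *: k) = t * rip h k.
Proof.
rewrite /rip ipZr /GRing.scale /=.
by case: (hs_ip H h k : R[i]) => a b; simpc.
Qed.

Lemma ripZl (t : R) h k : rip (t%:C%C *: h) k = t * rip h k.
Proof. by rewrite ripC ripZr ripC. Qed.

Lemma rip_norm h : (rip h h)%:C%C = `|h| ^+ 2.
Proof. by rewrite hs_norm RRe_real// -hs_norm realX// normr_real. Qed.

Lemma rip_ge0 h : 0 <= rip h h.
Proof. by rewrite -ler0c rip_norm exprn_ge0. Qed.

Lemma rip0l h : rip 0 h = 0.
Proof. by rewrite /rip ip0l. Qed.

Lemma rip_CS h k : rip h k ^+ 2 <= rip h h * rip k k.
Proof.
rewrite -lecR rmorphXn rmorphM /= !rip_norm -exprMn.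
apply: (@le_trans _ _ (`|hs_ip H h k : R[i]| ^+ 2)).
  rewrite -add_Re2_Im2 -rmorphXn lecR /rip; set z := hs_ip H h k : R[i].
  by rewrite lerDl sqr_ge0.
by rewrite ler_pXn2r// ?nnegrE ?mulr_ge0// hs_CS.
Qed.

Lemma rip_eq0 h : rip h h = 0 -> h = 0.
Proof.
move=> h0; apply/normr0_eq0/eqP; rewrite -sqrf_eq0 -rip_norm h0.
by rewrite rmorph0.
Qed.

End real_form.

Section symmetric_operator.
Context (R : realType) (H : hilbertSpace R) (P : H -> H).
Hypothesis PB : forall h k, P (h - k) = P h - P k.
Hypothesis PZ : forall (t : R[i]) h, P (t *: h) = t *: P h.
Hypothesis ripP : forall h k, rip (P h) k = rip h (P k).
Hypothesis P_ge0 : forall g, 0 <= rip g (P g).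

Let iterPB n h k : iter n P (h - k) = iter n P h - iter n P k.
Proof. by elim: n => //= n ->; exact: PB. Qed.

Lemma iterPZ n (t : R[i]) h : iter n P (t *: h) = t *: iter n P h.
Proof. by elim: n => //= n ->; exact: PZ. Qed.

(** Symmetry moves half of the factors to the left argument: with [k] the [n./2]-th iterate of [g],
    what remains is [rip k k] or [rip k (P k)]. *)
Let iterP_ge0 n g : 0 <= rip g (iter n P g).
Proof.
rewrite -(odd_double_half n); elim: (n./2) g => [|m IH] g.
  by case: (odd n); [exact: P_ge0|exact: rip_ge0].
rewrite doubleS !addnS iterS -ripP iterSr; exact: IH.
Qed.

(* With [g := P h - m h],
   [<h, P^(j+1) (P - m) h> = m <h, P^j (P - m) h> + <g, P^j g>]. *)
Lemma moment_step (m : R) h j : 0 <= m -> m * rip h h <= rip h (P h) ->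
  m * rip h (iter j P h) <= rip h (iter j.+1 P h).
Proof.
move=> m0 hm; elim: j => [//|j IH].
pose g := P h - m%:C%C *: h.
have := iterP_ge0 j g; rewrite /g iterPB iterPZ ripDl !ripDr !ripNr !ripNl.
rewrite !ripZl !ripZr -!iterSr ripP [rip (P h) (iter j P h)]ripP.
rewrite -[P (iter j.+1 P h)]iterS -[P (iter j P h)]iterS => K.
by have := ler_wpM2l m0 IH; lra.
Qed.

(** Jensen's inequality for the spectral measure of [P] at [h], obtained without spectral theory. *)
Lemma moment_lower (m : R) h j : 0 <= m -> m * rip h h <= rip h (P h) ->
  m ^+ j * rip h h <= rip h (iter j P h).
Proof.
move=> m0 hm; elim: j => [|j IH]; first by rewrite mul1r.
by apply: le_trans (moment_step j m0 hm); rewrite exprS -mulrA ler_wpM2l.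
Qed.

(* [L P (L - P) = P (L - P) P + (L - P) P (L - P)]. *)
Lemma form_bound_norm (L : R) : 0 < L ->
  (forall g, rip g (P g) <= L * rip g g) ->
  forall g, rip (P g) (P g) <= L ^+ 2 * rip g g.
Proof.
move=> L0 PL g.
apply: (@le_trans _ _ (L * rip g (P g))); last first.
  by rewrite expr2 -mulrA ler_pM2l.
rewrite -(ler_pM2l L0).
have := PL (P g); have := P_ge0 (L%:C%C *: g - P g).
rewrite PB PZ ripDl !ripDr !ripNr !ripNl !ripZl !ripZr.
rewrite -[rip g (P (P g))]ripP.
by move=> *; lra.
Qed.

End symmetric_operator.

Section powers.
Context (R : realType) (A : cstarAlgType R) (H : hilbertSpace R).
Context (s : A -> adjointable (hs_ip H)) (sM : star_morphism s).
Context (b : A) (bs : star b = b) (M : R).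

(* [shift_pow n] is [b (b + M)^n], which lies in A although [M] does not. *)
Definition shift_pow n : A := iter n (fun x => smul b x + M%:C%C *: x) b.

Definition shift_op (h : H) : H := s b h + M%:C%C *: h.

Lemma rip_shift h k : rip (shift_op h) k = rip h (shift_op k).
Proof.
rewrite /shift_op ripDl ripDr ripZl ripZr; congr (_ + _).
by rewrite /rip (rep_star sM) bs.
Qed.

Lemma shift_opB h k : shift_op (h - k) = shift_op h - shift_op k.
Proof.
rewrite /shift_op adj_opD scalerDr scalerN opprD addrACA; congr (_ + (_ - _)).
by rewrite -[- k]scaleN1r adj_opZ scaleN1r.
Qed.

Lemma shift_opZ (t : R[i]) h : shift_op (t *: h) = t *: shift_op h.
Proof. by rewrite /shift_op adj_opZ scalerDr !scalerA [M%:C%C * t]mulrC. Qed.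

Lemma rep_shift_pow n h : s (shift_pow n) h = iter n shift_op (s b h).
Proof.
elim: n => //= n IH.
by rewrite (repD sM) (rep_smul sM) (repZ sM) IH.
Qed.

Hypothesis shift_ge0 : forall g, 0 <= rip g (shift_op g).

(** With [P = b + M] one has [b P^n = P^(n+1) - M P^n]. By [moment_step] its form at [h] is at least
    [mu] times that of [P^n], hence at least [mu * (M + mu) ^+ n * rip h h]; Cauchy-Schwarz turns
    this into a bound on the norm. *)
Lemma shift_pow_lower n h (mu : R) : 0 <= M -> 0 <= mu ->
  mu * rip h h <= rip h (s b h) ->
  mu ^+ 2 * (M + mu) ^+ n.*2 * rip h h <=
    rip (s (shift_pow n) h) (s (shift_pow n) h).
Proof.
move=> M0 mu0 hmu; set m := M + mu.
have m0 : 0 <= m by rewrite addr_ge0.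
have hm : m * rip h h <= rip h (shift_op h).
  by rewrite /shift_op ripDr ripZr /m mulrDl addrC lerD2r.
have low : mu * m ^+ n * rip h h <= rip h (s (shift_pow n) h).
  have -> : rip h (s (shift_pow n) h) =
      rip h (iter n.+1 shift_op h) - M * rip h (iter n shift_op h).
    rewrite rep_shift_pow -ripZr -ripNr -ripDr iterSr; congr rip.
    elim: n => [|n IH] /=; first by rewrite /shift_op addrK.
    by rewrite IH shift_opB shift_opZ.
  have := moment_step shift_opB shift_opZ rip_shift shift_ge0 n m0 hm.
  have := moment_lower shift_opB shift_opZ rip_shift shift_ge0 n m0 hm.
  move=> p1; rewrite mulrDl => p2.
  by have := ler_wpM2l mu0 p1; lra.
have [h0|hn0] := eqVneq (rip h h) 0; first by rewrite h0 mulr0 rip_ge0.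
have hp : 0 < rip h h by rewrite lt_def hn0 rip_ge0.
rewrite -(ler_pM2l hp); apply: le_trans (rip_CS _ _).
have -> : rip h h * (mu ^+ 2 * m ^+ n.*2 * rip h h) = (mu * m ^+ n * rip h h) ^+ 2.
  by rewrite -muln2 exprM; ring.
by rewrite ler_pXn2r// nnegrE ?mulr_ge0 ?exprn_ge0 ?rip_ge0//; apply: le_trans low;
  rewrite !mulr_ge0 ?exprn_ge0 ?rip_ge0.
Qed.

(** The factor [b] costs [M]. Each of the [n] factors [b + M] costs [L], since for a positive
    operator a bound on the form is a bound on the norm. *)
Lemma shift_pow_upper n h (L : R) : 0 < L ->
  (forall g, rip g (shift_op g) <= L * rip g g) ->
  (forall g, rip (s b g) (s b g) <= M ^+ 2 * rip g g) ->
  rip (s (shift_pow n) h) (s (shift_pow n) h) <= M ^+ 2 * L ^+ n.*2 * rip h h.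
Proof.
move=> L0 PL bM; rewrite rep_shift_pow.
have PP := form_bound_norm shift_opB shift_opZ rip_shift shift_ge0 L0 PL.
elim: n => [|n IH]; first by rewrite double0 expr0 mulr1 bM.
apply: le_trans (PP _) _.
have -> : M ^+ 2 * L ^+ n.+1.*2 * rip h h = L ^+ 2 * (M ^+ 2 * L ^+ n.*2 * rip h h).
  by rewrite doubleS 2!(exprS L); ring.
by rewrite ler_wpM2l// exprn_ge0// ltW.
Qed.

End powers.

Section bundle.
Context (R : realType) (X : topologicalType) (A : cstarAlgType R).
Context (H : X -> hilbertSpace R).
Context (sigma : forall x, A -> adjointable (hs_ip (H x))).
Hypothesis sM : forall x, star_morphism (sigma x).

Lemma rip_rep_le x a (h : H x) :
  rip (sigma x a h) (sigma x a h) <=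
    (2 * complex.Re `|a|) ^+ 2 * rip h h.
Proof.
rewrite -lecR rip_norm rmorphM rmorphXn rmorphM /= rip_norm rmorph_nat.
rewrite RRe_real ?normr_real// -exprMn ler_pXn2r// ?nnegrE ?mulr_ge0//.
exact: rep_bounded.
Qed.

Hypothesis sigma_lsc : forall a : A,
  lower_semicontinuous (fun x => opnorm (sigma x a)).

(** Semicontinuity of [opnorm] in terms of vectors: [h] is normalized and the threshold is
    [Num.sqrt r]. At a nearby [y], a vector [k] of the unit ball that exceeds the threshold
    satisfies the claim because [rip k k <= 1] and [0 <= r]. *)
Lemma near_rip_rep x a (h : H x) (r : R) : 0 <= r ->
  r * rip h h < rip (sigma x a h) (sigma x a h) ->
  \forall y \near x, exists k : H y,
    r * rip k k < rip (sigma y a k) (sigma y a k).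
Proof.
move=> r0 rh.
have hp : 0 < rip h h.
  rewrite lt_def rip_ge0 andbT; apply/negP => /eqP h0; move: rh.
  have := rip_rep_le a h; rewrite h0 !mulr0 => /le_lt_trans H1 /H1.
  by rewrite ltxx.
pose t := (Num.sqrt (rip h h))^-1.
have t2 : t ^+ 2 * rip h h = 1.
  by rewrite exprVn sqr_sqrtr ?rip_ge0// mulVf// gt_eqF.
have tr : ((Num.sqrt r)%:E < opnorm (sigma x a))%E.
  apply: (@lt_le_trans _ _ (complex.Re `|sigma x a (t%:C%C *: h)|)%:E%E).
    rewrite lte_fin -ltcR RRe_real ?normr_real//.
    rewrite -(@ltr_pXn2r _ 2%N)// ?nnegrE ?ler0c ?sqrtr_ge0// -rmorphXn /=.
    rewrite sqr_sqrtr// -rip_norm ltcR adj_opZ ripZl ripZr mulrA -expr2.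
    have t0 : 0 < t ^+ 2 by rewrite exprn_gt0// invr_gt0 sqrtr_gt0.
    move: rh; rewrite -(ltr_pM2l t0); apply: le_lt_trans.
    by rewrite mulrCA t2 mulr1.
  apply: ereal_sup_ubound; exists (t%:C%C *: h) => //=.
  rewrite -(@ler_pXn2r _ 2%N)// ?nnegrE//.
  by rewrite -rip_norm ripZl ripZr mulrA -expr2 t2 expr1n.
have [V xV VP] := sigma_lsc tr.
apply: filterS xV => y /VP /ereal_sup_gt[_ [k /= k1 <-]].
rewrite lte_fin => rk; exists k.
have rk2 : r < rip (sigma y a k) (sigma y a k).
  rewrite -ltcR rip_norm -[r]sqr_sqrtr// rmorphXn /=.
  rewrite ltr_pXn2r ?nnegrE ?ler0c ?sqrtr_ge0//.
  by rewrite -[ltRHS]RRe_real ?normr_real// ltcR.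
apply: le_lt_trans rk2; rewrite -[leRHS]mulr1 ler_wpM2l//.
by rewrite -lecR rip_norm expr_le1.
Qed.

(* If [<k, sigma_y(b) k> <= r |k|^2] for all [k], then [b (b + M)^n] has norm at
   most [M (M + r)^n] at [y]; for large n this is less than its norm at [x], so
   that lower semicontinuity of the norm of a single element suffices. *)
Lemma near_form x b (h : H x) (mu r : R) : star b = b ->
  0 < rip h h -> mu * rip h h <= rip h (sigma x b h) -> 0 <= r < mu ->
  \forall y \near x, exists k : H y, r * rip k k < rip k (sigma y b k).
Proof.
move=> bs hp hmu /andP[r0 rmu].
(* The bound of [rep_bounded] for [b], valid in all fibres at once, so that [b + M] is positive
   everywhere; the added 1 makes [M] positive even for [b = 0]. *)
pose M := 2 * complex.Re `|b| + 1.
have b0 : 0 <= complex.Re `|b| by rewrite -ler0c RRe_real ?normr_real.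
have M0 : 0 < M by rewrite ltr_wpDl ?mulr_ge0.
have bM y (g : H y) : rip (sigma y b g) (sigma y b g) <= M ^+ 2 * rip g g.
  apply: le_trans (rip_rep_le _ _) _; rewrite ler_wpM2r ?rip_ge0//.
  by rewrite ler_pXn2r ?nnegrE ?mulr_ge0 ?(ltW M0)// lerDl.
have PM y (g : H y) : 0 <= rip g (sigma y b g + M%:C%C *: g).
  rewrite ripDr ripZr -lerBlDr sub0r lerNl.
  have := rip_CS g (sigma y b g); have := bM y g; have := rip_ge0 g.
  set u := rip g (sigma y b g); set v := rip g g.
  set w := rip (sigma y b g) _ => v0 uv wv.
  have : u ^+ 2 <= (M * v) ^+ 2.
    by apply: le_trans wv _; rewrite exprMn [v ^+ 2]expr2 mulrCA ler_wpM2l.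
  rewrite -ler_sqrt ?sqr_ge0// !sqrtr_sqr [leRHS]ger0_norm ?mulr_ge0 ?(ltW M0)//.
  by rewrite ler_norml => /andP[+ _]; rewrite lerNl.
have L0 : 0 < M + r by rewrite ltr_wpDr.
have mu0 : 0 < mu by apply: le_lt_trans rmu.
have Mmu : 0 < M + mu by exact: addr_gt0.
(* The ratio [q] of [M + mu] to [M + r] exceeds 1, so by Bernoulli's inequality its powers
   eventually beat the constant [M / mu] that separates the two bounds. *)
have [n Hn] : exists n, M ^+ 2 * (M + r) ^+ n.*2 < mu ^+ 2 * (M + mu) ^+ n.*2.
  pose q := (M + mu) / (M + r).
  pose d := q - 1.
  have d0 : 0 < d by rewrite subr_gt0 ltr_pdivlMr// mul1r ltrD2l.
  have bern j : 1 + j%:R * d <= q ^+ j.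
    elim: j => [|j IH]; first by rewrite mul0r addr0.
    have j0 : 0 <= j%:R :> R by [].
    have -> : q ^+ j.+1 = q ^+ j * (1 + d) by rewrite exprSr /d subrKC.
    by rewrite -natr1; nra.
  have [j Hj] : exists j : nat, M / mu / d < j%:R.
    exists (Num.bound (M / mu / d)); apply: archi_boundP.
    by rewrite !divr_ge0// ltW.
  exists j; rewrite -muln2 !exprM -!exprMn.
  rewrite ltr_pXn2r ?nnegrE ?mulr_ge0 ?exprn_ge0 ?(ltW M0) ?(ltW L0)
    ?(ltW mu0) ?(ltW Mmu)//.
  have : M / mu < q ^+ j.
    apply: lt_le_trans (bern j); rewrite ltr_wpDl//.
    by rewrite -ltr_pdivrMr.
  rewrite /q expr_div_n ltr_pdivlMr ?exprn_gt0// mulrAC ltr_pdivrMr//.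
  by rewrite [mu * _]mulrC.
have up : M ^+ 2 * (M + r) ^+ n.*2 * rip h h <
    rip (sigma x (shift_pow b M n) h) (sigma x (shift_pow b M n) h).
  apply: (lt_le_trans _ (shift_pow_lower (sM x) bs (PM x) n (ltW M0) (ltW mu0) hmu)).
  by rewrite ltr_pM2r.
have L1 : 0 <= M ^+ 2 * (M + r) ^+ n.*2.
  by rewrite mulr_ge0 ?exprn_ge0 ?(ltW M0) ?(ltW L0).
apply: filterS (near_rip_rep L1 up) => y [k Hk]; apply/not_existsP => no.
have rle (g : H y) : rip g (sigma y b g) <= r * rip g g.
  by have /negP := no g; rewrite -leNgt.
move: Hk; apply/negP; rewrite -leNgt; apply: shift_pow_upper => //.
by move=> g; have := rle g; rewrite /shift_op ripDr ripZr; lra.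
Qed.

End bundle.

(** * Lower semicontinuity of the vector functionals *)

(* Frank-Wolfe: moving from a near-minimizer [w] of the distance to [v] towards
   a point of W that is good for the direction [v - w] decreases the distance. *)
Lemma convex_near (R : realType) (J : finType) (W : set (J -> R)) (v : J -> R)
    (C eta : R) : 0 < eta -> W !=set0 ->
  (forall w w' l, W w -> W w' -> 0 <= l <= 1 ->
    W (fun j => w j + l * (w' j - w j))) ->
  (forall w j, W w -> `|w j| <= C) -> (forall j, `|v j| <= C) ->
  (forall t : J -> R, (forall j, `|t j| <= 2 * C) ->
    exists2 w, W w & \sum_j t j * (v j - w j) <= eta) ->
  exists2 w, W w & \sum_j (v j - w j) ^+ 2 <= 2 * eta.
Proof.
move=> eta0 [w0 Ww0] Wconv WC vC Wt.
pose D w := \sum_j (v j - w j) ^+ 2.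
(* [K] bounds the squared diameter of [W], the 1 keeping it positive. The step length [l] is small
   enough for the second-order cost [l ^+ 2 * K] to stay below [l * eta]. *)
pose K := 1 + \sum_(j : J) (2 * C) ^+ 2.
have K0 : 0 < K by rewrite ltr_wpDr// sumr_ge0// => j _; rewrite sqr_ge0.
pose l := Num.min 1 (eta / K).
have l0 : 0 < l by rewrite lt_min ltr01 divr_gt0.
have l1 : l <= 1 by rewrite ge_min lexx.
have lK : l * K <= eta by rewrite -ler_pdivlMr// ge_min lexx orbT.
have infD : has_inf (D @` W).
  split; first by exists (D w0); exists w0.
  by exists 0 => _ [w _ <-]; rewrite sumr_ge0// => j _; rewrite sqr_ge0.
(* The near-minimizer is within [l * eta] of the infimum. If [D w > 2 * eta], a step of length [l]
   gains more than [2 * l * eta] at first order and costs at most [l * eta], so it would fall below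
   the infimum. *)
have [_ [w Ww <-] Dw] := inf_adherent (mulr_gt0 l0 eta0) infD.
exists w => //; rewrite leNgt; apply/negP => Deta.
have [|w' Ww' Hw'] := Wt (fun j => v j - w j).
  move=> j; rewrite (le_trans (ler_normB _ _))//.
  by rewrite mulr_natl mulr2n lerD// WC.
pose w2 j := w j + l * (w' j - w j).
have Ww2 : W w2 by apply: Wconv => //; rewrite (ltW l0).
have : inf (D @` W) <= D w2 by apply: ge_inf; [exact: (proj2 infD)|exists w2].
apply/negP; rewrite -ltNge; apply: le_lt_trans (_ : D w - l * eta < _); last first.
  by rewrite ltrBlDr.
have -> : D w2 = D w - 2 * l * (D w - \sum_j (v j - w j) * (v j - w' j)) +
    l ^+ 2 * \sum_j (w' j - w j) ^+ 2.
  rewrite /D -sumrB !mulr_sumr -sumrB -big_split/=; apply: eq_bigr => j _.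
  by rewrite /w2; ring.
have b1 : \sum_j (w' j - w j) ^+ 2 <= K.
  rewrite /K -[leLHS]add0r lerD//; apply: ler_sum => j _.
  have C2 : 0 <= 2 * C by rewrite mulr_ge0// (le_trans _ (vC j)).
  rewrite -real_normK ?num_real// ler_pXn2r ?nnegrE//.
  by rewrite (le_trans (ler_normB _ _))// mulr_natl mulr2n lerD// WC.
have b2 : l ^+ 2 * \sum_j (w' j - w j) ^+ 2 <= l * eta.
  rewrite expr2 -mulrA ler_pM2l//; apply: le_trans lK.
  by rewrite ler_pM2l.
have b3 : l * eta <= l * (D w - \sum_j (v j - w j) * (v j - w' j)).
  by rewrite ler_pM2l//; move: Deta; rewrite -/(D w) => Deta; lra.
by lra.
Qed.

Lemma interval_net (R : realType) (C theta : R) : 0 < theta ->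
  exists (n : nat) (g : 'I_n.+1 -> R), forall t, `|t| <= C ->
    exists i, `|t - g i| <= theta.
Proof.
move=> th0.
pose n := Num.truncn (2 * C / theta).
exists n, (fun i => - C + i%:R * theta) => t tC.
have C0 : 0 <= C by exact: le_trans tC.
move: tC; rewrite ler_norml => /andP[t1 t2].
pose u := (t + C) / theta.
have u0 : 0 <= u by rewrite divr_ge0 ?(ltW th0)// addrC -lerBlDl sub0r.
have un : (Num.truncn u < n.+1)%N.
  rewrite ltnS /n truncn_le_nat.
  rewrite (@le_lt_trans _ _ (2 * C / theta))//.
    by rewrite /u ler_pM2r ?invr_gt0// mulr_natl mulr2n lerD2r.
  by rewrite truncnS_gt.
exists (Ordinal un) => /=.
have /andP[h1 h2] := truncn_itv u0.
have -> : t - (- C + (Num.truncn u)%:R * theta) = (u - (Num.truncn u)%:R) * theta.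
  by rewrite /u; field; rewrite gt_eqF.
rewrite normrM (gtr0_norm th0) ger_pMl// ger0_norm ?subr_ge0//.
by rewrite lerBlDl (le_trans (ltW h2))// -natr1 .
Qed.

Section vector_functionals.
Context (R : realType) (X : topologicalType) (A : cstarAlgType R).
Context (H : X -> hilbertSpace R).
Context (sigma : forall x, A -> adjointable (hs_ip (H x))).
Hypothesis sM : forall x, star_morphism (sigma x).

(* The weights of a convex combination of vector functionals are absorbed in the
   vectors: the sequences of mass at most 1 represent a convex set. *)
Definition psi x (s : seq (H x)) (a : A) : R[i] :=
  \sum_(h <- s) hs_ip (H x) h (sigma x a h).

Definition mass x (s : seq (H x)) : R := \sum_(h <- s) rip h h.

Lemma psi_linear x (s : seq (H x)) (k : R[i]) a b :
  psi s (k *: a + b) = k * psi s a + psi s b.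
Proof.
rewrite /psi mulr_sumr -big_split /=; apply: eq_bigr => h _.
by rewrite (rep_linear (sM x)) ip_linear.
Qed.

Lemma psi0 x (s : seq (H x)) : psi s 0 = 0.
Proof. by rewrite /psi big1// => h _; rewrite (rep0 (sM x)) ip0r. Qed.

Lemma psi_sum x (s : seq (H x)) (J : finType) (k : J -> R[i]) (a : J -> A) :
  psi s (\sum_j k j *: a j) = \sum_j k j * psi s (a j).
Proof.
elim/big_rec2: _ => [|j b c _ <-]; first exact: psi0.
exact: psi_linear.
Qed.

Lemma psi_eq0 x (s : seq (H x)) a : sigma x a = 0 -> psi s a = 0.
Proof. by move=> a0; rewrite /psi big1// => h _; rewrite a0 /= ip0r. Qed.

Lemma psi_star x (s : seq (H x)) a : psi s (star a) = (psi s a)^*.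
Proof.
rewrite /psi rmorph_sum; apply: eq_bigr => h _ /=.
by rewrite -(rep_star (sM x)) -(ip_star (hs_ip (H x))).
Qed.

Lemma psi_sqE x (s : seq (H x)) a :
  psi s (smul (star a) a) = \sum_(h <- s) `|sigma x a h| ^+ 2.
Proof.
apply: eq_bigr => h _.
by rewrite (rep_smul (sM x)) -(rep_star (sM x)) hs_norm.
Qed.

Lemma psi_ge0 x (s : seq (H x)) a : 0 <= psi s (smul (star a) a).
Proof. by rewrite psi_sqE sumr_ge0// => h _; rewrite exprn_ge0. Qed.

(** An inequality between values of the functional, hence stable under limits: it will bound left
    multiplication on the GNS module. *)
Lemma psi_op_le x (s : seq (H x)) a b :
  psi s (smul (star (smul a b)) (smul a b)) <=
    (2 * `|a|) ^+ 2 * psi s (smul (star b) b).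
Proof.
rewrite !psi_sqE mulr_sumr; apply: ler_sum => h _.
rewrite -exprMn ler_pXn2r ?nnegrE ?mulr_ge0// (rep_smul (sM x)).
exact: rep_bounded.
Qed.

Lemma psi_bounded x (s : seq (H x)) a : mass s <= 1 ->
  `|psi s a| <= 2 * `|a|.
Proof.
move=> s1; apply: le_trans (_ : 2 * `|a| * (mass s)%:C%C <= _); last first.
  by rewrite ler_piMr ?mulr_ge0// lecR.
rewrite /psi /mass rmorph_sum mulr_sumr (le_trans (ler_norm_sum _ _ _))//.
apply: ler_sum => h _ /=; rewrite rip_norm (le_trans (hs_CS _ _))//.
by rewrite expr2 mulrC mulrA ler_wpM2r// rep_bounded.
Qed.

Lemma psi_convex x (I : Type) (r : seq I) (w : I -> R) (s : I -> seq (H x)) :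
  (forall i, 0 <= w i) ->
  exists2 s' : seq (H x), mass s' = \sum_(i <- r) w i * mass (s i) &
    forall a, psi s' a = \sum_(i <- r) (w i)%:C%C * psi (s i) a.
Proof.
move=> w0; elim: r => [|i r [s' m' p']].
  by exists [::]; [rewrite /mass !big_nil|move=> a; rewrite /psi !big_nil].
exists ([seq (Num.sqrt (w i))%:C%C *: h | h <- s i] ++ s').
  rewrite /mass big_cat big_map big_cons -/(mass s') m'; congr (_ + _).
  rewrite mulr_sumr; apply: eq_bigr => h _.
  by rewrite ripZl ripZr mulrA -expr2 sqr_sqrtr.
move=> a; rewrite /psi big_cat big_map big_cons -/(psi s' a) p'; congr (_ + _).
rewrite mulr_sumr; apply: eq_bigr => h _.
rewrite adj_opZ ipZl ipZr /GRing.scale /= mulrA; congr (_ * _).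
rewrite (CrealP _) ?ger0_real ?ler0c ?sqrtr_ge0//.
by rewrite -rmorphM -expr2 sqr_sqrtr.
Qed.

Hypothesis sigma_lsc : forall a : A,
  lower_semicontinuous (fun x => opnorm (sigma x a)).

Lemma Re_psi x (s : seq (H x)) a :
  complex.Re (psi s a) =
    \sum_(h <- s) rip h (sigma x (2^-1 *: (a + star a)) h).
Proof.
have -> : complex.Re (psi s a) = complex.Re (psi s (2^-1 *: (a + star a))).
  rewrite -[_ *: (a + _)]addr0 psi_linear -[a + star a]scale1r -[1 *: _]addr0.
  rewrite scalerDr -addrA [in RHS]psi_linear [psi s (1 *: _ + 0)]psi_linear.
  rewrite psi0 psi_star !addr0 !mul1r.
  have -> : psi s a + (psi s a)^* = 2 * (complex.Re (psi s a))%:C%C.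
    exact: addcJ.
  by rewrite mulrA mulVf ?pnatr_eq0// mul1r.
by rewrite /psi raddf_sum.
Qed.

(** A sum of mass at most 1 cannot exceed its best normalized vector, so a single [h] of [s] already
    reaches [mu - e / 2] on the self-adjoint part of [a]. [near_form] carries this one vector to the
    nearby fibres. *)
Lemma near_Re_psi x (s : seq (H x)) a (e : R) : mass s <= 1 -> 0 < e ->
  \forall y \near x, exists2 s' : seq (H y), mass s' <= 1 &
    complex.Re (psi s a) - e < complex.Re (psi s' a).
Proof.
move=> s1 e0; set mu := complex.Re (psi s a).
(* [near_form] only handles nonnegative thresholds; below [e] the zero functional, given by the
   empty sequence, is good enough. *)
have [mue|emu] := ltP mu e.
  near=> y; exists [::]; first by rewrite /mass big_nil.
  by rewrite /psi big_nil raddf0 subr_lt0.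
pose b := 2^-1 *: (a + star a).
have bs : star b = b.
  by rewrite /b starZ starD starK addrC fmorphV rmorph_nat.
have [h hp hmu] : exists2 h : H x, 0 < rip h h &
    (mu - e / 2) * rip h h <= rip h (sigma x b h).
  apply: contrapT => /forall2NP no.
  have : mu <= (mu - e / 2) * mass s.
    rewrite {1}/mu Re_psi -/b /mass mulr_sumr; apply: ler_sum => h _.
    have [h0|hn0] := eqVneq (rip h h) 0.
      by rewrite h0 mulr0 (rip_eq0 h0) rip0l.
    have [|/negP] := no h; first by rewrite lt_def hn0 rip_ge0.
    by rewrite -ltNge => /ltW.
  move=> H1; have := ler_wpM2l (_ : 0 <= mu - e / 2) s1.
  by rewrite mulr1 => H2; have := H2 ltac:(lra); lra.
apply: filterS (near_form sM sigma_lsc bs hp hmu (r := mu - e) _); last by lra.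
move=> y [k Hk].
have kp : 0 < rip k k.
  rewrite lt_def rip_ge0 andbT; apply/negP => /eqP k0; move: Hk.
  by rewrite k0 (rip_eq0 k0) rip0l mulr0 ltxx.
pose t := (Num.sqrt (rip k k))^-1.
have t2 : t * (t * rip k k) = 1.
  by rewrite mulrA -expr2 exprVn sqr_sqrtr ?rip_ge0// mulVf// gt_eqF.
exists [:: t%:C%C *: k]; first by rewrite /mass big_seq1 ripZl ripZr t2.
rewrite Re_psi big_seq1 -/b adj_opZ ripZl ripZr.
have t0 : 0 < t by rewrite invr_gt0 sqrtr_gt0.
have := Hk; rewrite -(ltr_pM2l t0) -(ltr_pM2l t0).
apply: le_lt_trans.
by rewrite [t * (_ * rip k k)]mulrCA [t * (_ * _)]mulrCA t2 mulr1.
Unshelve. all: by end_near. Qed.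

(** [near_Re_psi] treats one direction, that is, one linear combination of the [a j]. By
    [convex_near] directions in a bounded box suffice; a finite net of the box needs only finitely
    many neighbourhoods, and the intersection of these serves all directions. *)
Lemma near_Re_psi_family x (s : seq (H x)) (J : finType) (a : J -> A) (e : R) :
  mass s <= 1 -> 0 < e ->
  \forall y \near x, exists2 s' : seq (H y), mass s' <= 1 &
    \sum_j (complex.Re (psi s (a j)) - complex.Re (psi s' (a j))) ^+ 2 <= e.
Proof.
move=> s1 e0.
pose C := \sum_j 2 * complex.Re `|a j|.
have na j : 0 <= complex.Re `|a j| by rewrite -ler0c RRe_real ?normr_real.
have psiC y (s' : seq (H y)) j : mass s' <= 1 -> `|complex.Re (psi s' (a j))| <= C.
  move=> s'1; apply: le_trans (_ : 2 * complex.Re `|a j| <= _); last first.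
    by rewrite /C (bigD1 j)//= lerDl sumr_ge0// => i _; rewrite mulr_ge0.
  rewrite -lecR (le_trans (normc_ge_Re _))// (le_trans (psi_bounded _ s'1))//.
  by rewrite rmorphM /= rmorph_nat RRe_real ?normr_real.
have C0 : 0 <= C by rewrite sumr_ge0// => i _; rewrite mulr_ge0.
pose eta := e / 2; have eta0 : 0 < eta by rewrite divr_gt0.
(* Rounding a direction to the net changes its pairing with [v - w], whose entries are at most
   [2 * C], by at most [eta / 2]. The other half of [eta] is the tolerance given to
   [near_Re_psi]. *)
pose theta := eta / 2 / (1 + \sum_(j : J) 2 * C).
have S0 : 0 <= \sum_(j : J) 2 * C by rewrite sumr_ge0// => i _; rewrite mulr_ge0.
have th0 : 0 < theta by rewrite !divr_gt0// ltr_wpDr.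
have [n [g gP]] := interval_net (2 * C) th0.
have := @filter_forall _ {ffun J -> 'I_n.+1} _ (nbhs x) _
  (fun f => near_Re_psi (\sum_j (g (f j))%:C%C *: a j) s1 (divr_gt0 eta0 (ltr0Sn R 1))).
move=> /(_ _); apply: filterS => y Hy.
pose W : set (J -> R) := [set w | exists2 s' : seq (H y), mass s' <= 1 &
  w = (fun j => complex.Re (psi s' (a j)))].
have [|||||w [s' s'1 ->] Hw] := @convex_near R J W
    (fun j => complex.Re (psi s (a j))) C eta eta0 _ _ _ _ _.
- exists (fun j => complex.Re (psi (x := y) [::] (a j))); exists [::] => //.
  by rewrite /mass big_nil.
- move=> _ _ l [s2 s21 ->] [s3 s31 ->] /andP[l0 l1].
  have [|s4 m4 p4] := @psi_convex y bool [:: false; true]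
    (fun i => if i then l else 1 - l) (fun i => if i then s3 else s2).
    by case; rewrite ?subr_ge0.
  exists s4; first by rewrite m4 !big_cons big_nil; nra.
  apply/funext => j; rewrite p4 !big_cons big_nil addr0 raddfD /=.
  have ReM (k : R) (z : R[i]) : complex.Re (k%:C%C * z) = k * complex.Re z.
    by case: z => ? ?; simpc.
  by rewrite !ReM; ring.
- by move=> _ j [s2 s21 ->]; exact: psiC.
- by move=> j; exact: psiC.
- move=> t tC; have /choice[f fP] j := gP _ (tC j).
  have [s' s'1] := Hy (finfun f).
  have Re_psi_sum z (r : seq (H z)) :
      complex.Re (psi r (\sum_j (g (finfun f j))%:C%C *: a j)) =
      \sum_j g (f j) * complex.Re (psi r (a j)).
    rewrite psi_sum raddf_sum; apply: eq_bigr => j _.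
    by rewrite ffunE; case: (psi r (a j)) => ? ?; simpc.
  rewrite !Re_psi_sum => Hs'.
  exists (fun j => complex.Re (psi s' (a j))); first by exists s'.
  set v := fun j => complex.Re (psi s (a j)).
  set w := fun j => complex.Re (psi s' (a j)).
  have -> : \sum_j t j * (v j - w j) =
      (\sum_j g (f j) * v j - \sum_j g (f j) * w j) +
      \sum_j (t j - g (f j)) * (v j - w j).
    by rewrite -sumrB -big_split /=; apply: eq_bigr => j _; ring.
  suff : \sum_j (t j - g (f j)) * (v j - w j) <= eta / 2.
    by move: Hs'; rewrite -/(v _) -/(w _); lra.
  apply: le_trans (_ : theta * (1 + \sum_(j : J) 2 * C) <= _); last first.
    by rewrite /theta divfK// gt_eqF// ltr_wpDr.
  apply: le_trans (_ : theta * (\sum_(j : J) 2 * C) <= _); last first.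
    by rewrite ler_pM2l// lerDr.
  rewrite mulr_sumr; apply: ler_sum => j _.
  rewrite (le_trans (ler_norm _))// normrM ler_pM//.
  by rewrite (le_trans (ler_normB _ _))// mulr_natl mulr2n lerD ?psiC.
by exists s' => //; rewrite (le_trans Hw)// /eta mulrC divfK.
Qed.

End vector_functionals.

(** * Continuous selections *)

(** The covering form of compactness is applied to the filter generated by inclusion of finite
    sequences: each [x] is responsible for [U x] as soon as the sequence contains [x]. *)
Lemma compact_finite_cover (X : topologicalType) (U : X -> set X) :
  compact [set: X] -> (forall x, nbhs x (U x)) ->
  exists r : seq X, forall y, exists2 i, i \in r & U i y.
Proof.
move=> /compact_near_coveringP Xc xU.
pose F : set_system (seq X) :=
  [set S | exists r0 : seq X, forall r : seq X, {subset r0 <= r} -> S r].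
have FF : Filter F.
  split; first by exists [::].
    move=> S T [r1 H1] [r2 H2]; exists (r1 ++ r2) => r sr; split.
      by apply: H1 => i i1; apply: sr; rewrite mem_cat i1.
    by apply: H2 => i i2; apply: sr; rewrite mem_cat i2 orbT.
  by move=> S T ST [r HS]; exists r => r' /HS /ST.
have [x _|r /(_ r) H] := Xc _ F (fun r y => exists2 i, i \in r & U i y) FF.
  exists (U x, [set r : seq X | x \in r]).
    by split => //=; exists [:: x] => r; apply; rewrite inE.
  by move=> [y r] /= [Uy xr]; exists x.
by exists r => y; apply: H.
Qed.

Section partition_of_unity.
Context (R : realType) (X : topologicalType) (d : X -> X -> R).
Hypothesis d0 : forall x y, d x y = 0 <-> x = y.
Hypothesis dC : forall x y, d x y = d y x.
Hypothesis dT : forall x y z, d x z <= d x y + d y z.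
Hypothesis d_nbhs : forall x (U : set X),
  nbhs x U <-> exists2 r, 0 < r & [set y | d x y < r] `<=` U.

Lemma lipschitz_continuous (g : X -> R) :
  (forall y z, g y - g z <= d y z) ->
  continuous (fun y => (g y)%:C%C : R[i]^o).
Proof.
move=> gl x; apply/cvgrPdist_lt => e e0; apply/d_nbhs.
have er : e = (complex.Re e)%:C%C by rewrite RRe_real// gtr0_real.
exists (complex.Re e); first by move: e0; rewrite er ltcR.
move=> y /= xy; rewrite -rmorphB [X in X < _]normc_def /= expr0n addr0.
rewrite sqrtr_sqr er ltcR; apply: le_lt_trans xy.
by rewrite ler_norml gl andbT lerNl opprB dC gl.
Qed.

Lemma contC_sumE (I : Type) (r : seq I) (f : I -> contC R X) x :
  (\sum_(i <- r) f i) x = \sum_(i <- r) (f i x : R[i]) :> R[i].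
Proof. by elim/big_rec2: _ => // i _ g _ <-. Qed.

(** Metric bumps [Num.max 0 (rad i - d i y)], divided by their sum, which is positive because the
    balls of radius [rad i] cover. *)
Lemma partition_of_unity (U : X -> set X) :
  compact [set: X] -> (forall x, nbhs x (U x)) ->
  exists (r : seq X) (w : X -> X -> R),
    [/\ forall i, continuous (fun y => (w i y)%:C%C : R[i]^o),
        forall i y, 0 <= w i y, forall y, \sum_(i <- r) w i y = 1
      & forall i y, 0 < w i y -> U i y].
Proof.
move=> Xc xU.
have /choice[rad radP] (x : X) : exists r : R, 0 < r /\
    [set y | d x y < r] `<=` U x.
  by have /d_nbhs[r r0 rU] := xU x; exists r.
have [|r rP] := @compact_finite_cover X (fun x => [set y | d x y < rad x]) Xc.
  by move=> x; apply/d_nbhs; exists (rad x) => //; have [] := radP x.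
pose b i y := Num.max 0 (rad i - d i y).
have b_ge0 i y : 0 <= b i y by rewrite le_max lexx.
have bc i : continuous (fun y => (b i y)%:C%C : R[i]^o).
  apply: lipschitz_continuous => y z; rewrite /b.
  have dyz : 0 <= d y z.
    by have := dT y z y; rewrite (proj2 (d0 y y))// [d z y]dC; lra.
  rewrite lerBlDr ge_max; apply/andP; split.
    by apply: addr_ge0 => //; rewrite le_max lexx.
  have : rad i - d i z <= Num.max 0 (rad i - d i z) by rewrite le_max lexx orbT.
  by have := dT i y z; have := dT i z y; rewrite [d z y]dC; lra.
pose S y := \sum_(i <- r) b i y.
have S0 y : 0 < S y.
  have [i ir /= iy] := rP y.
  rewrite /S (big_rem i)//= ltr_pwDl// ?sumr_ge0//.
  by rewrite lt_max subr_gt0 iy orbT.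
exists r, (fun i y => b i y / S y); split.
- move=> i y.
  have -> : (fun y => (b i y / S y)%:C%C : R[i]^o) =
      (fun y => ((b i y)%:C%C : R[i]) *
        ((\sum_(j <- r) contC_of (bc j)) y : R[i])^-1 : R[i]^o).
    by apply/funext => z; rewrite contC_sumE rmorphM fmorphV /= rmorph_sum.
  apply: cvgM; first exact: bc.
  apply: cvgV; last exact: cts_fun.
  rewrite contC_sumE /= -rmorph_sum gt_eqF//.
  by rewrite -[0]/(0%:C%C) ltcR S0.
- by move=> i y; rewrite divr_ge0// ltW.
- by move=> y; rewrite -mulr_suml divff// gt_eqF// S0.
- move=> i y; rewrite pmulr_lgt0 ?invr_gt0// lt_max ltxx /= subr_gt0 => iy.
  by have [_] := radP i; apply.
Qed.

Section selection.
Hypothesis Xcpt : compact [set: X].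
Context (Q : X -> set (nat -> R[i])).
Hypothesis Q_ne : forall x, Q x !=set0.
Hypothesis Q_convex : forall x (I : Type) (r : seq I) (w : I -> R)
    (q : I -> nat -> R[i]), (forall i, 0 <= w i) -> \sum_(i <- r) w i = 1 ->
  (forall i, Q x (q i)) -> Q x (fun j => \sum_(i <- r) (w i)%:C%C * q i j).
Hypothesis Q_lsc : forall x q n (e : R[i]), Q x q -> 0 < e ->
  \forall y \near x, exists2 q', Q y q' &
    forall j, (j < n)%N -> `|q j - q' j| <= e.

(** The product topology on sequences, one coordinate at a time: stage [n] controls only the first
    [n] coordinates, so a new coordinate may be chosen freely when it enters. *)
Definition approx_selection (n : nat) (f : nat -> contC R X) :=
  forall y, exists2 q, Q y q & forall j, (j < n)%N -> `|q j - f j y| <= 2^-1 ^+ n.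

(** Around each [x], a point [q x] of [Q x] near [f] stays within [2^-1 ^+ n.+1] of [Q y] and [f]
    varies by at most [2^-1 ^+ n]. A partition of unity averages the constants [q x], and convexity
    keeps the average near [Q y]. The two errors of size [2^-1 ^+ n] make up the distance from
    [f]. *)
Lemma approx_selection_step n (f : nat -> contC R X) : approx_selection n f ->
  exists2 g, approx_selection n.+1 g &
    forall j y, (j < n)%N -> `|g j y - f j y| <= 2 * 2^-1 ^+ n.
Proof.
move=> fn.
have e0 m : 0 < 2^-1 ^+ m :> R[i] by rewrite exprn_gt0// invr_gt0.
have /choice[q qP] (x : X) : exists q, Q x q /\
    forall j, (j < n)%N -> `|q j - f j x| <= 2^-1 ^+ n.
  by have [q] := fn x; exists q.
pose U x : set X := [set y | (exists2 q', Q y q' &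
      forall j, (j < n.+1)%N -> `|q x j - q' j| <= 2^-1 ^+ n.+1) /\
    forall j : 'I_n, `|f j x - f j y : R[i]| <= 2^-1 ^+ n].
have Unbhs x : nbhs x (U x).
  apply: filterI; first by apply: Q_lsc => //; have [] := qP x.
  apply: filter_forall => j.
  by have /cvgrPdist_le/(_ _ (e0 n)) := @cts_fun _ _ (f j) x.
have [r [w [wc w0 w1 wU]]] := partition_of_unity Xcpt Unbhs.
have fc j : continuous (fun y => \sum_(i <- r) (w i y)%:C%C * q i j : R[i]^o).
  move=> y; have -> : (fun y => \sum_(i <- r) (w i y)%:C%C * q i j : R[i]^o) =
    (\sum_(i <- r) contC_scale (q i j) (contC_of (wc i)) : contC R X).
    apply/funext => z; rewrite contC_sumE; apply: eq_bigr => i _.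
    by rewrite mulrC.
  exact: cts_fun.
have dist_le y (z : R[i]) (e : R[i]) (v : X -> R[i]) : 0 <= e ->
    (forall i, 0 < w i y -> `|v i - z| <= e) ->
    `|\sum_(i <- r) (w i y)%:C%C * v i - z| <= e.
  move=> e_ge0 vz.
  have -> : z = \sum_(i <- r) (w i y)%:C%C * z.
    by rewrite -mulr_suml -rmorph_sum /= w1 mul1r.
  rewrite -sumrB (le_trans (ler_norm_sum _ _ _))//.
  have -> : e = \sum_(i <- r) (w i y)%:C%C * e.
    by rewrite -mulr_suml -rmorph_sum /= w1 mul1r.
  apply: ler_sum => i _; rewrite -mulrBr normrM ger0_norm ?ler0c//.
  have := w0 i y; rewrite le_eqVlt => /predU1P[<-|/vz vi]; first by rewrite !mul0r.
  by rewrite ler_wpM2l// ler0c.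
exists (fun j => contC_of (fc j)).
  move=> y.
  (* Indices of weight zero at [y] may lie outside every neighbourhood; an arbitrary point of [Q y]
     is used for them and does not contribute. *)
  have /choice[q' q'P] (i : X) : exists q', Q y q' /\ (0 < w i y ->
      forall j, (j < n.+1)%N -> `|q i j - q' j| <= 2^-1 ^+ n.+1).
    have [/wU[[q' Qq' H] _]|wn] := pselect (0 < w i y); first by exists q'.
    by have [q' Qq'] := Q_ne y; exists q'.
  exists (fun j => \sum_(i <- r) (w i y)%:C%C * q' i j).
    by apply: Q_convex => // i; have [] := q'P i.
  move=> j jn /=.
  have -> : \sum_(i <- r) (w i y)%:C%C * q' i j -
      \sum_(i <- r) (w i y)%:C%C * q i j =
      \sum_(i <- r) (w i y)%:C%C * (q' i j - q i j) - 0.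
    by rewrite subr0 -sumrB; apply: eq_bigr => i _; rewrite mulrBr.
  apply: dist_le; first by rewrite exprn_ge0// invr_ge0.
  by move=> i wi; rewrite subr0 distrC; have [_] := q'P i; apply.
move=> j y jn /=; apply: dist_le; first by rewrite mulr_ge0 ?exprn_ge0 ?invr_ge0.
move=> i /wU[_ /(_ (Ordinal jn)) /= fi].
rewrite -(subrKA (f j i)) mulr_natl mulr2n (le_trans (ler_normD _ _))// lerD//.
by have [_] := qP i; apply.
Qed.

Lemma michael_selection : exists f : nat -> contC R X,
  forall y n (e : R[i]), 0 < e ->
    exists2 q, Q y q & forall j, (j < n)%N -> `|q j - f j y| <= e.
Proof.
have [F0 HF0] : exists f, approx_selection 0 f.
  by exists (fun=> 0) => y; have [q Qq] := Q_ne y; exists q.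
(* The step as a total function, returning the dummy value [F0] on inputs that are not approximate
   selections, so that it can be iterated. *)
have /choice[T TP] (nf : nat * (nat -> contC R X)) :
    exists g, approx_selection nf.1 nf.2 -> approx_selection nf.1.+1 g /\
    forall j y, (j < nf.1)%N -> `|g j y - nf.2 j y| <= 2 * 2^-1 ^+ nf.1.
  have [/approx_selection_step[g H1 H2]|no] :=
    pselect (approx_selection nf.1 nf.2); first by exists g.
  by exists F0.
pose F := fix F n := if n is m.+1 then T (m, F m) else F0.
have FA n : approx_selection n (F n).
  by elim: n => [//|n IH]; have [] := TP (n, F n) IH.
have Fstep n j y : (j < n)%N -> `|F n.+1 j y - F n j y| <= 2 * 2^-1 ^+ n.
  by move=> jn; have [_] := TP (n, F n) (FA n); apply.
(* Telescoping: the geometric series of the steps [2 * 2^-1 ^+ i] from [n] to [n + k - 1]. *)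
have Fdist n k j y : (j < n)%N ->
    `|F (n + k)%N j y - F n j y| <= 4 * (2^-1 ^+ n - 2^-1 ^+ (n + k)).
  move=> jn; elim: k => [|k IH]; first by rewrite addn0 !subrr normr0 mulr0.
  rewrite addnS -(subrKA (F (n + k)%N j y)) (le_trans (ler_normD _ _))//.
  have := lerD (Fstep (n + k)%N j y (ltn_addr _ jn)) IH => /le_trans; apply.
  rewrite exprS le_eqVlt; apply/orP; left; apply/eqP; by field.
have small (e : R[i]) : 0 < e -> exists n, 4 * 2^-1 ^+ n <= e.
  move=> e0; have [|n Hn] := @complex_archi R (e / 4); first by rewrite divr_gt0.
  by exists n; rewrite mulrC -ler_pdivlMr// ltW.
have Flim j : exists g : contC R X, forall e : R[i], 0 < e -> exists N,
    forall n, (N <= n)%N -> forall x, `|F n j x - g x| <= e.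
  apply: contC_cauchy => e e0.
  have [N HN] := small _ (divr_gt0 e0 (ltr0Sn R[i] 1)).
  pose M := maxn N j.+1.
  have HM n x : (M <= n)%N -> `|F n j x - F M j x| <= e / 2.
    move=> Mn; rewrite -(subnKC Mn) (le_trans (Fdist _ _ _ _ _))//.
      by rewrite leq_max leqnn orbT.
    apply: le_trans HN; rewrite ler_pM2l// (@le_trans _ _ (2^-1 ^+ M))//.
      by rewrite gerBl ltW.
    by rewrite ler_wiXn2l// ?invr_ge0// ?invf_le1// ?ler1n// leq_maxl.
  exists M => n m Mn Mm x; rewrite -(subrKA (F M j x)).
  rewrite (le_trans (ler_normD _ _))// [e]splitr lerD ?HM//.
  by rewrite distrC HM.
have /choice[f fP] := Flim; exists f => y n e e0.
have e2 : 0 < e / 2 by rewrite divr_gt0.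
have [N1 H1] := small _ e2.
have /choice[N2 H2] (j : nat) := fP j _ e2.
pose M := (N1 + n + \sum_(j < n) N2 j)%N.
have nM : (n <= M)%N by rewrite /M -addnA addnCA leq_addr.
have [q Qq HM] := FA M y; exists q => // j jn.
rewrite -(subrKA (F M j y)) [e]splitr (le_trans (ler_normD _ _))// lerD//.
  apply: le_trans (HM _ (leq_trans jn nM)) _.
  apply: le_trans H1; apply: (@le_trans _ _ (2^-1 ^+ N1)).
    by rewrite ler_wiXn2l// ?invr_ge0// ?invf_le1// ?ler1n// /M -addnA leq_addr.
  by rewrite ler_peMl ?exprn_ge0 ?invr_ge0// ler1n.
by apply: H2; rewrite /M (bigD1 (Ordinal jn))//= addnCA leq_addr.
Qed.

End selection.
End partition_of_unity.

(** * Continuous fields of functionals *)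

Section continuous_selection.
Context (R : realType) (X : topologicalType) (A : cstarAlgType R).
Context (H : X -> hilbertSpace R).
Context (sigma : forall x, A -> adjointable (hs_ip (H x))).
Hypothesis sM : forall x, star_morphism (sigma x).

(* [phi ^~ y] is a weak-* limit of vector functionals of [sigma_y]. *)
Definition functional_field (phi : A -> contC R X) :=
  forall y (l : seq A) (e : R[i]), 0 < e ->
    exists2 s : seq (H y), mass s <= 1 &
      forall a, a \in l -> `|psi sigma s a - phi a y| <= e.

Hypothesis sigma_lsc : forall a : A,
  lower_semicontinuous (fun x => opnorm (sigma x a)).
Context (d : X -> X -> R).
Hypothesis d0 : forall x y, d x y = 0 <-> x = y.
Hypothesis dC : forall x y, d x y = d y x.
Hypothesis dT : forall x y z, d x z <= d x y + d y z.
Hypothesis d_nbhs : forall x (U : set X),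
  nbhs x U <-> exists2 r, 0 < r & [set y | d x y < r] `<=` U.
Hypothesis Xcpt : compact [set: X].
Hypothesis Asep : separable_space A.

(** Imaginary parts are the real parts of the values at [- 'i%C *: a j], hence the doubled index
    set. Each part is allowed half of [e], so the sum of squares is asked to be at most the square
    of that half. *)
Lemma near_psi_family x (s : seq (H x)) (J : finType) (a : J -> A) (e : R[i]) :
  mass s <= 1 -> 0 < e ->
  \forall y \near x, exists2 s' : seq (H y), mass s' <= 1 &
    forall j, `|psi sigma s (a j) - psi sigma s' (a j)| <= e.
Proof.
move=> s1 e0.
have er : e = (complex.Re e)%:C%C by rewrite RRe_real// gtr0_real.
have e1 : 0 < complex.Re e by move: e0; rewrite er ltcR.
pose a' (jb : J * bool) := if jb.2 then - 'i%C *: a jb.1 else a jb.1.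
have := near_Re_psi_family sM sigma_lsc a' s1
  (exprn_gt0 2 (divr_gt0 e1 (ltr0Sn R 1))).
apply: filterS => y [s' s'1 Hs']; exists s' => // j.
have part b : `|complex.Re (psi sigma s (a' (j, b))) -
    complex.Re (psi sigma s' (a' (j, b)))| <= complex.Re e / 2.
  rewrite -(@ler_pXn2r _ 2%N)// ?nnegrE ?divr_ge0 ?(ltW e1)//.
  rewrite real_normK ?num_real//; apply: le_trans Hs'.
  rewrite (bigD1 (j, b))//= lerDl sumr_ge0// => i _; exact: sqr_ge0.
have im z (r : seq (H z)) : complex.Re (psi sigma r (a' (j, true))) =
    complex.Im (psi sigma r (a j)).
  rewrite /a' /= -[_ *: _]addr0 psi_linear// psi0// addr0.
  by case: (psi sigma r (a j)) => u v; simpc.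
have := part true; have := part false; rewrite !im /=.
set z := psi sigma s (a j); set z' := psi sigma s' (a j) => h1 h2.
have -> : z - z' = (complex.Re z - complex.Re z')%:C%C +
    'i%C * (complex.Im z - complex.Im z')%:C%C.
  by case: z z' {h1 h2} => ? ? [? ?]; simpc.
rewrite (le_trans (ler_normD _ _))// normrM.
have -> : `|'i%C : R[i]| = 1 by rewrite normc_def /= expr0n expr1n add0r sqrtr1.
rewrite mul1r er [in leRHS](splitr (complex.Re e)) [in leRHS]rmorphD lerD//=.
  by rewrite normc_def /= expr0n addr0 sqrtr_sqr lecR.
by rewrite normc_def /= expr0n addr0 sqrtr_sqr lecR.
Qed.

Lemma separable_sequence : exists a : nat -> A,
  forall b (e : R[i]), 0 < e -> exists j, `|b - a j| <= e.
Proof.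
have [D [/countable_injP[f f_inj] Dd]] := Asep.
have /choice[a aP] (n : nat) : exists b : A, forall b', D b' -> f b' = n -> b = b'.
  have [[b Db fb]|no] := pselect (exists2 b, D b & f b = n).
    exists b => b' Db' fb'; apply: f_inj; rewrite ?inE//.
    by rewrite fb fb'.
  by exists 0 => b' Db' fb'; case: no; exists b'.
exists a => b e e0.
have [||b' [/= bb' Db']] := Dd (ball b e).
- by exists b; exact: ballxx.
- exact: ball_open.
exists (f b'); rewrite (aP (f b') b')//.
by move: bb'; rewrite -ball_normE /= => /ltW.
Qed.

(** Selection yields continuous values [f j] on the dense sequence [a]. All functionals of mass at
    most 1 are Lipschitz with constant 2, so the [f j] extend uniformly in [y] to all of [A]. *)
Lemma functional_field_exists x0 (s0 : seq (H x0)) : mass s0 <= 1 ->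
  exists2 phi, functional_field phi & forall a, phi a x0 = psi sigma s0 a.
Proof.
move=> s01; have [a a_dense] := separable_sequence.
pose q0 j := psi sigma s0 (a j).
(* Prescribing the functional at [x0] preserves lower semicontinuity. *)
pose Q x : set (nat -> R[i]) := [set q |
  (exists2 s : seq (H x), mass s <= 1 & q = fun j => psi sigma s (a j)) /\
  (x = x0 -> q = q0)].
have Q_x0 : Q x0 q0 by split => //; exists s0.
have Q_other x (s : seq (H x)) : x <> x0 -> mass s <= 1 ->
    Q x (fun j => psi sigma s (a j)).
  by move=> xx0 s1; split => //; exists s.
have Q_ne x : Q x !=set0.
  have [->|xx0] := pselect (x = x0); first by exists q0.
  by eexists; apply: (Q_other x [::] xx0); rewrite /mass big_nil.
have Q_convex x (I : Type) (r : seq I) (w : I -> R) (q : I -> nat -> R[i]) :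
    (forall i, 0 <= w i) -> \sum_(i <- r) w i = 1 -> (forall i, Q x (q i)) ->
    Q x (fun j => \sum_(i <- r) (w i)%:C%C * q i j).
  move=> w0 w1 qQ; split.
    have /choice[s sP] (i : I) : exists s : seq (H x), mass s <= 1 /\
        q i = fun j => psi sigma s (a j).
      by have [[s ? ?] _] := qQ i; exists s.
    have [s' m' p'] := psi_convex sigma r s w0.
    exists s'.
      rewrite m' -w1; apply: ler_sum => i _.
      by rewrite ler_piMr//; have [] := sP i.
    apply/funext => j; rewrite p'; apply: eq_bigr => i _.
    by have [_ ->] := sP i.
  move=> xx0; apply/funext => j.
  under eq_bigr => i _ do rewrite (proj2 (qQ i) xx0).
  by rewrite -mulr_suml -rmorph_sum /= w1 mul1r.
have Q_lsc x q n (e : R[i]) : Q x q -> 0 < e ->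
    \forall y \near x, exists2 q', Q y q' &
      forall j, (j < n)%N -> `|q j - q' j| <= e.
  move=> [[s s1 qs] qx0] e0.
  (* A point [x] other than [x0] has a neighbourhood avoiding [x0], so the shrunken set at [x0] is
     met only when [x = x0], where [q] is already [q0]. *)
  have xy : \forall y \near x, y = x0 -> x = x0.
    have [->|xx0] := pselect (x = x0); first by near=> y.
    apply/d_nbhs; exists (d x x0); last by move=> y /[swap] -> /=; rewrite ltxx.
    rewrite lt_def; apply/andP; split; first by apply/eqP => /d0.
    by have := dT x x0 x; rewrite (proj2 (d0 x x))// [d x0 x]dC; lra.
  apply: filterS2 xy (near_psi_family (fun j : 'I_n => a j) s1 e0) => y xy [s' s'1 Hs'].
  have [yx0|yx0] := pselect (y = x0).
    exists q0; first by rewrite yx0.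
    by move=> j _; rewrite (qx0 (xy yx0)) subrr normr0 ltW.
  exists (fun j => psi sigma s' (a j)); first exact: Q_other.
  by move=> j jn; have := Hs' (Ordinal jn); rewrite qs.
have [f fP] := michael_selection d0 dC dT d_nbhs Xcpt Q_ne Q_convex Q_lsc.
have f_near i y (e : R[i]) : 0 < e -> exists s : seq (H y), [/\ mass s <= 1,
    forall j, (j < i)%N -> `|psi sigma s (a j) - f j y| <= e &
    y = x0 -> forall j, psi sigma s (a j) = psi sigma s0 (a j)].
  move=> e0; have [q [[s s1 ->] qx0] Hq] := fP y i e e0.
  by exists s; split => // /qx0/funeqP.
have psiB y (s : seq (H y)) b c : psi sigma s (b - c) = psi sigma s b - psi sigma s c.
  by rewrite addrC -scaleN1r psi_linear// mulN1r addrC.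
have f_lip i j y (e : R[i]) : 0 < e ->
    `|f i y - f j y| <= 2 * `|a i - a j| + 2 * e.
  move=> e0; have [s [s1 Hs _]] := f_near (maxn i.+1 j.+1) y e e0.
  have -> : (f i y : R[i]) - f j y = psi sigma s (a i - a j) -
      (psi sigma s (a i) - f i y) + (psi sigma s (a j) - f j y).
    by rewrite psiB; ring.
  rewrite (le_trans (ler_normD _ _))// [2 * e]mulr_natl [e *+ 2]mulr2n addrA.
  rewrite lerD ?Hs ?leq_max ?leqnn ?orbT//.
  rewrite (le_trans (ler_normB _ _))// lerD ?Hs ?leq_max ?leqnn//.
  exact: psi_bounded.
have /choice[phi phiP] (b : A) : exists g : contC R X, forall e : R[i], 0 < e ->
    exists2 i, `|b - a i| <= e & forall y, `|f i y - g y| <= e.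
  have /choice[i iP] (n : nat) : exists j, `|b - a j| <= 2^-1 ^+ n.
    by apply: a_dense; rewrite exprn_gt0// invr_gt0.
  have i_small (e : R[i]) : 0 < e ->
      exists N, forall n, (N <= n)%N -> `|b - a (i n)| <= e.
    move=> /complex_archi[N HN]; exists N => n Nn.
    apply: le_trans (iP n) (le_trans _ (ltW HN)).
    by rewrite ler_wiXn2l// ?invr_ge0// ?invf_le1// ?ler1n.
  have [|g gP] := @contC_cauchy R X (f \o i).
    move=> e e0; have e8 : 0 < e / 8 by rewrite divr_gt0.
    have [N HN] := i_small _ e8; exists N => n m Nn Nm x /=.
    have -> : e = 2 * (e / 8 + e / 8) + 2 * (e / 4) by field.
    apply: le_trans (f_lip _ _ _ (e / 4) _) _; first by rewrite divr_gt0.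
    rewrite lerD// ler_pM2l// -(subrKA b) (le_trans (ler_normD _ _))//.
    by rewrite lerD// ?HN// distrC HN.
  exists g => e e0; have [N1 H1] := i_small _ e0; have [N2 H2] := gP _ e0.
  exists (i (maxn N1 N2)); first by rewrite H1// leq_maxl.
  by move=> y; apply: H2; rewrite leq_maxr.
exists phi.
  move=> y l e e0.
  have e4 : 0 < e / 4 by rewrite divr_gt0.
  have /choice[i iP] (b : A) : exists i, `|b - a i| <= e / 4 /\
      `|f i y - phi b y| <= e / 4.
    by have [i h1 h2] := phiP b _ e4; exists i.
  (* Taking the maximum of the indices lets a single [s] serve all elements of [l]
     simultaneously. *)
  have [s [s1 Hs _]] := f_near (\max_(b <- l) (i b).+1)%N y _ e4.
  exists s => // b bl; have [b1 b2] := iP b.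
  have -> : psi sigma s b - phi b y = psi sigma s (b - a (i b)) +
      (psi sigma s (a (i b)) - f (i b) y) + (f (i b) y - phi b y).
    by rewrite psiB; ring.
  have -> : e = 2 * (e / 4) + e / 4 + e / 4 by field.
  rewrite (le_trans (ler_normD _ _))// lerD//.
  rewrite (le_trans (ler_normD _ _))// lerD//.
    by rewrite (le_trans (psi_bounded sM _ s1))// ler_pM2l.
  by apply: Hs; rewrite (big_rem b)//= leq_max leqnn.
(* At [x0] the approximating [s] agree with [s0] exactly on the dense sequence, so the limit is
   [psi s0] on all of [A]. *)
move=> b; apply/eqP; rewrite -subr_eq0; apply/eqP.
apply: (@small_norm_eq0 _ _ 4) => e e0.
have [i b1 b2] := phiP b _ e0.
have [s [s1 Hs sx0]] := f_near i.+1 x0 _ e0.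
have -> : phi b x0 - psi sigma s0 b = - psi sigma s0 (b - a i) -
    (psi sigma s (a i) - f i x0) - (f i x0 - phi b x0).
  by rewrite psiB sx0//; ring.
have -> : 4 * e = 2 * e + e + e by ring.
rewrite (le_trans (ler_normB _ _))// lerD//.
rewrite (le_trans (ler_normB _ _))// lerD ?Hs// normrN.
by rewrite (le_trans (psi_bounded sM _ s01))// ler_pM2l.
Unshelve. all: by end_near. Qed.

Section properties.
Context (phi : A -> contC R X) (phiF : functional_field phi).

(** The relation holds for every [psi s], and one [s] approximates [phi] at all the finitely many
    elements it involves. The properties that follow are obtained in the same way. *)
Lemma functional_field_linear y (k : R[i]) a b :
  phi (k *: a + b) y = k * phi a y + phi b y :> R[i].
Proof.
apply/eqP; rewrite -subr_eq0; apply/eqP.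
apply: (@small_norm_eq0 _ _ (2 + `|k|)) => e e0.
have [s s1 Hs] := phiF y [:: k *: a + b; a; b] e0.
have -> : (phi (k *: a + b) y : R[i]) - (k * phi a y + phi b y) =
    - (psi sigma s (k *: a + b) - phi (k *: a + b) y) +
    k * (psi sigma s a - phi a y) + (psi sigma s b - phi b y).
  by rewrite psi_linear//; ring.
have -> : (2 + `|k|) * e = e + `|k| * e + e by ring.
rewrite (le_trans (ler_normD _ _))// lerD ?Hs ?inE ?eqxx ?orbT//.
rewrite (le_trans (ler_normD _ _))// lerD ?normrN ?Hs ?inE ?eqxx ?orbT//.
by rewrite normrM ler_wpM2l// Hs// !inE eqxx ?orbT.
Qed.

Lemma functional_field_star y a : phi (star a) y = (phi a y : R[i])^* :> R[i].
Proof.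
apply/eqP; rewrite -subr_eq0; apply/eqP.
apply: (@small_norm_eq0 _ _ 2) => e e0.
have [s s1 Hs] := phiF y [:: star a; a] e0.
have -> : (phi (star a) y : R[i]) - (phi a y : R[i])^* =
    (psi sigma s a - phi a y)^* - (psi sigma s (star a) - phi (star a) y).
  by rewrite psi_star// rmorphB /=; ring.
rewrite (le_trans (ler_normB _ _))// norm_conjC mulr_natl mulr2n.
by rewrite lerD ?Hs ?inE ?eqxx ?orbT.
Qed.

Lemma functional_field_ge0 y a : 0 <= (phi (smul (star a) a) y : R[i]).
Proof.
apply: near_ge0 => e e0.
have [s s1 Hs] := phiF y [:: smul (star a) a] e0.
by exists (psi sigma s (smul (star a) a)); rewrite ?psi_ge0// Hs// inE.
Qed.

Lemma functional_field_op_le y a b :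
  (phi (smul (star (smul a b)) (smul a b)) y : R[i]) <=
    (2 * `|a|) ^+ 2 * phi (smul (star b) b) y.
Proof.
set u := smul (star (smul a b)) _; set v := smul (star b) b.
set c := (2 * `|a|) ^+ 2; rewrite -subr_ge0.
have c0 : 0 <= c by rewrite exprn_ge0// mulr_ge0.
apply: near_ge0 => e e0.
have e1 : 0 < e / (1 + c) by rewrite divr_gt0// ltr_wpDr.
have [s s1 Hs] := phiF y [:: u; v] e1.
exists (c * psi sigma s v - psi sigma s u).
  by rewrite subr_ge0 /u /v /c psi_op_le.
have -> : c * psi sigma s v - psi sigma s u - (c * phi v y - phi u y) =
    c * (psi sigma s v - phi v y) - (psi sigma s u - phi u y) by ring.
have -> : e = c * (e / (1 + c)) + e / (1 + c).
  by field; rewrite gt_eqF// ltr_wpDr.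
rewrite (le_trans (ler_normB _ _))// lerD ?Hs ?inE ?eqxx ?orbT//.
by rewrite normrM ger0_norm// ler_wpM2l// Hs// !inE eqxx orbT.
Qed.

Lemma functional_field_eq0 y a : sigma y a = 0 -> phi a y = 0 :> R[i].
Proof.
move=> a0; apply: (@small_norm_eq0 _ _ 1) => e e0.
have [s s1 Hs] := phiF y [:: a] e0.
by rewrite mul1r -normrN -[- _]add0r -(psi_eq0 s a0) Hs// inE.
Qed.

End properties.
End continuous_selection.

(** * Completion of pre-Hilbert modules *)

(** The form may be degenerate. A vector [v] will enter the completion only through the function
    [ph_form ^~ v], which kills null vectors and makes the module axioms hold pointwise in C(X). *)
Record preHilbertModule (R : realType) (X : topologicalType) := {
  ph_space :> lmodType R[i] ;
  ph_form : ph_space -> ph_space -> contC R X ;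
  ph_act : ph_space -> contC R X -> ph_space ;
  ph_linear : forall u (k : R[i]) v w x,
    ph_form u (k *: v + w) x = k * ph_form u v x + ph_form u w x :> R[i] ;
  ph_star : forall u v x, (ph_form u v x : R[i])^* = ph_form v u x :> R[i] ;
  ph_ge0 : forall u x, (0 : R[i]) <= ph_form u u x ;
  ph_bounded : forall u, exists2 M : R[i], 0 <= M &
    forall x, `|ph_form u u x : R[i]| <= M ;
  ph_form_act : forall u v f x,
    ph_form u (ph_act v f) x = (ph_form u v x : R[i]) * f x :> R[i]
}.

Section completion.
Context (R : realType) (X : topologicalType) (V : preHilbertModule R X).
Implicit Types (u v w : V) (x : X).

Local Notation B := (@ph_form R X V).

Definition ph_norm x u : R[i] := sqrtC (B u u x).
Local Notation N := ph_norm.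

Lemma ph_norm_ge0 x u : 0 <= N x u.
Proof. by rewrite sqrtC_ge0 ph_ge0. Qed.
Hint Resolve ph_norm_ge0 : core.

Lemma ph_normK x u : N x u ^+ 2 = B u u x.
Proof. exact: sqrtCK. Qed.

Lemma ph_formDr u v w x : B u (v + w) x = (B u v x : R[i]) + B u w x :> R[i].
Proof. by rewrite -[v in LHS]scale1r ph_linear mul1r. Qed.

Lemma ph_form0r u x : B u 0 x = 0 :> R[i].
Proof. by apply: (addIr (B u 0 x : R[i])); rewrite -ph_formDr !add0r. Qed.

Lemma ph_formZr u (k : R[i]) v x : B u (k *: v) x = k * B u v x :> R[i].
Proof. by rewrite -[k *: v]addr0 ph_linear ph_form0r addr0. Qed.

Lemma ph_formNr u v x : B u (- v) x = - (B u v x : R[i]) :> R[i].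
Proof. by rewrite -scaleN1r ph_formZr mulN1r. Qed.

Lemma ph_formDl u v w x : B (u + v) w x = (B u w x : R[i]) + B v w x :> R[i].
Proof. by rewrite -ph_star ph_formDr rmorphD /= !ph_star. Qed.

Lemma ph_formZl u (k : R[i]) v x : B (k *: u) v x = k^* * B u v x :> R[i].
Proof. by rewrite -ph_star ph_formZr rmorphM /= ph_star. Qed.

Lemma ph_CS u v x : `|B u v x : R[i]| <= N x u * N x v.
Proof.
rewrite -(@ler_pXn2r _ 2%N)// ?nnegrE ?mulr_ge0// exprMn !ph_normK.
apply: quadratic_CS => [| |z]; rewrite ?ph_ge0//.
have := ph_ge0 (u + z *: v) x.
rewrite ph_formDl !ph_formDr !ph_formZl !ph_formZr -(ph_star u v) normCK.
set a := (B u u x : R[i]); set b := (B u v x : R[i]); set c := (B v v x : R[i]).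
by congr (_ <= _); ring.
Qed.

(* The completion is realized as the closure of the functions [B ^~ v] in
   [V -> C(X)]; such an [F] is thought of as [u |-> <u, F>]. *)
Definition close_to (F : V -> contC R X) v (e : R[i]) :=
  forall u x, `|(F u x : R[i]) - B u v x| <= e * N x u.

Definition approximable : {pred V -> contC R X} :=
  [pred F | `[< forall e : R[i], 0 < e -> exists v, close_to F v e >]].

Lemma close_toD (k : R[i]) F G v w e e' : close_to F v e -> close_to G w e' ->
  close_to (k *: F + G) (k *: v + w) (`|k| * e + e').
Proof.
move=> Fv Gw u x; rewrite ph_linear.
have -> : (k *: F + G) u x = k * F u x + G u x :> R[i] by [].
have -> : k * F u x + G u x - (k * B u v x + B u w x) =
  k * ((F u x : R[i]) - B u v x) + ((G u x : R[i]) - B u w x) by ring.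
rewrite (le_trans (ler_normD _ _))// mulrDl lerD//.
by rewrite normrM -mulrA ler_wpM2l.
Qed.

Lemma close_toW F v (e e' : R[i]) : e <= e' -> close_to F v e -> close_to F v e'.
Proof. by move=> ee' Fv u x; rewrite (le_trans (Fv u x))// ler_wpM2r. Qed.

Fact approximable_submod : submod_closed approximable.
Proof.
split=> [|k F G].
  apply/asboolP => e e0; exists 0 => u x.
  by rewrite ph_form0r subr0 normr0 mulr_ge0// ltW.
move=> /asboolP Fa /asboolP Ga; apply/asboolP => e e0.
have k1 : 0 < `|k| + 1 by rewrite ltr_wpDl.
have e1 : 0 < e / (`|k| + 1) by rewrite divr_gt0.
have [v Fv] := Fa _ e1; have [w Gw] := Ga _ e1.
exists (k *: v + w); apply: close_toW (close_toD k Fv Gw).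
by rewrite -[X in _ + X]mul1r -mulrDl mulrC divfK// gt_eqF.
Qed.

HB.instance Definition _ := GRing.isSubmodClosed.Build R[i] (V -> contC R X)
  approximable approximable_submod.

Record completion := Completion {
  completion_fun :> V -> contC R X ;
  completionP : completion_fun \in approximable
}.

HB.instance Definition _ := [isSub for completion_fun].
HB.instance Definition _ := [Choice of completion by <:].
HB.instance Definition _ := [SubChoice_isSubLmodule of completion by <:].

Implicit Types F G : completion.

Lemma completion_approx F (e : R[i]) : 0 < e -> exists v, close_to F v e.
Proof. by move: e; apply/asboolP; exact: completionP. Qed.

Lemma completionPP F G : (forall u x, F u x = G u x :> R[i]) -> F = G.
Proof.
by move=> FG; apply: val_inj; apply/funext => u; apply: contCP => x; exact: FG.
Qed.

Lemma completionDE F G u x : (F + G) u x = (F u x : R[i]) + G u x :> R[i].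
Proof. by []. Qed.

Lemma completionZE (k : R[i]) F u x : (k *: F) u x = k * F u x :> R[i].
Proof. by []. Qed.

Lemma completionNE F u x : (- F) u x = - (F u x : R[i]) :> R[i].
Proof. by []. Qed.

Lemma completion_antilinear F u v (k : R[i]) x :
  F (k *: u + v) x = k^* * F u x + F v x :> R[i].
Proof.
apply/eqP; rewrite -subr_eq0; apply/eqP.
apply: (@small_norm_eq0 _ _ (N x (k *: u + v) + `|k| * N x u + N x v)) => e.
move=> /(completion_approx F)[w Fw].
have -> : (F (k *: u + v) x : R[i]) - (k^* * F u x + F v x) =
    ((F (k *: u + v) x : R[i]) - B (k *: u + v) w x) -
    k^* * ((F u x : R[i]) - B u w x) - ((F v x : R[i]) - B v w x).
  by rewrite ph_formDl ph_formZl; ring.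
rewrite !mulrDl -mulrA (le_trans (ler_normB _ _))// lerD//; last first.
  by rewrite mulrC.
rewrite (le_trans (ler_normB _ _))// lerD//; first by rewrite mulrC.
by rewrite normrM norm_conjC ler_wpM2l// mulrC.
Qed.

Lemma ph_norm_bounded u : exists2 M : R[i], 0 <= M & forall x, N x u <= M.
Proof.
have [M M0 MP] := ph_bounded u; exists (sqrtC M).
  by rewrite sqrtC_ge0.
move=> x; rewrite ler_sqrtC ?nnegrE ?ph_ge0//.
by rewrite -[leLHS]ger0_norm ?ph_ge0.
Qed.

(** The norm of [F] is to be the best constant in the Cauchy-Schwarz inequality, tested pointwise in
    [x]; [completion_is_sup_norm] identifies it with the norm of the Hilbert module. *)
Definition bound_set F : set R :=
  [set c | 0 <= c /\ forall u x, `|F u x : R[i]| <= c%:C%C * N x u].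

Definition completion_norm F : R[i] := (inf (bound_set F))%:C%C.
Local Notation n_ := completion_norm.

Lemma bound_set_ex F : bound_set F !=set0.
Proof.
have [v Fv] := completion_approx F ltr01.
have [M M0 vM] := ph_norm_bounded v.
have M1 : 0 <= M + 1 by rewrite addr_ge0.
exists (complex.Re (M + 1)); split.
  by rewrite -ler0c RRe_real// ger0_real.
move=> u x; rewrite RRe_real ?ger0_real//.
rewrite -[F u x : R[i]](subrK (B u v x : R[i])) (le_trans (ler_normD _ _))//.
rewrite mulrDl addrC lerD// (le_trans (ph_CS _ _ _))// mulrC.
by rewrite ler_wpM2r.
Qed.

Lemma bound_set_lb F : lbound (bound_set F) 0.
Proof. by move=> c []. Qed.

Lemma completion_norm_ge0 F : 0 <= n_ F.
Proof.
rewrite ler0c; apply: lb_le_inf; first exact: bound_set_ex.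
exact: bound_set_lb.
Qed.

Lemma completion_norm_apply F u x : `|F u x : R[i]| <= n_ F * N x u.
Proof.
have := ph_norm_ge0 x u; rewrite le_eqVlt => /predU1P[N0|N0].
  by have [c [_ /(_ u x)]] := bound_set_ex F; rewrite -N0 !mulr0.
rewrite -ler_pdivrMr//.
have r : `|F u x : R[i]| / N x u \is Num.real.
  by rewrite ger0_real// divr_ge0.
rewrite -(RRe_real r) lecR; apply: lb_le_inf; first exact: bound_set_ex.
move=> c [_ /(_ u x)]; rewrite -ler_pdivrMr//.
by rewrite -(RRe_real r) lecR.
Qed.

Lemma completion_norm_le F (c : R[i]) : 0 <= c ->
  (forall u x, `|F u x : R[i]| <= c * N x u) -> n_ F <= c.
Proof.
move=> c0 Fc; have cr : c = (complex.Re c)%:C%C by rewrite RRe_real// ger0_real.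
rewrite cr lecR; apply: ge_inf; first by exists 0; exact: bound_set_lb.
split; first by rewrite -ler0c -cr.
by rewrite -cr.
Qed.

Fact completion_normD F G : n_ (F + G) <= n_ F + n_ G.
Proof.
apply: completion_norm_le => [|u x]; first by rewrite addr_ge0 ?completion_norm_ge0.
rewrite completionDE (le_trans (ler_normD _ _))// mulrDl lerD//;
exact: completion_norm_apply.
Qed.

Fact completion_normZ (k : R[i]) F : n_ (k *: F) = `|k| * n_ F.
Proof.
have le k' G : n_ (k' *: G) <= `|k'| * n_ G.
  apply: completion_norm_le => [|u x]; first by rewrite mulr_ge0 ?completion_norm_ge0.
  rewrite completionZE normrM -mulrA ler_wpM2l//; exact: completion_norm_apply.
apply/eqP; rewrite eq_le le /=.
have [->|k0] := eqVneq k 0; first by rewrite normr0 mul0r completion_norm_ge0.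
rewrite mulrC -ler_pdivlMr ?normr_gt0// mulrC -normfV.
by rewrite -{1}[F](scalerK k0) le.
Qed.

Fact completion_norm0_eq0 F : n_ F = 0 -> F = 0.
Proof.
move=> F0; apply: completionPP => u x; apply/normr0_eq0/eqP.
rewrite eq_le normr_ge0 andbT.
by have := completion_norm_apply F u x; rewrite F0 mul0r.
Qed.

HB.instance Definition _ := Lmodule_isNormed.Build R[i] completion
  completion_normD completion_normZ completion_norm0_eq0.

Lemma completion_le F u x : `|F u x : R[i]| <= `|F| * N x u.
Proof. exact: completion_norm_apply. Qed.

(** For fixed [u] the values converge uniformly on X, since the seminorms of [u] are bounded. The
    error relative to [ph_norm x u] passes to the limit at each [u] and [x], hence the limit is
    again approximable. *)
Lemma completion_cauchy (Fn : nat -> completion) :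
  (forall e : R[i], 0 < e -> exists M, forall n m, (M <= n)%N -> (M <= m)%N ->
    `|Fn n - Fn m| <= e) ->
  exists F, forall e : R[i], 0 < e -> exists M, forall n, (M <= n)%N ->
    `|Fn n - F| <= e.
Proof.
move=> Fc.
have /choice[G GP] (u : V) : exists g : contC R X, forall e : R[i], 0 < e ->
    exists M, forall n, (M <= n)%N -> forall x, `|Fn n u x - g x| <= e.
  apply: contC_cauchy => e e0; have [K K0 uK] := ph_norm_bounded u.
  have K1 : 0 < K + 1 by rewrite ltr_wpDl.
  have [M HM] := Fc _ (divr_gt0 e0 K1); exists M => n m Mn Mm x.
  rewrite -completionNE -completionDE (le_trans (completion_le _ _ _))//.
  have -> : e = e / (K + 1) * (K + 1) by rewrite divfK// gt_eqF.
  by rewrite ler_pM// ?HM// (le_trans (uK x))// lerDl.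
have FG (e : R[i]) : 0 < e -> exists M, forall n, (M <= n)%N ->
    forall u x, `|(Fn n u x : R[i]) - G u x| <= e * N x u.
  move=> e0; have [M HM] := Fc _ e0; exists M => n Mn u x.
  apply: (@le_of_near _ _ _ 1) => // h h0 _; rewrite mul1r.
  have [M' HM'] := GP u _ h0; set m := maxn M M'.
  rewrite -(subrKA (Fn m u x : R[i])) (le_trans (ler_normD _ _))// lerD//.
    rewrite -completionNE -completionDE (le_trans (completion_le _ _ _))//.
    by rewrite ler_wpM2r// HM// leq_maxl.
  by rewrite HM'// leq_maxr.
have Ga : G \in approximable.
  apply/asboolP => e e0; have e2 : 0 < e / 2 by rewrite divr_gt0.
  have [M HM] := FG _ e2; have [v Fv] := completion_approx (Fn M) e2.
  exists v => u x; rewrite -(subrKA (Fn M u x : R[i])) (le_trans (ler_normD _ _))//.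
  by rewrite [e]splitr mulrDl lerD ?Fv// distrC HM.
exists (Completion Ga) => e e0; have [M HM] := FG _ e0; exists M => n Mn.
apply: completion_norm_le => [|u x]; first exact: ltW.
by rewrite completionDE completionNE HM.
Qed.

Fact completion_complete (S : set_system completion) :
  ProperFilter S -> cauchy S -> cvg S.
Proof.
move=> SF /cauchyP Sc.
pose eps n : R[i] := 2^-1 ^+ n.
have eps0 n : 0 < eps n by rewrite exprn_gt0// invr_gt0.
have [p Sp] : {p : nat -> completion & forall n, S (ball (p n) (eps n))}.
  by apply: (@choice _ _ (fun n q => S (ball q (eps n)))) => n; exact: Sc.
have epsM n m : (n <= m)%N -> eps m <= eps n.
  by move=> nm; rewrite ler_wiXn2l// ?invr_ge0// invf_le1// ler1n.
have eps_small (e : R[i]) : 0 < e -> exists M, forall n, (M <= n)%N -> eps n <= e.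
  move=> /complex_archi[M HM]; exists M => n Mn.
  exact: le_trans (epsM _ _ Mn) (ltW HM).
have [|F FP] := @completion_cauchy p.
  move=> e e0; have e2 : 0 < e / 2 by rewrite divr_gt0.
  have [M HM] := eps_small _ e2; exists M => n m Mn Mm.
  have [q [qn qm]] := filter_ex (filterI (Sp n) (Sp m)).
  move: qn qm; rewrite -!ball_normE /= => qn qm.
  rewrite -(subrKA q) [e]splitr (le_trans (ler_normD _ _))// lerD//.
    by rewrite (le_trans (ltW qn))// HM.
  by rewrite distrC (le_trans (ltW qm))// HM.
apply: (cvgP F); apply/cvgrPdist_le => e e0.
have e2 : 0 < e / 2 by rewrite divr_gt0.
have [M1 H1] := eps_small _ e2; have [M2 H2] := FP _ e2.
pose M := maxn M1 M2.
apply: filterS (Sp M) => q; rewrite -ball_normE /= => pq.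
rewrite -(subrKA (p M)) [e]splitr (le_trans (ler_normD _ _))// lerD//.
  by rewrite distrC H2// leq_maxr.
by rewrite (le_trans (ltW pq))// H1// leq_maxl.
Qed.

HB.instance Definition _ :=
  Uniform_isComplete.Build completion completion_complete.

(** Both approximations are tested on the vector [v - w] itself, which bounds the square of its
    seminorm by [e + e'] times the seminorm. *)
Lemma close_to_dist F v w (e e' : R[i]) x : 0 <= e -> 0 <= e' ->
  close_to F v e -> close_to F w e' -> N x (v - w) <= e + e'.
Proof.
move=> e0 e'0 Fv Fw; set u := v - w.
have : N x u ^+ 2 <= (e + e') * N x u.
  rewrite ph_normK -[leLHS]ger0_norm ?ph_ge0// {2}/u ph_formDr ph_formNr.
  rewrite -(subrKA (F u x : R[i])) (le_trans (ler_normD _ _))// mulrDl.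
  by rewrite lerD// distrC.
have := ph_norm_ge0 x u; rewrite le_eqVlt => /predU1P[<-|u0].
  by rewrite addr_ge0.
by rewrite expr2 ler_pM2r.
Qed.

Lemma close_to_norm F v (e : R[i]) x : 0 <= e ->
  close_to F v e -> N x v <= `|F| + e.
Proof.
move=> e0 Fv; have : N x v ^+ 2 <= (`|F| + e) * N x v.
  rewrite ph_normK -[leLHS]ger0_norm ?ph_ge0//.
  rewrite -[B v v x : R[i]](subrK (F v x : R[i])) (le_trans (ler_normD _ _))//.
  by rewrite mulrDl addrC lerD ?completion_le// distrC.
have := ph_norm_ge0 x v; rewrite le_eqVlt => /predU1P[<- _|v0].
  exact: addr_ge0.
by rewrite expr2 ler_pM2r.
Qed.

Lemma completionB F u v x : F (u - v) x = (F u x : R[i]) - F v x :> R[i].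
Proof. by rewrite addrC -scaleN1r completion_antilinear rmorphN1 mulN1r addrC. Qed.

(* [<F, G>] is the limit of [G v] as [v] tends to [F]. *)
Lemma completion_ip_ex F G : exists g : contC R X, forall v (e : R[i]) x,
  0 <= e -> close_to F v e -> `|(g x : R[i]) - G v x| <= `|G| * e.
Proof.
have e0 n : 0 < 2^-1 ^+ n :> R[i] by rewrite exprn_gt0// invr_gt0.
have /choice[v vP] (n : nat) := completion_approx F (e0 n).
have Gv n w (e : R[i]) x : 0 <= e -> close_to F w e ->
    `|(G (v n) x : R[i]) - G w x| <= `|G| * (2^-1 ^+ n + e).
  move=> e_ge0 Fw; rewrite -completionB (le_trans (completion_le _ _ _))//.
  by rewrite ler_wpM2l// (close_to_dist x (ltW (e0 n)) e_ge0 (vP n) Fw).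
have small (h : R[i]) : 0 < h ->
    exists M, forall n, (M <= n)%N -> `|G| * 2^-1 ^+ n <= h.
  move=> h0; have G1 : 0 < `|G| + 1 by rewrite ltr_wpDl.
  have [M HM] := complex_archi (divr_gt0 h0 G1); exists M => n Mn.
  have -> : h = (`|G| + 1) * (h / (`|G| + 1)) by rewrite mulrC divfK// gt_eqF.
  rewrite ler_pM// ?(ltW (e0 n)) ?lerDl//; apply: le_trans (ltW HM).
  by rewrite ler_wiXn2l// ?invr_ge0// invf_le1// ler1n.
have [|g gP] := @contC_cauchy R X (fun n => G (v n)).
  move=> h h0; have [M HM] := small _ (divr_gt0 h0 (ltr0Sn R[i] 1)).
  exists M => n m Mn Mm x; apply: le_trans (Gv n _ _ x (ltW (e0 m)) (vP m)) _.
  by rewrite mulrDr [h]splitr lerD// HM.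
exists g => w e x e_ge0 Fw; apply: (@le_of_near _ _ _ 2) => // h h0 _.
have [M1 H1] := gP _ h0; have [M2 H2] := small _ h0.
set n := maxn M1 M2.
rewrite -(subrKA (G (v n) x : R[i])) (le_trans (ler_normD _ _))//.
have -> : `|G| * e + 2 * h = h + (h + `|G| * e) by ring.
rewrite lerD//; first by rewrite distrC H1// leq_maxl.
rewrite (le_trans (Gv n _ _ x e_ge0 Fw))// mulrDr lerD2r.
by rewrite H2// leq_maxr.
Qed.

Definition completion_ip_fun F G : contC R X := projT1 (cid (completion_ip_ex F G)).
Local Notation ipf := completion_ip_fun.

Lemma completion_ip_close F G v (e : R[i]) x : 0 <= e -> close_to F v e ->
  `|(ipf F G x : R[i]) - G v x| <= `|G| * e.
Proof. by rewrite /ipf; case: cid => g /= gP; exact: gP. Qed.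

Lemma completion_ip_form F G v w (e : R[i]) x : 0 <= e -> close_to F v e ->
  close_to G w e ->
  `|(ipf F G x : R[i]) - B v w x| <= (`|F| + `|G| + e) * e.
Proof.
move=> e0 Fv Gw; rewrite -(subrKA (G v x : R[i])) (le_trans (ler_normD _ _))//.
have -> : (`|F| + `|G| + e) * e = `|G| * e + e * (`|F| + e) by ring.
rewrite lerD// ?completion_ip_close// (le_trans (Gw _ _))// ler_wpM2l//.
exact: close_to_norm.
Qed.

Fact completion_ip_linear F (k : R[i]) G G' :
  ipf F (k *: G + G') = k *: ipf F G + ipf F G'.
Proof.
apply: contCP => x; apply/eqP; rewrite -subr_eq0; apply/eqP.
apply: (@small_norm_eq0 _ _ (`|k *: G + G'| + `|k| * `|G| + `|G'|)) => e e0.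
have [v Fv] := completion_approx F e0.
have -> : ipf F (k *: G + G') x - (k *: ipf F G + ipf F G') x =
    ((ipf F (k *: G + G') x : R[i]) - (k *: G + G') v x) -
    k * ((ipf F G x : R[i]) - G v x) - ((ipf F G' x : R[i]) - G' v x).
  rewrite completionDE completionZE.
  rewrite -[X in _ - X = _]/(k * (ipf F G x : R[i]) + (ipf F G' x : R[i])).
  by ring.
rewrite !mulrDl (le_trans (ler_normB _ _))// lerD ?completion_ip_close ?(ltW e0)//.
rewrite (le_trans (ler_normB _ _))// lerD ?completion_ip_close ?(ltW e0)//.
by rewrite normrM -mulrA ler_wpM2l// completion_ip_close// ltW.
Qed.

Fact completion_ip_star F G : star (ipf F G) = ipf G F.
Proof.
apply: contCP => x; apply/eqP; rewrite -subr_eq0; apply/eqP.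
apply: (@small_norm_eq0_le1 _ _ (2 * (`|F| + `|G| + 1))) => e e0 e1.
have [v Fv] := completion_approx F e0; have [w Gw] := completion_approx G e0.
have -> : star (ipf F G) x - ipf G F x =
    ((ipf F G x : R[i]) - B v w x)^* - ((ipf G F x : R[i]) - B w v x).
  by rewrite rmorphB /= ph_star -[X in X - _ = _]/((ipf F G x : R[i])^*); ring.
have -> : 2 * (`|F| + `|G| + 1) * e =
    (`|F| + `|G| + 1) * e + (`|G| + `|F| + 1) * e by ring.
rewrite (le_trans (ler_normB _ _))// norm_conjC lerD//.
  apply: le_trans (completion_ip_form x (ltW e0) Fv Gw) _.
  by rewrite ler_pM2r// lerD2l.
apply: le_trans (completion_ip_form x (ltW e0) Gw Fv) _.
by rewrite ler_pM2r// lerD2l.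
Qed.

Lemma completion_ip_ge0 F x : (0 : R[i]) <= ipf F F x.
Proof.
apply: near_ge0 => h h0; set C := `|F| + `|F| + 1.
have C0 : 0 < C by rewrite ltr_wpDl// addr_ge0.
have D0 : 0 < C + h by rewrite addr_gt0.
have e0 : 0 < h / (C + h) by rewrite divr_gt0.
have e1 : h / (C + h) <= 1 by rewrite ler_pdivrMr// mul1r lerDr ltW.
have [v Fv] := completion_approx F e0.
exists (B v v x); rewrite ?ph_ge0// distrC.
apply: le_trans (completion_ip_form x (ltW e0) Fv Fv) _.
apply: (@le_trans _ _ (C * (h / (C + h)))); first by rewrite ler_pM2r// lerD2l.
by rewrite mulrCA ger_pMr// ler_pdivrMr// mul1r lerDl ltW.
Qed.

(** [ph_CS] for the approximants of [F], in the limit. It yields both definiteness and the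
    nontrivial half of the norm formula. *)
Lemma completion_CS F u x : `|F u x : R[i]| ^+ 2 <= B u u x * ipf F F x.
Proof.
have b0 := ph_norm_ge0 x u; set b := N x u in b0.
pose C := 2 * `|F| + 1; have C0 : 0 <= C by rewrite addr_ge0// mulr_ge0.
rewrite -ph_normK -/b.
(* In the constant, [C] is the error of [ipf F F], [2 * (|F| + 1)] comes from the cross term of the
   square, and 1 from [e ^+ 2 <= e]. *)
apply: (@le_of_near _ _ _ (b ^+ 2 * (C + 2 * (`|F| + 1) + 1))).
  by rewrite mulr_ge0 ?exprn_ge0// !addr_ge0// mulr_ge0// addr_ge0.
move=> e e0 e1; have [v Fv] := completion_approx F e0.
have Nv : N x v <= `|F| + 1.
  by apply: le_trans (close_to_norm x (ltW e0) Fv) _; rewrite lerD2l.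
have h1 : `|F u x : R[i]| <= b * (N x v + e).
  rewrite -[F u x : R[i]](subrK (B u v x : R[i])) (le_trans (ler_normD _ _))//.
  by rewrite mulrDr addrC lerD ?ph_CS// mulrC Fv.
have h2 : N x v ^+ 2 <= ipf F F x + C * e.
  rewrite ph_normK -lerBlDl.
  have r : B v v x - ipf F F x \is Num.real.
    by rewrite realB// ger0_real ?ph_ge0 ?completion_ip_ge0.
  apply: le_trans (real_ler_norm r) _; rewrite distrC.
  apply: le_trans (completion_ip_form x (ltW e0) Fv Fv) _.
  by rewrite ler_pM2r// /C mulr_natl mulr2n lerD2l.
apply: (@le_trans _ _ ((b * (N x v + e)) ^+ 2)).
  by rewrite ler_pXn2r ?nnegrE ?mulr_ge0 ?addr_ge0 ?(ltW e0).
rewrite exprMn.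
have -> : b ^+ 2 * ipf F F x + b ^+ 2 * (C + 2 * (`|F| + 1) + 1) * e =
    b ^+ 2 * ((ipf F F x : R[i]) + (C + 2 * (`|F| + 1) + 1) * e) by ring.
rewrite ler_wpM2l ?exprn_ge0//.
have -> : (N x v + e) ^+ 2 = N x v ^+ 2 + 2 * N x v * e + e ^+ 2 by ring.
have -> : (ipf F F x : R[i]) + (C + 2 * (`|F| + 1) + 1) * e =
    ((ipf F F x : R[i]) + C * e) + 2 * (`|F| + 1) * e + e by ring.
rewrite !lerD//; first by rewrite ler_pM2r// ler_pM2l.
by rewrite expr2 ger_pMl.
Qed.

Fact completion_ip_definite F : ipf F F = 0 -> F = 0.
Proof.
move=> F0; apply: completionPP => u x; apply/eqP.
rewrite -normr_eq0 -sqrf_eq0 eq_le exprn_ge0// andbT.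
have := completion_CS F u x; rewrite F0.
by rewrite -[contC_0 _ _ x]/(0 : R[i]) mulr0.
Qed.

Definition completion_ip : innerProduct (contC R X : starAlgType R) completion :=
  Build_innerProduct completion_ip_linear completion_ip_star
    completion_ip_definite.

Lemma completion_is_sup_norm F : is_sup_norm (completion_ip F F) (`|F| ^+ 2).
Proof.
split=> [|x|c c0 Fc]; first by rewrite exprn_ge0.
  apply: (@le_of_near _ _ _ (2 * `|F| + 1)).
    by rewrite addr_ge0// mulr_ge0.
  move=> e e0 e1; have [v Fv] := completion_approx F e0.
  rewrite -[completion_ip F F x : R[i]](subrK (F v x : R[i])).
  rewrite (le_trans (ler_normD _ _))//.
  apply: le_trans (lerD (completion_ip_close _ _ (ltW e0) Fv) (completion_le _ _ _)) _.
  apply: (@le_trans _ _ (`|F| * e + `|F| * (`|F| + e))).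
    by rewrite lerD2l ler_wpM2l// (close_to_norm x (ltW e0) Fv).
  rewrite mulrDr -expr2 addrCA lerD2l -mulrDl ler_pM2r//.
  by rewrite mulr_natl mulr2n lerDl.
have -> : c = sqrtC c ^+ 2 by rewrite sqrtCK.
rewrite ler_pXn2r ?nnegrE ?sqrtC_ge0//.
apply: completion_norm_le => [|u x]; first by rewrite sqrtC_ge0.
rewrite -(@ler_pXn2r _ 2%N) ?nnegrE ?mulr_ge0 ?sqrtC_ge0 ?ph_ge0//.
apply: le_trans (completion_CS F u x) _; rewrite exprMn sqrtCK ph_normK mulrC.
apply: ler_wpM2r; first exact: ph_ge0.
by rewrite -[leLHS]ger0_norm ?completion_ip_ge0//; exact: Fc.
Qed.

End completion.

(** * Operators on the completion *)

Section completion_module.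
Context (R : realType) (X : topologicalType) (V : preHilbertModule R X).
Hypothesis Xcpt : compact [set: X].
Implicit Types (F G : completion V) (f g : contC R X).

Fact completion_act_approximable F f :
  (fun u => smul (F u) f) \in @approximable R X V.
Proof.
apply/asboolP => e e0; have [M M0 fM] := contC_bounded f Xcpt.
have M1 : 0 < M + 1 by rewrite ltr_wpDl.
have [v Fv] := completion_approx F (divr_gt0 e0 M1).
exists (ph_act v f) => u x; rewrite ph_form_act.
have -> : smul (F u) f x = (F u x : R[i]) * f x :> R[i] by [].
rewrite -mulrBl normrM mulrC.
have -> : e * ph_norm x u = (M + 1) * (e / (M + 1) * ph_norm x u).
  by field; rewrite gt_eqF.
by rewrite ler_pM ?(le_trans (fM x))// lerDl.
Qed.

Definition completion_act F f := Completion (completion_act_approximable F f).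

Fact completion_actDl F G f :
  completion_act (F + G) f = completion_act F f + completion_act G f.
Proof. by apply: completionPP => u x; exact: mulrDl. Qed.
Fact completion_actDr F f g :
  completion_act F (f + g) = completion_act F f + completion_act F g.
Proof. by apply: completionPP => u x; exact: mulrDr. Qed.
Fact completion_actZl (k : R[i]) F f :
  completion_act (k *: F) f = k *: completion_act F f.
Proof. by apply: completionPP => u x; apply/esym; exact: mulrA. Qed.
Fact completion_actZr (k : R[i]) F f :
  completion_act F (k *: f) = k *: completion_act F f.
Proof. by apply: completionPP => u x; exact: mulrCA. Qed.
Fact completion_actA F f g :
  completion_act F (smul f g) = completion_act (completion_act F f) g.
Proof. by apply: completionPP => u x; exact: mulrA. Qed.
Fact completion_act1 F : completion_act F contC_1 = F.
Proof. by apply: completionPP => u x; exact: mulr1. Qed.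

Fact completion_ip_act F G f :
  completion_ip V F (completion_act G f) = smul (completion_ip V F G) f.
Proof.
apply: contCP => x; apply/eqP; rewrite -subr_eq0; apply/eqP.
apply: (@small_norm_eq0 _ _ (`|completion_act G f| + `|G| * `|f x : R[i]|)) => e e0.
have [v Fv] := completion_approx F e0.
have -> : completion_ip V F (completion_act G f) x -
      smul (completion_ip V F G) f x =
    ((completion_ip V F (completion_act G f) x : R[i]) - completion_act G f v x) -
    ((completion_ip V F G x : R[i]) - G v x) * f x.
  rewrite -[completion_act G f v x]/((G v x : R[i]) * f x).
  rewrite -[X in _ - X = _]/((completion_ip V F G x : R[i]) * f x).
  by ring.
rewrite [leRHS]mulrDl (le_trans (ler_normB _ _))// lerD//.
  exact: completion_ip_close (ltW e0) Fv.
rewrite normrM mulrAC ler_wpM2r//; exact: completion_ip_close (ltW e0) Fv.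
Qed.

Definition completion_module : hilbertModule R X := @Build_hilbertModule R X
  (completion V) (completion_ip V) (@completion_ip_ge0 R X V)
  (@completion_is_sup_norm R X V) completion_act completion_actDl completion_actDr
  completion_actZl completion_actZr completion_actA completion_act1
  completion_ip_act.

Section operator.
Context (T T' : V -> V) (c : R[i]).
Hypothesis c0 : 0 <= c.
Hypothesis T_adj : forall u v x, ph_form (T' u) v x = ph_form u (T v) x :> R[i].
Hypothesis T'_le : forall u x, ph_norm x (T' u) <= c * ph_norm x u.

Lemma close_to_op F v (e : R[i]) : 0 <= e -> close_to F v e ->
  close_to (fun u => F (T' u)) (T v) (c * e).
Proof.
move=> e0 Fv u x; rewrite -T_adj (le_trans (Fv _ _))// mulrAC mulrC.
by rewrite ler_wpM2r.
Qed.

Fact completion_op_approximable F : (fun u => F (T' u)) \in @approximable R X V.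
Proof.
apply/asboolP => e e0; have c1 : 0 < c + 1 by rewrite ltr_wpDl.
have e1 := divr_gt0 e0 c1; have [v Fv] := completion_approx F e1.
exists (T v); apply: close_toW (close_to_op (ltW e1) Fv).
by rewrite mulrCA ger_pMr// ler_pdivrMr// mul1r lerDl.
Qed.

(** Since [F] stands for the pairing of [u] with [F], the extension of [T] is precomposition with
    its adjoint [T']. *)
Definition completion_op F := Completion (completion_op_approximable F).

End operator.

Section adjoint.
Context (T T' : V -> V) (c c' : R[i]).
Hypothesis c0 : 0 <= c.
Hypothesis c'0 : 0 <= c'.
Hypothesis T_adj : forall u v x, ph_form (T' u) v x = ph_form u (T v) x :> R[i].
Hypothesis T'_adj : forall u v x, ph_form (T u) v x = ph_form u (T' v) x :> R[i].
Hypothesis T'_le : forall u x, ph_norm x (T' u) <= c * ph_norm x u.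
Hypothesis T_le : forall u x, ph_norm x (T u) <= c' * ph_norm x u.

Local Notation op := (completion_op c0 T_adj T'_le).
Local Notation op' := (completion_op c'0 T'_adj T_le).

Fact completion_op_adj F G :
  hm_ip completion_module (op F) G = hm_ip completion_module F (op' G).
Proof.
apply: contCP => x; apply/eqP; rewrite -subr_eq0; apply/eqP.
apply: (@small_norm_eq0 _ _ (`|G| * c + `|op' G|)) => e e0.
have [v Fv] := completion_approx F e0.
rewrite -(subrKA (G (T v) x : R[i])) mulrDl (le_trans (ler_normD _ _))// lerD//.
  rewrite -mulrA; apply: completion_ip_close; first by rewrite mulr_ge0// ltW.
  exact: close_to_op (ltW e0) Fv.
by rewrite distrC; exact: completion_ip_close (ltW e0) Fv.
Qed.

Definition completion_adjointable : adjointable (hm_ip completion_module) :=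
  @Adjointable _ _ _ (hm_ip completion_module) op op' completion_op_adj.

(** The image of [V] is dense in the completion, hence in the fibre, so the induced operator is
    determined by its effect on vectors of [V]. *)
Lemma fibre_completion_eq0 x :
  fibre_op completion_adjointable x = 0 <->
    forall v, ph_form (T v) (T v) x = 0 :> R[i].
Proof.
split=> [T0 v|T0].
  have va : (fun u => ph_form u v) \in @approximable R X V.
    apply/asboolP => e e0; exists v => u y.
    by rewrite subrr normr0 mulr_ge0 ?ph_norm_ge0// ltW.
  pose F : completion V := Completion va.
  have Fv : close_to F v 0 by move=> u y; rewrite subrr normr0 mul0r.
  have := fibre_op_pi completion_adjointable x F; rewrite T0 /= => F0.
  have /fibre_piP : fibre_pi x (0 : completion_module) =
      fibre_pi x (op F : completion_module).
    rewrite -F0; apply: (addIr (fibre_pi x (0 : completion_module))).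
    by rewrite -fibre_piD !add0r.
  rewrite sub0r fibre_formNl fibre_formNr opprK /fibre_form /= => opF0.
  have opv : close_to (op F) (T v) 0.
    by have := close_to_op T_adj T'_le (lexx 0) Fv; rewrite mulr0.
  have := completion_ip_form x (lexx 0) opv opv.
  by rewrite mulr0 opF0 sub0r normrN normr_le0 => /eqP.
apply: adjointableP => q; rewrite -(fibre_reprK q) fibre_op_pi.
rewrite -[RHS]/(0 : fibre _ x).
have <- : fibre_pi x (0 : completion_module) = 0.
  by apply: (addIr (fibre_pi x (0 : completion_module))); rewrite -fibre_piD !add0r.
apply/fibre_piP; rewrite subr0; set F := fibre_repr q.
apply: (@small_norm_eq0_le1 _ _ ((`|op F| + `|op F| + c) * c)) => e e0 e1.
have [v Fv] := completion_approx F e0.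
have opv : close_to (op F) (T v) (c * e) := close_to_op T_adj T'_le (ltW e0) Fv.
have := completion_ip_form x (mulr_ge0 c0 (ltW e0)) opv opv.
rewrite T0 subr0 => /le_trans; apply; rewrite mulrA ler_pM2r//.
by rewrite ler_wpM2r// lerD2l ler_piMr.
Qed.

End adjoint.
End completion_module.

(** * The GNS module of all fields of functionals *)

(** Equal kernels make the map sending [rho a] to [tau a] well defined and injective; outside the
    range of [rho] it takes the dummy value 0. *)
Lemma star_isomorphic_ranges (R : realType) (A B C : starAlgType R)
    (rho : A -> B) (tau : A -> C) :
  star_morphism rho -> star_morphism tau ->
  (forall a, rho a = 0 <-> tau a = 0) ->
  star_isomorphic (range rho) (range tau).
Proof.
move=> [rhoL rhoM rhoS] [tauL tauM tauS] ker.
have morB (D : starAlgType R) (f : A -> D) :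
    (forall (k : R[i]) a b, f (k *: a + b) = k *: f a + f b) ->
    forall a b, f (a - b) = f a - f b.
  by move=> fL a b; rewrite addrC -scaleN1r fL scaleN1r addrC.
have eqE a b : rho a = rho b <-> tau a = tau b.
  split=> /eqP; rewrite -subr_eq0 -morB// => /eqP/ker/eqP;
  by rewrite morB// subr_eq0 => /eqP.
have /choice[f fP] (b : B) : exists c : C, forall a, rho a = b -> tau a = c.
  have [[a ab]|no] := pselect (exists a, rho a = b); last first.
    by exists 0 => a ab; case: no; exists a.
  by exists (tau a) => a' a'b; apply/eqE; rewrite a'b ab.
have fE a : f (rho a) = tau a by rewrite -(fP (rho a) a).
exists f; split.
- split.
  + by move=> _ [a _ <-]; rewrite fE; exists a.
  + by move=> x y; rewrite !inE => -[a _ <-] [b _ <-]; rewrite !fE => /eqE.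
  + by move=> _ [a _ <-]; exists (rho a); [exists a|rewrite fE].
- by move=> k _ _ [a _ <-] [b _ <-]; rewrite -rhoL !fE tauL.
- by move=> _ _ [a _ <-] [b _ <-]; rewrite -rhoM !fE tauM.
- by move=> _ [a _ <-]; rewrite -rhoS !fE tauS.
Qed.

Lemma induced_rep_morphism (R : realType) (X : topologicalType)
    (A : CXAlgebra R X) (E : hilbertModule R X)
    (pi : A -> adjointable (hm_ip E)) x :
  star_morphism pi -> star_morphism (induced_rep pi x).
Proof.
move=> [piL piM piS]; split=> [k a b|a b|a].
- apply: adjointableP => q; rewrite -(fibre_reprK q) /induced_rep fibre_op_pi piL.
  by rewrite /= fibre_piD fibre_piZE !fibre_reprK.
- apply: adjointableP => q; rewrite -(fibre_reprK q) /induced_rep fibre_op_pi piM.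
  rewrite -[RHS]/(fibre_op (pi a) x (fibre_op (pi b) x (fibre_pi x (fibre_repr q)))).
  by rewrite !fibre_op_pi.
- by apply: adjointableP => q; rewrite /induced_rep piS.
Qed.

Section finite_support.
Context (R : realType) (A : lmodType R[i]) (I : choiceType).

Definition finitely_supported : {pred I -> A} :=
  [pred e | `[< finite_set [set i | e i != 0] >]].

Fact finitely_supported_submod : submod_closed finitely_supported.
Proof.
split=> [|k e f /asboolP fe /asboolP ff]; apply/asboolP.
  suff -> : [set i | (0 : I -> A) i != 0] = set0 by [].
  by apply/seteqP; split=> i //=; rewrite eqxx.
have fu : finite_set ([set i | e i != 0] `|` [set i | f i != 0]).
  by rewrite finite_setU.
apply: sub_finite_set fu => i /=.
have -> : (k *: e + f) i = k *: e i + f i by [].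
have [->|e0] := eqVneq (e i) 0; last by left.
by rewrite scaler0 add0r; right.
Qed.

HB.instance Definition _ := GRing.isSubmodClosed.Build R[i] (I -> A)
  finitely_supported finitely_supported_submod.

Record fin_sum := FinSum {
  fin_sum_fun :> I -> A ;
  fin_sumP : fin_sum_fun \in finitely_supported
}.

HB.instance Definition _ := [isSub for fin_sum_fun].
HB.instance Definition _ := [Choice of fin_sum by <:].
HB.instance Definition _ := [SubChoice_isSubLmodule of fin_sum by <:].

Implicit Types u v w : fin_sum.

Lemma fin_sumE u v : u =1 v -> u = v.
Proof. by move=> uv; apply: val_inj; apply/funext. Qed.

Definition fsupp u : {fset I} := fset_set [set i | u i != 0].

Lemma notin_fsupp u i : i \notin fsupp u -> u i = 0.
Proof.
rewrite in_fset_set; last by apply/asboolP; exact: fin_sumP.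
by rewrite notin_setE /= => /negP; rewrite negbK => /eqP.
Qed.

Fact fin_sum_map_subproof (h : A -> A) u : h 0 = 0 ->
  (fun i => h (u i)) \in finitely_supported.
Proof.
move=> h0; apply/asboolP; have /asboolP := fin_sumP u.
apply: sub_finite_set => i /=; apply: contraNN => /eqP ->.
by rewrite h0.
Qed.

Definition fin_sum_map (h : A -> A) (h0 : h 0 = 0) u :=
  FinSum (fin_sum_map_subproof u h0).

Fact fin_sum_delta_subproof i0 (a : A) :
  (fun i => if i == i0 then a else 0) \in finitely_supported.
Proof.
apply/asboolP; apply: sub_finite_set (finite_set1 i0) => i /=.
by have [->//|_] := eqVneq i i0; rewrite eqxx.
Qed.

Definition fin_sum_delta i0 a := FinSum (fin_sum_delta_subproof i0 a).

End finite_support.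

Section gns.
Context (R : realType) (X : topologicalType) (A : CXAlgebra R X).
Context (H : X -> hilbertSpace R).
Context (sigma : forall x, A -> adjointable (hs_ip (H x))).
Hypothesis sigma_bundle : lsc_bundle sigma.
Hypothesis Xcpt : compact [set: X].

Let sM x : star_morphism (sigma x) := lscb_morph sigma_bundle x.

(** All fields at once, so that no vector functional is missed. [{classic _}] supplies the choice
    structure required by finite sets of indices. *)
Definition field_index :=
  {classic {phi : A -> contC R X | functional_field sigma phi}}.
Local Notation I := field_index.

Definition field_at (i : I) : A -> contC R X := sval (i : {phi | _}).

Lemma field_atP i : functional_field sigma (field_at i).
Proof. exact: svalP. Qed.

Local Notation V0 := (fin_sum A I).
Implicit Types (u v w : V0).

Lemma field_at0 i x : field_at i 0 x = 0 :> R[i].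
Proof.
apply: (functional_field_eq0 (field_atP i)); apply: adjointableP => h.
exact: (rep0 (sM x)).
Qed.

Definition gns_form u v : contC R X :=
  \sum_(i <- fsupp v) field_at i (smul (star (u i)) (v i)).

Lemma gns_formE (D : {fset I}) u v x : (fsupp v `<=` D)%fset ->
  gns_form u v x = \sum_(i <- D) (field_at i (smul (star (u i)) (v i)) x : R[i]) :> R[i].
Proof.
move=> vD; rewrite /gns_form contC_sumE; apply: big_fset_incl => // i _ iv.
by rewrite (notin_fsupp iv) smul0r field_at0.
Qed.

Fact gns_linear u (k : R[i]) v w x :
  gns_form u (k *: v + w) x = k * gns_form u v x + gns_form u w x :> R[i].
Proof.
pose D := (fsupp (k *: v + w)%R `|` (fsupp v `|` fsupp w))%fset.
rewrite !(@gns_formE D) /D ?fsubsetUl//; last 2 first.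
- by rewrite fsubsetU// fsubsetUr orbT.
- by rewrite fsubsetU// fsubsetUl orbT.
rewrite mulr_sumr -big_split /=; apply: eq_bigr => i _.
rewrite -[X in smul _ X]/(k *: v i + w i).
by rewrite smulDr smulZr (functional_field_linear sM (field_atP i)).
Qed.

Fact gns_star u v x : (gns_form u v x : R[i])^* = gns_form v u x :> R[i].
Proof.
rewrite !(@gns_formE (fsupp u `|` fsupp v)%fset) ?fsubsetUl ?fsubsetUr//.
rewrite rmorph_sum; apply: eq_bigr => i _ /=.
by rewrite -(functional_field_star sM (field_atP i)) starM starK.
Qed.

Fact gns_ge0 u x : (0 : R[i]) <= gns_form u u x.
Proof.
rewrite (@gns_formE (fsupp u))// sumr_ge0// => i _.
exact: (functional_field_ge0 sM (field_atP i)).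
Qed.

(** The function [f - f(x)] vanishes at [x], so [sigma x] kills its product with [a]; unitality of
    the structure map evaluates the constant part. *)
Lemma rep_cx_act x f (a : A) h : sigma x (cx_act f a) h = (f x : R[i]) *: sigma x a h.
Proof.
have [cL _ _] := cx_morph A.
pose g : contC R X := - (f x : R[i]) *: contC_1 + f.
have ga : cx_act g a = - (f x : R[i]) *: a + cx_act f a.
  by rewrite /cx_act /g cL cx_unital.
have : sigma x (cx_act g a) = 0.
  apply: (lscb_fibre sigma_bundle).
  rewrite -[g x]/(- (f x : R[i]) * 1 + f x); ring.
rewrite ga => /(congr1 (fun T => op T h)).
rewrite (rep_linear (sM x)) /= => /eqP.
by rewrite scaleNr addrC subr_eq0 => /eqP.
Qed.

Lemma cx_act0 f : cx_act f (0 : A) = 0.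
Proof. by rewrite /cx_act -{1}(scale0r (0 : A)) mult_lZ scale0r. Qed.

Definition gns_act v f : V0 := fin_sum_map (cx_act0 f) v.

(** The functional at [x] kills the kernel of [sigma x]. This is how C(X)-linearity, known only in
    the representations, reaches the form. *)
Lemma field_at_scale i x (k : R[i]) a b :
  (forall h, sigma x b h = k *: sigma x a h) ->
  field_at i b x = k * field_at i a x :> R[i].
Proof.
move=> ab; apply/eqP; rewrite -subr_eq0 -mulNr addrC.
rewrite -(functional_field_linear sM (field_atP i)); apply/eqP.
apply: (functional_field_eq0 (field_atP i)); apply: adjointableP => h.
by rewrite (rep_linear (sM x)) ab scaleNr addNr.
Qed.

Fact gns_form_act u v f x :
  gns_form u (gns_act v f) x = (gns_form u v x : R[i]) * f x :> R[i].
Proof.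
rewrite !(@gns_formE (fsupp v `|` fsupp (gns_act v f))%fset)
  ?fsubsetUl ?fsubsetUr//.
rewrite mulr_suml; apply: eq_bigr => i _; rewrite mulrC.
apply: field_at_scale => h.
by rewrite !(rep_smul (sM x)) rep_cx_act adj_opZ.
Qed.

Fact gns_bounded u : exists2 M : R[i], 0 <= M &
  forall x, `|gns_form u u x : R[i]| <= M.
Proof. exact: contC_bounded. Qed.

Definition gns_module : preHilbertModule R X := Build_preHilbertModule
  gns_linear gns_star gns_ge0 gns_bounded gns_form_act.

Definition gns_mul (a : A) (u : gns_module) : gns_module :=
  fin_sum_map (smul0r a) u.

Fact gns_mul_adj a (u v : gns_module) x :
  ph_form (gns_mul (star a) u) v x = ph_form u (gns_mul a v) x :> R[i].
Proof.
rewrite /= !(@gns_formE (fsupp v `|` fsupp (gns_mul a v))%fset)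
  ?fsubsetUl ?fsubsetUr//.
by apply: eq_bigr => i _ /=; rewrite starM starK smulA.
Qed.

Fact gns_mul_adj' a (u v : gns_module) x :
  ph_form (gns_mul a u) v x = ph_form u (gns_mul (star a) v) x :> R[i].
Proof. by rewrite -gns_mul_adj starK. Qed.

Fact gns_mul_le a (u : gns_module) x :
  ph_norm x (gns_mul a u) <= 2 * `|a| * ph_norm x u.
Proof.
rewrite -(@ler_pXn2r _ 2%N) ?nnegrE ?mulr_ge0 ?ph_norm_ge0//.
rewrite exprMn !ph_normK /= !(@gns_formE (fsupp u `|` fsupp (gns_mul a u))%fset)
  ?fsubsetUl ?fsubsetUr//.
rewrite mulr_sumr; apply: ler_sum => i _ /=.
exact: (functional_field_op_le sM (field_atP i)).
Qed.

Definition gns_hilbert := completion_module gns_module Xcpt.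

Definition gns_rep (a : A) : adjointable (hm_ip gns_hilbert) :=
  completion_adjointable Xcpt
    (mulr_ge0 (ler0n _ 2) (normr_ge0 (star a))) (mulr_ge0 (ler0n _ 2) (normr_ge0 a))
    (@gns_mul_adj a) (@gns_mul_adj' a)
    (@gns_mul_le (star a)) (@gns_mul_le a).

Lemma gns_mul_cx_act f a (u v : gns_module) x :
  gns_form u (gns_mul (cx_act f a) v) x =
    (gns_form u (gns_mul a v) x : R[i]) * f x :> R[i].
Proof.
rewrite !(@gns_formE (fsupp (gns_mul a v) `|` fsupp (gns_mul (cx_act f a) v))%fset)
  ?fsubsetUl ?fsubsetUr//.
rewrite mulr_suml; apply: eq_bigr => i _; rewrite mulrC.
apply: field_at_scale => h.
by rewrite !(rep_smul (sM x)) rep_cx_act adj_opZ.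
Qed.

Lemma gns_rep_representation : CX_representation gns_rep.
Proof.
split; first split=> [k a b|a b|a].
- apply: adjointableP => F; apply: completionPP => u x.
  have -> : (gns_rep (k *: a + b) F : completion gns_module) u x =
    F (gns_mul (star (k *: a + b)) u) x by [].
  have -> : gns_mul (star (k *: a + b)) u =
      k^* *: gns_mul (star a) u + gns_mul (star b) u.
    apply: fin_sumE => i.
    rewrite -[RHS]/(k^* *: smul (star a) (u i) + smul (star b) (u i)) /=.
    by rewrite starD starZ smulDl smulZl.
  by rewrite completion_antilinear conjCK.
- apply: adjointableP => F; apply: completionPP => u x.
  congr ((F : completion gns_module) _ x); apply: fin_sumE => i /=.
  by rewrite starM smulA.
- apply: adjointableP => F; apply: completionPP => u x.
  by congr ((F : completion gns_module) _ x); apply: fin_sumE => i /=; rewrite starK.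
move=> f a F; apply: completionPP => u x.
rewrite -[LHS]/((F : completion gns_module) (gns_mul (star (cx_act f a)) u) x).
rewrite -[RHS]/(((F : completion gns_module) (gns_mul (star a) u) x : R[i]) * f x).
set u1 := gns_mul (star (cx_act f a)) u; set u2 := gns_mul (star a) u.
(* The identity holds for the form by [gns_mul_cx_act]; an element of the completion inherits it
   through its approximants [v]. *)
apply/eqP; rewrite -subr_eq0; apply/eqP.
apply: (@small_norm_eq0 _ _ (ph_norm x u1 + ph_norm x u2 * `|f x : R[i]|)) => e e0.
have [v Fv] := completion_approx (F : completion gns_module) e0.
have uv : ph_form u1 v x = (ph_form u2 v x : R[i]) * f x :> R[i].
  by rewrite !gns_mul_adj /= gns_mul_cx_act.
have -> : ((F : completion gns_module) u1 x : R[i]) -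
      ((F : completion gns_module) u2 x : R[i]) * f x =
    (((F : completion gns_module) u1 x : R[i]) - ph_form u1 v x) -
    (((F : completion gns_module) u2 x : R[i]) - ph_form u2 v x) * f x.
  by rewrite uv; ring.
rewrite [leRHS]mulrDl (le_trans (ler_normB _ _))// lerD//.
  by rewrite mulrC Fv.
by rewrite normrM mulrAC ler_wpM2r// mulrC Fv.
Qed.

Hypothesis field_ex : forall x (s : seq (H x)), mass s <= 1 ->
  exists2 phi, functional_field sigma phi & forall a, phi a x = psi sigma s a.

(** As [A] may lack a unit, no vector of [V0] represents the functional of [h] itself. The vector
    with entry [star a] replaces it: if [a] acts by zero, [sigma x] of [smul a (star a)] kills [h],
    and pairing with [h] gives [sigma x (star a) h = 0]. Conversely, fields vanish on the kernel of
    [sigma x]. *)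
Lemma gns_rep_ker x a : induced_rep gns_rep x a = 0 <-> sigma x a = 0.
Proof.
rewrite /induced_rep fibre_completion_eq0; split=> [a0|a0 v]; last first.
  rewrite /= (@gns_formE (fsupp (gns_mul a v)))// big1// => i _ /=.
  apply: (functional_field_eq0 (field_atP i)); apply: adjointableP => h.
  rewrite !(rep_smul (sM x)) a0.
  by rewrite -[X in sigma x _ X]/(0 : H x) -(scale0r 0) adj_opZ scale0r.
suff sa0 h : sigma x (star a) h = 0.
  apply: adjointableP => h; apply: (@ip_injl _ _ _ (hs_ip (H x))) => k.
  by rewrite (rep_star (sM x)) sa0 ip0r /= ip0l.
(* This scaling brings [h] into the unit ball without a square root and without excluding
   [h = 0]. *)
pose t := (1 + rip h h)^-1.
have t0 : 0 < 1 + rip h h by rewrite ltr_pwDl ?rip_ge0.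
have [|phi phiF phix] := @field_ex x [:: t%:C%C *: h].
  rewrite /mass big_seq1 ripZl ripZr mulrA -expr2 /t exprVn mulrC.
  rewrite ler_pdivrMr ?exprn_gt0//.
  by rewrite mul1r expr2; have := rip_ge0 h; nra.
pose i : I := exist _ phi phiF.
have := a0 (fin_sum_delta i (star a)).
rewrite /= (@gns_formE [fset i]%fset); last first.
  apply/fsubsetP => j; rewrite inE; apply: contraTT => ji.
  rewrite in_fset_set; last by apply/asboolP; exact: fin_sumP.
  by rewrite notin_setE /= (negbTE ji) smul0r eqxx.
rewrite big_seq_fset1; have -> : gns_mul a (fin_sum_delta i (star a)) i = smul a (star a).
  by rewrite /= eqxx.
rewrite -[field_at i]/phi phix psi_sqE// big_seq1.
move/eqP; rewrite sqrf_eq0 normr_eq0 adj_opZ scaler_eq0.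
rewrite -[0]/(0%:C%C) (inj_eq (@complexI R)) invr_eq0 gt_eqF//= => /eqP ah.
have := hs_norm (sigma x (star a) h); rewrite (rep_star (sM x)) starK.
rewrite -(rep_smul (sM x)) ah ip0r => /eqP.
by rewrite sqrf_eq0 normr_eq0 => /eqP.
Qed.

End gns.

Theorem theorem2p2 (R : realType) (X : topologicalType) (A : CXAlgebra R X)
    (H : X -> hilbertSpace R)
    (sigma : forall x, A -> adjointable (hs_ip (H x))) :
  compact [set: X] -> hausdorff_space X -> metrizable R X ->
  separable_space A -> lsc_bundle sigma ->
  exists (E : hilbertModule R X) (pi : A -> adjointable (hm_ip E)),
    CX_representation pi /\
    forall x, star_isomorphic (range (induced_rep pi x)) (range (sigma x)).
Proof.
move=> Xcpt _ [d [d0 dC dT d_nbhs]] Asep bundle.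
have sM x := lscb_morph bundle x.
exists (gns_hilbert bundle Xcpt), (gns_rep bundle Xcpt).
split; first exact: gns_rep_representation.
move=> x; apply: star_isomorphic_ranges => //.
  by apply: induced_rep_morphism; have [] := gns_rep_representation bundle Xcpt.
move=> a; apply: gns_rep_ker => y s s1.
exact: (functional_field_exists sM (lscb_lsc bundle) d0 dC dT d_nbhs Xcpt Asep s1).
Qed.
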